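(* Suppose $N$ and $m$ are both odd. For $k\ge1$ let $a_k$ (respectively $b_k$) be the dimension of the Hodge degree $k$ part of the defect $0$ homology $H_0$ (respectively defect $1$ homology $H_1$) of the two-loop hairy graph-complex $0\to\mathcal C_2\to\mathcal C_1\to\mathcal C_0\to 0$ with rational coefficients. Then $$a_k=\begin{cases}\lceil\frac{k+1}{6}\rceil & k\equiv0\bmod2,\\ 0& k\equiv1\bmod2,\end{cases}\qquad b_k=\begin{cases}0& k\equiv0\bmod2,\\ \lceil\frac{k}{6}\rceil & k\equiv1\bmod2.\end{cases}$$
   Context: Let $m,N$ be positive integers; all coefficients are in $\mathbb Q$. Graph-complex $\mathcal E^{m,N}_\pi$. It is spanned by connected graphs (self-loops and multiple edges allowed) with a non-empty finite set of unlabeled external vertices of valence $1$ and a possibly empty finite set of unlabeled internal vertices of valence $\ge3$. The orientation set of a graph is the union of its external vertices (each of degree $-m$), internal vertices (each of degree $-N$) and edges (each of degree $N-1$). An orientation of a graph is a total order of its orientation set together with an orientation of every edge. Isomorphic oriented graphs (isomorphism respecting adjacency, edge orientations and the order) are identified. One takes the quotient of the $\mathbb Q$-vector space spanned by isomorphism classes of oriented graphs by the relations: reversing the orientation of one edge multiplies by $(-1)^N$; permuting the orientation set multiplies by the Koszul sign of the permutation, computed from the degrees of the elements. The differential $\partial\Upsilon$ is the sum, over all internal vertices $v$ and all unordered partitions of the half-edges at $v$ into two sets of size $\ge2$, of the graph obtained by replacing $v$ by a new edge joining two vertices, the half-edges of one set being attached to one endpoint and those of the other set to the other endpoint; one endpoint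 is regarded as the old vertex $v$, the other one as the new vertex; the new vertex and the new edge are added as the first and second elements of the ordered orientation set, and the new edge is oriented from the old vertex to the new one (the choice of which endpoint is new does not matter). Hairy graphs. An edge of a connected graph is tree-type if removing it disconnects the graph into two parts, exactly one of which is a tree. The frame is the subgraph generated by the edges that are not tree-type. A hair is a tree-type edge one of whose endpoints is univalent and whose other endpoint lies in the frame and has no other tree-type edges adjacent to it. A vertex is a cut vertex if removing it (as a point of the topological space) disconnects the graph. A two-loop hairy graph is a connected graph (self-loops and multiple edges allowed) with a non-empty finite set of unlabeled external vertices of valence $1$ and a finite set of unlabeled internal vertices of valence $\ge3$, of first Betti number $2$, whose frame has no cut vertices and all of whose tree-type edges are hairs; its frame is a (subdivided) $\Theta$-graph. The Hodge degree is the number of external vertices (i.e. of hairs). The defect is $\sum_v(|v|-3)$ over the internal vertices $v$, where $|v|$ is the valence; for two-loop hairy graphs it is $0$, $1$ or $2$. Let $\mathcal C_i\subset\mathcal E^{m,N}_\pi$ be the span of the two-loop hairy graphs of defect $i$. The differential $\partial$ preserves Hodge degree and lowers the defect by $1$, giving the two-loop hairy graph-complex $0\to\mathcal C_2\xrightarrow{\partial_2}\mathcal C_1\xrightarrow{\partial_1}\mathcal C_0\to0$, with $H_i=\ker\partial_i/\operatorname{im}\partial_{i+1}$. *)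

(* Defs.v *)
From HB Require Import structures.
From mathcomp.multinomials Require Import freeg.
From mathcomp Require Import all_boot all_order all_algebra.

Set Implicit Arguments.
Unset Strict Implicit.
Unset Printing Implicit Defensive.

Import Order.TTheory GRing.Theory Num.Theory.

Local Open Scope ring_scope.

(* An oriented graph.  [ends e] is the pair (source, target) of the edge [e],
   so it carries both the adjacency and the edge orientations; [ordr] lists the
   orientation set, which consists of all the vertices and all the edges, in
   increasing order (that it lists everything exactly once is required in
   [admissible]).  Vertices and edges are numbered only in order to have a type
   of graphs; the numbering is forgotten by [ograph_iso]. *)
Record ograph := OGraph {
  nv : nat;
  ne : nat;
  ends : {ffun 'I_ne -> 'I_nv * 'I_nv};
  ordr : seq ('I_nv + 'I_ne)
}.

Definition ograph_code (G : ograph) :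
    {n : nat & {p : nat & ({ffun 'I_p -> 'I_n * 'I_n} * seq ('I_n + 'I_p))%type}} :=
  existT _ (nv G) (existT _ (ne G) (ends G, ordr G)).

Definition ograph_decode
    (c : {n : nat & {p : nat & ({ffun 'I_p -> 'I_n * 'I_n} * seq ('I_n + 'I_p))%type}}) :
    ograph :=
  OGraph (projT2 (projT2 c)).1 (projT2 (projT2 c)).2.

Lemma ograph_codeK : cancel ograph_code ograph_decode.
Proof. by case. Qed.

HB.instance Definition _ := Countable.copy ograph (can_type ograph_codeK).

Notation vert G := 'I_(nv G).
Notation edge G := 'I_(ne G).

(* The vertices and the (open) edges are the cells of the topological space of
   the graph.  The cells also form the orientation set. *)
Notation cell G := (vert G + edge G)%type.

(* (e, false) is the half of [e] at its source, (e, true) the one at its target. *)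
Notation half_edge G := (edge G * bool)%type.

Section Graphs.

Variable G : ograph.

Definition at_vertex (h : half_edge G) : vert G :=
  if h.2 then (ends G h.1).2 else (ends G h.1).1.

Definition halves (v : vert G) : {set half_edge G} := [set h | at_vertex h == v].

Definition valence (v : vert G) : nat := #|halves v|.

(* Vertices carry no marking: admissible graphs have external vertices of valence
   1 and internal ones of valence >= 3, so the valence tells the two apart. *)
Definition external (v : vert G) : bool := valence v == 1%N.
Definition internal (v : vert G) : bool := (3 <= valence v)%N.

Definition incident (v : vert G) (e : edge G) : bool :=
  ((ends G e).1 == v) || ((ends G e).2 == v).

Definition cell_adj (C : {set cell G}) : rel (cell G) := fun x y =>
  [&& x \in C, y \in C &
    match x, y with
    | inl v, inr e => incident v e
    | inr e, inl v => incident v e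
    | _, _ => false
    end].

(* The connected components of the subspace that is the union of the cells
   in [C]; [C] need not be closed. *)
Definition parts (C : {set cell G}) : {set {set cell G}} :=
  equivalence_partition (connect (cell_adj C)) C.

(* First Betti number of a subgraph, by the Euler characteristic: the number
   of edges plus the number of components is at least the number of vertices. *)
Definition betti1 (C : {set cell G}) : nat :=
  (#|[set e : edge G | inr e \in C]| + #|parts C|
     - #|[set v : vert G | inl v \in C]|)%N.

Definition is_tree (C : {set cell G}) : bool :=
  (#|parts C| == 1%N) && (betti1 C == 0%N).

Definition tree_type (e : edge G) : bool :=
  let P := parts [set~ inr e] in
  (#|P| == 2) && (#|[set C in P | is_tree C]| == 1%N).

Definition frame : {set cell G} :=
  [set x : cell G | match x with
    | inl v => [exists e, ~~ tree_type e && incident v e]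
    | inr e => ~~ tree_type e
    end].

Definition hair (e : edge G) : bool :=
  tree_type e &&
  [exists u : vert G, exists v : vert G,
    [&& (ends G e == (u, v)) || (ends G e == (v, u)),
        valence u == 1%N,
        inl v \in frame &
        [forall e', tree_type e' && incident v e' ==> (e' == e)]]].

(* For connected [C]; removing the point [v] leaves the open edges at [v]. *)
Definition cut_vertex (C : {set cell G}) (v : vert G) : bool :=
  (inl v \in C) && (1 < #|parts (C :\ inl v)|)%N.

Definition admissible : bool :=
  [&& perm_eq (ordr G) (enum {: cell G}),
      #|parts setT| == 1%N,
      [forall v, external v || internal v] &
      [exists v, external v]].

Definition hodge : nat := #|[set v | external v]|.

Definition defect : nat := (\sum_(v | internal v) (valence v - 3))%N.

Definition two_loop_hairy : bool :=
  [&& admissible,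
      betti1 setT == 2,
      [forall v, ~~ cut_vertex frame v] &
      [forall e, tree_type e ==> hair e]].

End Graphs.

Definition ograph_iso (G H : ograph) : Prop :=
  exists (f : vert G -> vert H) (g : edge G -> edge H),
    [/\ bijective f, bijective g,
        forall e, ends H (g e) = (f (ends G e).1, f (ends G e).2) &
        ordr H = [seq match x with inl v => inl (f v) | inr e => inr (g e) end
                 | x <- ordr G]].

Definition reverse_edge (G : ograph) (e : edge G) : ograph :=
  OGraph [ffun e' => if e' == e then ((ends G e').2, (ends G e').1)
                     else ends G e'] (ordr G).

Definition reorder (G : ograph) (s : seq (cell G)) : ograph :=
  OGraph (ends G) s.

Definition degree (m N : nat) (G : ograph) (x : cell G) : int :=
  match x with
  | inl v => if external v then - m%:Z else - N%:Z
  | inr _ => N%:Z - 1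
  end.

(* Koszul sign of the passage from the order [s] to the order [t]: a factor
   (-1)^(|x||y|) for each pair x, y that gets inverted. *)
Definition koszul (m N : nat) (G : ograph) (s t : seq (cell G)) : rat :=
  \prod_(x : cell G)
    \prod_(y : cell G | (index x s < index y s)%N && (index y t < index x t)%N)
      (-1) ^ (degree m N x * degree m N y).

(* Formal linear combinations of oriented graphs, before any identification. *)
Definition chain : lmodType rat := {freeg ograph / rat}.

Inductive relator (m N : nat) : chain -> Prop :=
| relator_iso (G H : ograph) :
    admissible G -> admissible H -> ograph_iso G H ->
    relator m N (<< H >> - << G >>)
| relator_reverse (G : ograph) (e : edge G) :
    admissible G ->
    relator m N (<< reverse_edge e >> - (-1) ^+ N *: << G >>)
| relator_reorder (G : ograph) (s : seq (cell G)) :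
    admissible G -> perm_eq s (ordr G) ->
    relator m N (<< reorder s >> - koszul m N (ordr G) s *: << G >>).

Inductive in_span (V : lmodType rat) (S : V -> Prop) : V -> Prop :=
| in_span0 : in_span S 0
| in_spanD (a : rat) (x y : V) : S x -> in_span S y -> in_span S (a *: x + y).

(* The elements of the graph-complex are the chains supported on admissible
   graphs, two of them being equal when their difference is null. *)
Definition null (m N : nat) : chain -> Prop := in_span (relator m N).

(* [split_vertex v A] detaches the half-edges in [A] from [v] and attaches them
   to the new vertex [ord0]; the old vertices and edges are renumbered by
   [lift ord0], and [ord0] is the new edge. *)
Definition split_vertex (G : ograph) (v : vert G) (A : {set half_edge G}) : ograph :=
  let at' (h : half_edge G) : 'I_(nv G).+1 :=
    if h \in A then ord0 else lift ord0 (at_vertex h) in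
  @OGraph (nv G).+1 (ne G).+1
    [ffun e' => if unlift ord0 e' is Some e then (at' (e, false), at' (e, true))
                else (lift ord0 v, ord0)]
    (inl ord0 :: inr ord0 ::
       [seq match x with inl u => inl (lift ord0 u) | inr e => inr (lift ord0 e) end
       | x <- ordr G]).

(* Unordered partitions of the half-edges at [v] into two sets of size >= 2. *)
Definition splitting (G : ograph) (v : vert G)
    (P : {set {set half_edge G}}) : bool :=
  [&& partition P (halves v), #|P| == 2 & [forall A in P, (2 <= #|A|)%N]].

(* The block that goes to the new vertex; which of the two is immaterial
   modulo [null]. *)
Definition new_block (G : ograph)
    (P : {set {set half_edge G}}) : {set half_edge G} :=
  odflt set0 [pick A in P].

Definition split_sum (G : ograph) : chain :=
  \sum_(v : vert G | internal v)
    \sum_(P : {set {set half_edge G}} | splitting v P)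
      << split_vertex v (new_block P) >>.

Definition differential (x : chain) : chain := fglift split_sum x.

(* Representatives of the elements of Hodge degree [k] of the span of the
   two-loop hairy graphs of defect [i]. *)
Definition hairy_chain (i k : nat) (x : chain) : bool :=
  all [pred G | [&& two_loop_hairy G, defect G == i & hodge G == k]] (dom x).

(* There is nothing below defect 0: a graph of defect 0 has no vertex to split. *)
Definition cycle (m N i k : nat) (x : chain) : Prop :=
  hairy_chain i k x /\ null m N (differential x).

Definition boundary (m N i k : nat) (x : chain) : Prop :=
  exists2 y, hairy_chain i.+1 k y & null m N (x - differential y).

(* The image of the subspace [Z] in the quotient of [V] by the subspace [B] has
   dimension [d]: there are [d] elements of [Z] whose classes form a basis. *)
Definition quotient_dim (V : lmodType rat) (Z B : V -> Prop) (d : nat) : Prop :=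
  exists z : 'I_d -> V,
    [/\ forall j, Z (z j),
        forall c : 'I_d -> rat,
          B (\sum_j c j *: z j) -> forall j, c j = 0 &
        forall x, Z x -> exists c : 'I_d -> rat, B (x - \sum_j c j *: z j)].

Definition homology_dim (m N i k d : nat) : Prop :=
  quotient_dim (cycle m N i k) (boundary m N i k) d.

(* Main.v *)
(* A two-loop hairy graph is a theta graph whose two trivalent vertices carry a, b <= 1 hairs and
   whose three strands carry n1, n2, n3 hairs.  For m and N odd the edges have even degree, and the
   signs are governed by the vertices, of odd degree, and by the edge directions.  Permuting the
   strands preserves the orientation, because the vertices on a strand come in pairs (inner vertex,
   external vertex).  Exchanging the two ends preserves it as well, except that it reverses the
   orientation when a = b and n1 + n2 + n3 does not have the parity of a; such graphs vanish.
   Hence in each Hodge degree the non-zero part of C_i is the space of symmetric polynomials in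
   three variables of a fixed degree: for Hodge degree k, degree k in defect 0 when k is even,
   k - 1 in defect 1 always, and k - 2 in defect 2 when k is odd.  Up to a non-zero factor, the
   differential C_1 -> C_0 for k even, C_2 -> C_1 for k odd, is the multiplication by X + Y + Z.
   It is injective, and its cokernel in even degree K has as a basis the classes of the
   symmetrised monomials X^(K/2-j) Y^(K/2-j) Z^(2j) with 6 j <= K. *)

Require Import Defs.
From mathcomp.multinomials Require Import freeg.
From mathcomp Require Import all_boot all_order all_algebra.
From mathcomp Require Import zify ring.
From Stdlib Require Import ClassicalEpsilon.

Set Implicit Arguments.
Unset Strict Implicit.
Unset Printing Implicit Defensive.

Import Order.TTheory GRing.Theory Num.Theory.

Local Open Scope ring_scope.

(** * Parity of inversions *)

(** [null] is spanned by relators on all admissible graphs, hairy or not, so independence needs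
    functionals on every oriented graph that kill every relator. [phi] reads a monomial coefficient
    off a label of the graph and is 0 where there is no suitable label; it is well defined because a
    label can be recovered from the graph up to permuting strands and exchanging ends
    ([label_unique]). Spanning needs the converse, that each two-loop hairy graph has a label: the
    cut-vertex condition enters there, to exclude the figure eight and the dumbbell.

    The basis comes from ordering monomials by their largest exponent. For [a >= b >= c], the
    product of X + Y + Z with the symmetrised [(a, b, c)] has leading exponents [(a+1, b, c)], the
    first strictly largest. This triangularity gives injectivity, and leaves over the monomials
    whose two largest exponents agree: [(n, n, z)] with [2n + z = K]. As [K] is even, [z = 2j] and
    [n = K/2 - j], and [z <= n] means [6j <= K].

    Types killed by the exchange of ends are set apart by [good_type]; only the others carry
    functionals. *)

Section Inversions.

Variables (T : eqType) (a : T -> nat).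

Fixpoint inversions (s : seq T) : nat :=
  if s is x :: s' then (count (fun y => a y < a x) s' + inversions s')%N else 0%N.

Definition cross_inversions (s t : seq T) : nat :=
  (\sum_(x <- s) count (fun y => a y < a x)%N t)%N.

Lemma inversions_cat (s t : seq T) :
  inversions (s ++ t) = (inversions s + inversions t + cross_inversions s t)%N.
Proof.
elim: s => [|x s IH] /=; first by rewrite /cross_inversions big_nil addn0.
rewrite IH /cross_inversions big_cons count_cat; lia.
Qed.

Lemma cross_inversions_catr (s t u : seq T) :
  cross_inversions s (t ++ u) = (cross_inversions s t + cross_inversions s u)%N.
Proof. by rewrite /cross_inversions -big_split /=; apply: eq_bigr => x _; rewrite count_cat. Qed.

Lemma cross_inversions_catl (s t u : seq T) :
  cross_inversions (s ++ t) u = (cross_inversions s u + cross_inversions t u)%N.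
Proof. by rewrite /cross_inversions big_cat. Qed.

(** Distinct elements have distinct ranks, so each pair from the two lists is inverted in exactly
    one of the two relative positions. Modulo 2 this is the sign of exchanging two blocks of odd
    elements. *)
Lemma cross_inversions_sym (s t : seq T) : injective a -> uniq (s ++ t) ->
  (cross_inversions s t + cross_inversions t s = size s * size t)%N.
Proof.
move=> ainj; elim: s => [|x s IH] /=.
  by rewrite /cross_inversions big_nil big1_seq // => y _.
case/andP=> xst ust; rewrite -[x :: s]cat1s cross_inversions_catl.
rewrite cross_inversions_catr addnACA IH // mulSn; congr addn.
rewrite /cross_inversions big_seq1 -sumn_count sumnE big_map -big_split /=.
move: xst; rewrite mem_cat negb_or => /andP [_ xt].
rewrite -sum1_size big_seq [RHS]big_seq; apply: eq_bigr => y yt.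
have : a y <> a x by move/ainj => E; rewrite -E yt in xt.
lia.
Qed.

Lemma odd_inversions_swap (s t1 t2 r : seq T) : injective a -> uniq (t1 ++ t2) ->
  odd (inversions (s ++ t1 ++ t2 ++ r)) =
  (odd (size t1) && odd (size t2)) (+) odd (inversions (s ++ t2 ++ t1 ++ r)).
Proof.
move=> ainj ut; rewrite -oddM -(cross_inversions_sym ainj ut).
rewrite !inversions_cat !cross_inversions_catr; lia.
Qed.

(** Adjacent blocks of even size are exchanged without a sign, and such exchanges generate all
    permutations of the blocks. *)
Lemma odd_inversions_blocks (S : eqType) (F : S -> seq T) (s r : seq T) (l l' : seq S) :
  injective a -> (forall x, ~~ odd (size (F x))) ->
  uniq (flatten (map F l)) -> perm_eq l l' ->
  odd (inversions (s ++ flatten (map F l) ++ r)) =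
  odd (inversions (s ++ flatten (map F l') ++ r)).
Proof.
move=> ainj Feven ul ll'.
pose P l2 := uniq (flatten (map F l2)) /\
  odd (inversions (s ++ flatten (map F l) ++ r)) =
  odd (inversions (s ++ flatten (map F l2) ++ r)).
suff [] : P l' by [].
have even_flatten l2 : odd (size (flatten (map F l2))) = false.
  elim: l2 => //= x l2 IH; rewrite size_cat oddD IH addbF; exact/negbTE.
apply: (catCA_perm_ind _ ll'); last by [].
move=> l1 l2 l3; rewrite /P !map_cat !flatten_cat => -[u13 ->]; split.
  by rewrite uniq_catCA.
rewrite -!catA odd_inversions_swap ?even_flatten //.
by move: u13; rewrite catA cat_uniq => /andP [].
Qed.

(** The minimal element is inverted exactly with what precedes it. It will be the new vertex of a
    split graph, which stands first in the order. *)
Lemma inversions_insert_min (s t : seq T) (z : T) :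
  (forall x, x \in s ++ t -> a z < a x)%N ->
  inversions (s ++ z :: t) = (inversions (s ++ t) + size s)%N.
Proof.
move=> zmin; rewrite !inversions_cat -cat1s cross_inversions_catr inversions_cat /=.
rewrite /(cross_inversions [:: z] t) big_seq1.
have -> : count (fun y => a y < a z)%N t = 0%N.
  apply/eqP; rewrite -leqn0 leqNgt -has_count; apply/hasPn => y yt.
  by have := zmin y; rewrite mem_cat yt orbT => /(_ isT); lia.
rewrite /(cross_inversions s [:: z]) (eq_big_seq (fun=> 1%N)) ?sum1_size; first by lia.
by move=> x xs /=; have -> : (a z < a x)%N by apply: zmin; rewrite mem_cat xs.
Qed.

End Inversions.

Lemma inversions_map (S T : eqType) (f : S -> T) (a : T -> nat) (b : S -> nat) (s : seq S) :
  (forall x y, (a (f x) < a (f y)) = (b x < b y))%N ->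
  inversions a (map f s) = inversions b s.
Proof.
move=> H; elim: s => //= x s ->; rewrite count_map; congr addn.
by apply: eq_count => y /=; rewrite H.
Qed.

(** Relative to the listing [s], a pair is ranked in opposite ways by [a] and [b] exactly when one
    of the two inverts it and the other does not. The sign of a change of order thus becomes a
    quotient of two signs, each depending on one order only. *)
Lemma odd_discordances (T : eqType) (a b : T -> nat) (s : seq T) :
  injective a -> injective b -> uniq s ->
  odd (\sum_(x <- s) \sum_(y <- s) ((a x < a y) && (b y < b x)))%N =
  odd (inversions a s) (+) odd (inversions b s).
Proof.
move=> ainj binj; elim: s => [|z s IH] /=; first by rewrite big_nil.
case/andP=> zs us; rewrite big_cons [X in odd (X + _)]big_cons ltnn /=.
rewrite [X in (_ + X)%N](eq_bigr (fun x => ((a x < a z) && (b z < b x)) +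
  \sum_(y <- s) ((a x < a y) && (b y < b x)))%N); last by move=> x _; rewrite big_cons.
rewrite big_split /= addnA add0n oddD IH // -big_split /= !oddD.
have -> : odd (\sum_(i <- s) ((a z < a i) && (b i < b z) + (a i < a z) && (b z < b i)))%N =
  odd (count (fun y => a y < a z)%N s) (+) odd (count (fun y => b y < b z)%N s).
  elim: s zs {IH us} => [|x s IH]; first by rewrite big_nil.
  rewrite inE negb_or => /andP [zx zs]; rewrite big_cons /= !oddD IH //.
  have nax : a x != a z by apply: contra zx => /eqP/ainj ->.
  have nbx : b x != b z by apply: contra zx => /eqP/binj ->.
  case: (ltngtP (a x) (a z)) nax => // _ _; case: (ltngtP (b x) (b z)) nbx => // _ _ /=;
    by rewrite ?(addbN, addNb, negbK).
by case: (odd _); case: (odd _); case: (odd _); case: (odd _).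
Qed.

(** * Labelled theta graphs *)

Section Labels.

Variables V E : Type.

(* A strand is a path of the frame from one trivalent vertex of the frame to the other: the list
   of its inner vertices, each with the external vertex and the edge of its hair, and the list
   of its frame edges, one longer. *)
Definition strand := (seq (V * (V * E)) * seq E)%type.

Definition strand_verts (p : strand) : seq V := flatten [seq [:: b.1; b.2.1] | b <- p.1].

(** An arc [(e, (u, w))] records the direction in which the label reads the edge [e]: along the
    strand for a frame edge, outwards for a hair. The orientation of [e] in the graph may be the
    opposite one. *)
Definition strand_arcs (x y : V) (p : strand) : seq (E * (V * V)) :=
  zip p.2 (zip (x :: unzip1 p.1) (rcons (unzip1 p.1) y)) ++
  [seq (b.2.2, (b.1, b.2.1)) | b <- p.1].

Definition hair_arcs (x : V) (hs : seq (V * E)) : seq (E * (V * V)) :=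
  [seq (q.2, (x, q.1)) | q <- hs].

Record label := Label {
  source : V;
  target : V;
  source_hairs : seq (V * E);
  target_hairs : seq (V * E);
  strands : seq strand
}.

(* An external vertex is listed next to its neighbour: when [m] and [N] are odd, such a pair has
   even total degree, so the strands can be permuted without a sign. *)
Definition label_verts (l : label) : seq V :=
  (source l :: unzip1 (source_hairs l)) ++ (target l :: unzip1 (target_hairs l)) ++
  flatten (map strand_verts (strands l)).

Definition label_arcs (l : label) : seq (E * (V * V)) :=
  hair_arcs (source l) (source_hairs l) ++ hair_arcs (target l) (target_hairs l) ++
  flatten (map (strand_arcs (source l) (target l)) (strands l)).

Definition label_type (l : label) : nat * nat * seq nat :=
  (size (source_hairs l), size (target_hairs l), [seq size p.1 | p <- strands l]).

(** The bound 1 on the hairs at an end expresses that a hair has no other tree-type edge at its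
    frame vertex. *)
Definition well_shaped (l : label) : bool :=
  [&& size (source_hairs l) <= 1, size (target_hairs l) <= 1, size (strands l) == 3
    & all (fun p => size p.2 == (size p.1).+1) (strands l)]%N.

Lemma size_strand_verts (p : strand) : size (strand_verts p) = (size p.1).*2.
Proof. by rewrite /strand_verts; elim: p.1 => //= b s ->; rewrite doubleS. Qed.

Lemma strand_arcs_edges (x y : V) (p : strand) : size p.2 = (size p.1).+1 ->
  unzip1 (strand_arcs x y p) = p.2 ++ [seq b.2.2 | b <- p.1].
Proof.
move=> szp; rewrite /strand_arcs /unzip1 map_cat -map_comp; congr cat.
by rewrite -/unzip1 unzip1_zip // size_zip /= size_rcons !size_map minnn szp.
Qed.

Definition rev_strand (p : strand) : strand := (rev p.1, rev p.2).

Definition rev_label (l : label) : label :=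
  Label (target l) (source l) (target_hairs l) (source_hairs l)
        (map rev_strand (strands l)).

Definition permute_label (l : label) (ps : seq strand) : label :=
  Label (source l) (target l) (source_hairs l) (target_hairs l) ps.

End Labels.

Definition map_strand (V E V' E' : Type) (f : V -> V') (g : E -> E') (p : strand V E) :
    strand V' E' :=
  ([seq (f b.1, (f b.2.1, g b.2.2)) | b <- p.1], map g p.2).

Definition map_label (V E V' E' : Type) (f : V -> V') (g : E -> E') (l : label V E) :
    label V' E' :=
  Label (f (source l)) (f (target l))
    [seq (f q.1, g q.2) | q <- source_hairs l] [seq (f q.1, g q.2) | q <- target_hairs l]
    (map (map_strand f g) (strands l)).

Definition map_arc (V E V' E' : Type) (f : V -> V') (g : E -> E') (a : E * (V * V)) :
    E' * (V' * V') := (g a.1, (f a.2.1, f a.2.2)).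

Lemma strand_arcs_cons (V E : eqType) (x y : V) b bs (e : E) es :
  perm_eq (strand_arcs x y (b :: bs, e :: es))
    ((e, (x, b.1)) :: (b.2.2, (b.1, b.2.1)) :: strand_arcs b.1 y (bs, es)).
Proof.
rewrite perm_sym /strand_arcs /= perm_cons -cat1s perm_catCA.
by rewrite perm_refl.
Qed.

Section MapLabel.

Variables (V E V' E' : Type) (f : V -> V') (g : E -> E').

Lemma strand_verts_map (p : strand V E) :
  strand_verts (map_strand f g p) = map f (strand_verts p).
Proof. by rewrite /strand_verts map_flatten /= -!map_comp. Qed.

Lemma label_verts_map (l : label V E) : label_verts (map_label f g l) = map f (label_verts l).
Proof.
rewrite /label_verts /= !map_cat /= !map_cat map_flatten /unzip1 -!map_comp.
congr (_ :: _ ++ _ :: _ ++ flatten _).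
by apply: eq_map => p /=; exact: strand_verts_map.
Qed.

Lemma zip_map (S T S' T' : Type) (h : S -> S') (k : T -> T') (s : seq S) (t : seq T) :
  zip (map h s) (map k t) = [seq (h q.1, k q.2) | q <- zip s t].
Proof. by elim: s t => [|? s IH] [|? t] //=; rewrite IH. Qed.

Lemma strand_arcs_map (x y : V) (p : strand V E) :
  strand_arcs (f x) (f y) (map_strand f g p) = map (map_arc f g) (strand_arcs x y p).
Proof.
rewrite /strand_arcs map_cat -!map_comp; congr cat.
have -> : unzip1 (map_strand f g p).1 = map f (unzip1 p.1) by rewrite /unzip1 -!map_comp.
by rewrite -map_cons -map_rcons !zip_map.
Qed.

Lemma label_arcs_map (l : label V E) :
  label_arcs (map_label f g l) = map (map_arc f g) (label_arcs l).
Proof.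
rewrite /label_arcs /hair_arcs /= !map_cat map_flatten -!map_comp.
congr (_ ++ _ ++ flatten _).
by apply: eq_map => p /=; exact: strand_arcs_map.
Qed.

Lemma label_type_map (l : label V E) : label_type (map_label f g l) = label_type l.
Proof.
rewrite /label_type /= !size_map -map_comp; congr (_, _, _).
by apply: eq_map => p /=; rewrite size_map.
Qed.

Lemma well_shaped_map (l : label V E) : well_shaped (map_label f g l) = well_shaped l.
Proof.
rewrite /well_shaped /= !size_map all_map; congr [&& _, _, _ & _].
by apply: eq_all => p /=; rewrite !size_map.
Qed.

End MapLabel.

(** * Signs, and labels of a given oriented graph *)

Definition sgn (b : bool) : rat := if b then -1 else 1.

Lemma sgnD (a b : bool) : sgn (a (+) b) = sgn a * sgn b.
Proof. by case: a; case: b; rewrite /sgn ?mulr1 ?mul1r ?mulrNN ?mul1r. Qed.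

Lemma sgn_sq (a : bool) : sgn a * sgn a = 1.
Proof. by rewrite -sgnD addbb. Qed.

Lemma sgnN (a : bool) : sgn (~~ a) = - sgn a.
Proof. by case: a; rewrite /sgn ?opprK. Qed.

Lemma sgn_odd_sum (I : Type) (r : seq I) (F : I -> nat) :
  sgn (odd (\sum_(i <- r) F i)%N) = \prod_(i <- r) sgn (odd (F i)).
Proof.
by elim: r => [|i r IH]; rewrite ?big_nil // !big_cons oddD sgnD IH.
Qed.

Section Labelled.

Variable G : ograph.

Definition rank (v : vert G) : nat := index (inl v) (ordr G).

Definition arc_matches (a : edge G * (vert G * vert G)) : bool :=
  (ends G a.1 == a.2) || (ends G a.1 == (a.2.2, a.2.1)).

Definition arc_flipped (a : edge G * (vert G * vert G)) : bool := ends G a.1 != a.2.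

Definition labelled (l : label (vert G) (edge G)) : bool :=
  [&& perm_eq (ordr G) (enum {: cell G}), perm_eq (label_verts l) (enum 'I_(nv G)),
      perm_eq (unzip1 (label_arcs l)) (enum 'I_(ne G)), well_shaped l
    & all arc_matches (label_arcs l)].

(** Parity of the passage from the orientation of [G] to the one prescribed by [l]: vertices ordered
    as in [label_verts l], edges directed as in [label_arcs l]. The positions of the edges in the
    order do not enter, their degree being even. So the chain [label_sign l *: << G >>] keeps its
    class when [G] is reoriented. *)
Definition label_odd (l : label (vert G) (edge G)) : bool :=
  odd (inversions rank (label_verts l)) (+) odd (count arc_flipped (label_arcs l)).

Definition label_sign (l : label (vert G) (edge G)) : rat := sgn (label_odd l).

Lemma rank_inj : perm_eq (ordr G) (enum {: cell G}) -> injective rank.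
Proof.
move=> H u v E; have ou w : w \in ordr G by rewrite (perm_mem H) mem_enum.
by have := nth_index (inl u) (ou (inl u)); rewrite -/(rank u) E nth_index // => -[].
Qed.

End Labelled.

#[local] Arguments degree : simpl never.

Lemma exprN1z (z : int) : (-1 : rat) ^ z = sgn (odd `|z|%N).
Proof.
suff E n : (-1 : rat) ^+ n = sgn (odd n).
  by case: z => n; rewrite ?NegzE ?abszN ?absz_nat -?exprz_inv ?invrN1 -E.
by elim: n => //= n IH; rewrite exprS IH sgnN mulN1r.
Qed.

(** * Equality of chains modulo the relations *)

Section NullChains.

Variables m N : nat.

Definition eqv (x y : chain) : Prop := null m N (x - y).

Lemma null0 : null m N 0.
Proof. exact: in_span0. Qed.

Lemma nullD (x y : chain) : null m N x -> null m N y -> null m N (x + y).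
Proof.
move=> Hx Hy; elim: Hx => [|a z t Hz _ IH]; first by rewrite add0r.
by rewrite -addrA; exact: in_spanD.
Qed.

Lemma nullZ (a : rat) (x : chain) : null m N x -> null m N (a *: x).
Proof.
elim=> [|b z t Hz Ht IH]; first by rewrite scaler0; exact: null0.
by rewrite scalerDr scalerA; exact: in_spanD.
Qed.

Lemma nullN (x : chain) : null m N x -> null m N (- x).
Proof. by rewrite -scaleN1r; exact: nullZ. Qed.

Lemma null_relator (x : chain) : relator m N x -> null m N x.
Proof. by move=> Hx; rewrite -[x]addr0 -[x]scale1r; apply: in_spanD => //; exact: in_span0. Qed.

Lemma eqv_refl (x : chain) : eqv x x.
Proof. by rewrite /eqv subrr; exact: null0. Qed.

Lemma eqv_sym (x y : chain) : eqv x y -> eqv y x.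
Proof. by move=> H; rewrite /eqv -opprB; exact: nullN. Qed.

Lemma eqv_trans (y x z : chain) : eqv x y -> eqv y z -> eqv x z.
Proof. by move=> Hxy Hyz; rewrite /eqv -(subrKA y x); exact: nullD. Qed.

Lemma eqvD (x y z t : chain) : eqv x y -> eqv z t -> eqv (x + z) (y + t).
Proof. by move=> Hxy Hzt; rewrite /eqv opprD addrACA; exact: nullD. Qed.

Lemma eqvZ (a : rat) (x y : chain) : eqv x y -> eqv (a *: x) (a *: y).
Proof. by move=> Hxy; rewrite /eqv -scalerBr; exact: nullZ. Qed.

Lemma eqvN (x y : chain) : eqv x y -> eqv (- x) (- y).
Proof. by rewrite -!scaleN1r; exact: eqvZ. Qed.

Lemma eqv_null (x y : chain) : eqv x y -> null m N y -> null m N x.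
Proof. by move=> Hxy Hy; rewrite -(subrK y x); exact: nullD. Qed.

Lemma null_eqv0 (x : chain) : eqv x 0 <-> null m N x.
Proof. by rewrite /eqv subr0. Qed.

End NullChains.

Section OddDegrees.

Variables m N : nat.
Hypotheses (hm : odd m) (hN : odd N).

Lemma degree_sign (G : ograph) (x y : cell G) :
  (-1 : rat) ^ (degree m N x * degree m N y) =
  match x, y with inl _, inl _ => -1 | _, _ => 1 end.
Proof.
have oddV (v : vert G) : odd `|degree m N (inl v : cell G)|%N.
  by rewrite /degree; case: ifP => _; rewrite abszN absz_nat.
have evenE (e : edge G) : odd `|degree m N (inr e : cell G)|%N = false.
  by rewrite /degree; case: N hN => // n /negbTE; rewrite intS (addrC 1) addrK absz_nat.
rewrite exprN1z abszM oddM.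
case: x y => [v|e] [w|e']; rewrite ?oddV ?evenE ?andbF //=.
Qed.

(** Only pairs of vertices contribute, and [odd_discordances] applies to them. The reference listing
    [vs] is free; with [label_verts l] the Koszul sign is the change of [label_sign l]. *)
Lemma koszul_sign (G : ograph) (s : seq (cell G)) (vs : seq (vert G)) :
  perm_eq (ordr G) (enum {: cell G}) -> perm_eq s (ordr G) -> perm_eq vs (enum 'I_(nv G)) ->
  koszul m N (ordr G) s =
  sgn (odd (inversions (@rank G) vs) (+) odd (inversions (@rank (reorder s)) vs)).
Proof.
move=> po ps pv; rewrite -odd_discordances; last 3 first.
- exact: rank_inj.
- exact: (@rank_inj (reorder s) (perm_trans ps po)).
- by rewrite (perm_uniq pv) enum_uniq.
rewrite /koszul big_sumType /= [X in _ * X]big1 ?mulr1; last first.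
  by move=> e _; rewrite big1 // => y _; rewrite degree_sign.
rewrite sgn_odd_sum (perm_big _ pv) /= big_enum /=; apply: eq_bigr => v _.
rewrite sgn_odd_sum (perm_big _ pv) /= big_enum /=.
rewrite big_mkcond big_sumType /= [X in _ * X]big1 ?mulr1; last first.
  by move=> e _; rewrite degree_sign; case: ifP.
apply: eq_bigr => w _; rewrite degree_sign /rank /=.
by case: (_ && _).
Qed.

End OddDegrees.

Lemma perm_flatten_cat (S : Type) (T : eqType) (f g : S -> seq T) (s : seq S) :
  perm_eq (flatten [seq f x ++ g x | x <- s]) (flatten (map f s) ++ flatten (map g s)).
Proof.
by apply/permP => q; rewrite count_cat; elim: s => //= x s IH; rewrite !count_cat IH; lia.
Qed.

Lemma perm_flatten_map (S T : eqType) (f g : S -> seq T) (s : seq S) :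
  {in s, forall x, perm_eq (f x) (g x)} -> perm_eq (flatten (map f s)) (flatten (map g s)).
Proof.
elim: s => //= x s IH H; apply: perm_cat; first by apply: H; rewrite mem_head.
by apply: IH => y ys; apply: H; rewrite inE ys orbT.
Qed.

Lemma uniq_map_inj_in (S T : eqType) (f : S -> T) (s : seq S) :
  uniq (map f s) -> {in s &, injective f}.
Proof.
elim: s => //= z s IH /andP [zs us] x y; rewrite !inE.
case/orP=> [/eqP ->|xs] /orP [/eqP ->|ys] // E; last exact: IH.
- by rewrite E map_f in zs.
- by rewrite -E map_f in zs.
Qed.

Lemma mem_zip (S T : eqType) (s : seq S) (t : seq T) z :
  z \in zip s t -> (z.1 \in s) && (z.2 \in t).
Proof.
elim: s t => [|x s IH] [|y t] //=; rewrite !inE => /orP [/eqP -> /=|/IH /andP [-> ->]].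
  by rewrite !eqxx.
by rewrite !orbT.
Qed.

(** * Frame and hairs of a label *)

Section LabelParts.

Variables V E : Type.
Implicit Type l : label V E.

Definition strand_frame_arcs (x y : V) (p : strand V E) : seq (E * (V * V)) :=
  zip p.2 (zip (x :: unzip1 p.1) (rcons (unzip1 p.1) y)).

Definition frame_arcs l : seq (E * (V * V)) :=
  flatten (map (strand_frame_arcs (source l) (target l)) (strands l)).

Definition bead_arcs (p : strand V E) : seq (E * (V * V)) :=
  [seq (b.2.2, (b.1, b.2.1)) | b <- p.1].

(** All hairs together, read from the frame vertex (an entry of [roots]) to the external vertex (an
    entry of [tips]). *)
Definition spur_arcs l : seq (E * (V * V)) :=
  hair_arcs (source l) (source_hairs l) ++ hair_arcs (target l) (target_hairs l) ++
  flatten (map bead_arcs (strands l)).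

Definition beads l : seq V := flatten [seq unzip1 p.1 | p <- strands l].

Definition core l : seq V := [:: source l, target l & beads l].

Definition tips l : seq V := [seq a.2.2 | a <- spur_arcs l].

Definition roots l : seq V := [seq a.2.1 | a <- spur_arcs l].

Definition frame_edges l : seq E := flatten [seq p.2 | p <- strands l].

Lemma tipsE l : tips l = unzip1 (source_hairs l) ++ unzip1 (target_hairs l) ++
  flatten [seq [seq b.2.1 | b <- p.1] | p <- strands l].
Proof.
rewrite /tips /spur_arcs !map_cat map_flatten -!map_comp; congr (_ ++ _ ++ flatten _).
by apply: eq_map => p /=; rewrite -map_comp.
Qed.

Lemma rootsE l : roots l = nseq (size (source_hairs l)) (source l) ++
  nseq (size (target_hairs l)) (target l) ++ beads l.
Proof.
have nseqE (T : Type) x (s : seq T) : [seq x | _ <- s] = nseq (size s) x :> seq V.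
  by elim: s => //= _ s ->.
rewrite /roots /spur_arcs !map_cat map_flatten -!map_comp -!nseqE.
congr (_ ++ _ ++ flatten _).
by apply: eq_map => p /=; rewrite -map_comp.
Qed.

Lemma size_beads l : size (beads l) = sumn (label_type l).2.
Proof. by rewrite /beads /=; elim: (strands l) => //= p s <-; rewrite size_cat size_map. Qed.

Lemma size_roots l :
  size (roots l) = ((label_type l).1.1 + (label_type l).1.2 + sumn (label_type l).2)%N.
Proof. by rewrite rootsE !size_cat !size_nseq size_beads addnA. Qed.

Lemma size_frame_edges l : well_shaped l ->
  size (frame_edges l) = (sumn (label_type l).2 + 3)%N.
Proof.
case/and4P=> _ _ /eqP <- sz; rewrite /frame_edges /=.
elim: (strands l) sz => //= p ps IH /andP [/eqP szp /IH].
by rewrite size_cat szp => ->; lia.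
Qed.

Lemma frame_arcs_edges l : well_shaped l -> unzip1 (frame_arcs l) = frame_edges l.
Proof.
case/and4P=> _ _ _; rewrite /unzip1 /frame_arcs /frame_edges.
elim: (strands l) => //= p ps IH /andP [/eqP szp /IH <-]; rewrite map_cat; congr cat.
by rewrite -/unzip1 unzip1_zip // size_zip /= size_rcons !size_map szp minnn.
Qed.

End LabelParts.

Section LabelPartsEq.

Variables V E : eqType.
Implicit Type l : label V E.

Lemma perm_label_arcs l : perm_eq (label_arcs l) (frame_arcs l ++ spur_arcs l).
Proof.
rewrite perm_sym /label_arcs /spur_arcs perm_catCA perm_cat2l perm_catCA perm_cat2l perm_sym.
exact: (perm_flatten_cat (strand_frame_arcs (source l) (target l)) (@bead_arcs V E) (strands l)).
Qed.

Lemma perm_strand_verts (p : strand V E) :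
  perm_eq (strand_verts p) (unzip1 p.1 ++ [seq b.2.1 | b <- p.1]).
Proof.
by apply/permP => q; rewrite count_cat /strand_verts; elim: p.1 => //= b s ->; lia.
Qed.

Lemma perm_label_verts l : perm_eq (label_verts l) (core l ++ tips l).
Proof.
have H := perm_flatten_map (fun (p : strand V E) (_ : p \in strands l) => perm_strand_verts p).
have {}H := perm_trans H (perm_flatten_cat _ _ _).
apply/permP => q; rewrite tipsE /label_verts /core /beads /= !count_cat /= !count_cat.
have /permP/(_ q) -> := H; rewrite count_cat; congr addn.
rewrite addnCA; congr addn; rewrite [RHS]addnCA; congr addn.
by rewrite [RHS]addnCA.
Qed.

(** Each inner vertex is the end of one arc and the beginning of the next one, whereas [x] and [y]
    are met once. *)
Lemma count_strand_frame_arcs (x y v : V) (p : strand V E) : size p.2 == (size p.1).+1 ->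
  (\sum_(a <- strand_frame_arcs x y p) ((a.2.1 == v) + (a.2.2 == v)) =
   (x == v) + (y == v) + (count_mem v (unzip1 p.1)).*2)%N.
Proof.
rewrite /strand_frame_arcs; case: p => bs es /= /eqP.
elim: bs x es => [|b bs IH] x [|e es] //= [sz].
  by case: es sz => // _; rewrite big_cons big_nil /=; lia.
by rewrite big_cons IH //=; lia.
Qed.

Lemma count_frame_arcs l v : well_shaped l ->
  (\sum_(a <- frame_arcs l) ((a.2.1 == v) + (a.2.2 == v)) =
   3 * (source l == v) + 3 * (target l == v) + (count_mem v (beads l)).*2)%N.
Proof.
case/and4P=> _ _ /eqP <- sz; rewrite /frame_arcs /beads.
elim: (strands l) sz => [|p ps IH] /=; first by rewrite big_nil.
by case/andP=> szp sz; rewrite big_cat /= IH // count_strand_frame_arcs // count_cat; lia.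
Qed.

End LabelPartsEq.

(** * Valences and numerical invariants of a labelled graph *)

Section LabelledGraph.

Variables (G : ograph) (l : label (vert G) (edge G)).
Hypothesis hl : labelled l.

Let A := source l.
Let B := target l.
Let alpha := size (source_hairs l).
Let beta := size (target_hairs l).

Lemma labelled_order : perm_eq (ordr G) (enum {: cell G}). Proof. by case/and5P: hl. Qed.
Lemma labelled_shape : well_shaped l. Proof. by case/and5P: hl. Qed.

Lemma labelled_verts : perm_eq (core l ++ tips l) (enum 'I_(nv G)).
Proof. by case/and5P: hl => _ H _ _ _; apply: perm_trans H; rewrite perm_sym perm_label_verts. Qed.

Lemma uniq_core_tips : uniq (core l ++ tips l).
Proof. by rewrite (perm_uniq labelled_verts) enum_uniq. Qed.

Lemma mem_core_tips v : v \in core l ++ tips l.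
Proof. by rewrite (perm_mem labelled_verts) mem_enum. Qed.

Lemma labelled_edges : perm_eq (unzip1 (frame_arcs l ++ spur_arcs l)) (enum 'I_(ne G)).
Proof.
case/and5P: hl => _ _ H _ _; apply: perm_trans H; rewrite perm_sym.
exact/perm_map/perm_label_arcs.
Qed.

Lemma uniq_edges : uniq (unzip1 (frame_arcs l ++ spur_arcs l)).
Proof. by rewrite (perm_uniq labelled_edges) enum_uniq. Qed.

Lemma edge_arc e : exists2 a, a \in frame_arcs l ++ spur_arcs l & e = a.1.
Proof.
have : e \in unzip1 (frame_arcs l ++ spur_arcs l) by rewrite (perm_mem labelled_edges) mem_enum.
by case/mapP => a Ha ->; exists a.
Qed.

Lemma arc_endsP a : a \in frame_arcs l ++ spur_arcs l ->
  ends G a.1 = a.2 \/ ends G a.1 = (a.2.2, a.2.1).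
Proof.
rewrite -(perm_mem (perm_label_arcs l)); case/and5P: hl => _ _ _ _ /allP H /H.
by case/orP=> /eqP; [left | right].
Qed.

Lemma incident_arc a v : a \in frame_arcs l ++ spur_arcs l ->
  incident v a.1 = (a.2.1 == v) || (a.2.2 == v).
Proof. by case/arc_endsP; rewrite /incident => -> //=; rewrite orbC. Qed.

Lemma valence_arcs v :
  valence v = (\sum_(a <- label_arcs l) ((a.2.1 == v) + (a.2.2 == v)))%N.
Proof.
transitivity (\sum_(e : edge G) (((ends G e).1 == v) + ((ends G e).2 == v)))%N.
  rewrite /valence -sum1_card /halves big_mkcond /=.
  rewrite (eq_bigr (fun h : edge G * bool => nat_of_bool (at_vertex (h.1, h.2) == v))).
    rewrite -(pair_big xpredT xpredT (fun e b => nat_of_bool (at_vertex (e, b) == v))) /=.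
    by apply: eq_bigr => e _; rewrite big_bool /= addnC.
  by case=> e b _; rewrite inE; case: eqP.
case/and5P: hl => _ _ pE _ /allP am.
rewrite -big_enum -(perm_big _ pE) /= big_map big_seq [RHS]big_seq.
by apply: eq_bigr => a /am /orP [] /eqP -> //=; rewrite addnC.
Qed.

(** Three strands and the hairs meet at an end; a bead has two frame half-edges and one hair; a tip
    has a single half-edge. *)
Lemma valenceE v : valence v =
  ((3 + alpha) * (A == v) + (3 + beta) * (B == v) +
    3 * count_mem v (beads l) + count_mem v (tips l))%N.
Proof.
rewrite valence_arcs (perm_big _ (perm_label_arcs l)) big_cat /= count_frame_arcs ?labelled_shape //.
rewrite big_split /=.
have -> : (\sum_(a <- spur_arcs l) (a.2.1 == v) = count_mem v (roots l))%N.
  by rewrite /roots count_map -sumn_count sumnE big_map.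
have -> : (\sum_(a <- spur_arcs l) (a.2.2 == v) = count_mem v (tips l))%N.
  by rewrite /tips count_map -sumn_count sumnE big_map.
rewrite rootsE !count_cat !count_nseq /= -/A -/B -/alpha -/beta.
case: (A == v); case: (B == v) => /=; rewrite ?(mul1n, mul0n, muln0, muln1, add0n, addn0). all: lia.
Qed.

Lemma vertex_count v :
  ((A == v) + (B == v) + count_mem v (beads l) + count_mem v (tips l) = 1)%N.
Proof.
have := count_uniq_mem v uniq_core_tips; rewrite mem_core_tips count_cat /= -/A -/B; lia.
Qed.

Lemma hairs_le1 : (alpha <= 1)%N /\ (beta <= 1)%N.
Proof. by case/and4P: labelled_shape. Qed.

Lemma external_tip v : external v = (v \in tips l).
Proof.
rewrite /external valenceE -has_pred1 has_count.
by have := vertex_count v; case: (A == v); case: (B == v); lia.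
Qed.

Lemma internal_core v : internal v = (v \in core l).
Proof.
rewrite /internal valenceE; have := vertex_count v; rewrite !inE !(eq_sym v) -/A -/B.
by rewrite -has_pred1 has_count; case: (A == v); case: (B == v) => /=; lia.
Qed.

Lemma hodge_label : hodge G = (alpha + beta + sumn (label_type l).2)%N.
Proof.
rewrite -size_roots /roots size_map /hodge -(size_map (fun a => a.2.2)) -/(tips l).
have ut : uniq (tips l) by have := uniq_core_tips; rewrite cat_uniq => /and3P [].
rewrite -(card_uniqP ut); apply: eq_card => v; rewrite inE; exact: external_tip.
Qed.

Lemma defect_label : defect G = (alpha + beta)%N.
Proof.
rewrite /defect big_mkcond /=.
rewrite (eq_bigr (fun v => (alpha * (v == A)) + (beta * (v == B)))%N); last first.
  move=> v _; have := vertex_count v; rewrite (eq_sym v A) (eq_sym v B).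
  have [|] := boolP (internal v); rewrite /internal valenceE;
    by case: (A == v); case: (B == v) => /=; lia.
have sum1 (c : nat) (x : vert G) : (\sum_v c * (v == x) = c)%N.
  by rewrite (bigD1 x) //= eqxx muln1 big1 ?addn0 // => i /negbTE ->; rewrite muln0.
by rewrite big_split /= !sum1.
Qed.

Lemma label_size_verts : nv G = (2 + alpha + beta + (sumn (label_type l).2).*2)%N.
Proof.
have /perm_size := labelled_verts; rewrite size_cat /tips size_map size_enum_ord => /esym H; apply: etrans H _.
rewrite -(size_map (fun a => a.2.1)) -/(roots l) size_roots -[size (core l)]/((size (beads l)).+2).
by rewrite size_beads -[(label_type l).1.1]/alpha -[(label_type l).1.2]/beta; lia.
Qed.

Lemma label_size_edges : ne G = (3 + alpha + beta + (sumn (label_type l).2).*2)%N.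
Proof.
have /perm_size := labelled_edges; rewrite size_map size_cat size_enum_ord => /esym H; apply: etrans H _.
rewrite -(size_map fst (frame_arcs l)) -/(unzip1 _) frame_arcs_edges ?labelled_shape //.
rewrite size_frame_edges ?labelled_shape // -(size_map (fun a => a.2.1) (spur_arcs l)).
by rewrite -/(roots l) size_roots -[(label_type l).1.1]/alpha -[(label_type l).1.2]/beta; lia.
Qed.

Lemma core_frame_arc v : v \in core l -> exists2 a, a \in frame_arcs l &
  (a.2.1 == v) || (a.2.2 == v).
Proof.
have arcr (x y : vert G) (p : strand (vert G) (edge G)) w : size p.2 == (size p.1).+1 ->
    w \in rcons (unzip1 p.1) y -> exists2 a, a \in strand_frame_arcs x y p & a.2.2 == w.
  case: p => bs es /=; rewrite /strand_frame_arcs /=.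
  elim: bs x es => [|b bs IH] x [|e es] //= /eqP [sz].
    by case: es sz => // _; rewrite inE => /eqP ->; exists (e, (x, y)); rewrite ?inE ?eqxx.
  rewrite inE => /orP [/eqP ->|/IH - /(_ b.1 es) [|a Ha Hw]]; last 2 first.
  - exact/eqP.
  - by exists a => //; rewrite inE Ha orbT.
  by exists (e, (x, b.1)); rewrite ?inE ?eqxx.
have arcl (x y : vert G) (p : strand (vert G) (edge G)) : size p.2 == (size p.1).+1 ->
    exists2 a, a \in strand_frame_arcs x y p & a.2.1 == x.
  case: p => [[|b bs] [|e es]] //= _; rewrite /strand_frame_arcs /=.
    by exists (e, (x, y)); rewrite ?inE ?eqxx.
  by exists (e, (x, b.1)); rewrite ?inE ?eqxx.
have /and4P [_ _ sz3 /allP sz] := labelled_shape.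
have [p0 p0s] : exists p0, p0 \in strands l.
  by case: (strands l) sz3 => // p0 *; exists p0; rewrite mem_head.
have inframe p a : p \in strands l -> a \in strand_frame_arcs A B p -> a \in frame_arcs l.
  by move=> ps Ha; apply/flattenP; exists (strand_frame_arcs A B p) => //; exact: map_f.
rewrite !inE => /or3P [/eqP ->|/eqP ->|/flattenP [_ /mapP [p ps ->] vp]].
- have [a Ha Hv] := arcl A B p0 (sz _ p0s); exists a; rewrite ?Hv //; exact: inframe Ha.
- have [|a Ha Hv] := arcr A B p0 B (sz _ p0s); first by rewrite mem_rcons mem_head.
  by exists a; rewrite ?Hv ?orbT //; exact: inframe Ha.
- have [|a Ha Hv] := arcr A B p v (sz _ ps); first by rewrite mem_rcons inE vp orbT.
  by exists a; rewrite ?Hv ?orbT //; exact: inframe Ha.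
Qed.

Lemma frame_arc_ends a : a \in frame_arcs l -> a.2.1 \in core l /\ a.2.2 \in core l.
Proof.
case/flattenP => _ /mapP [p ps ->].
have sub : {subset unzip1 p.1 <= core l}.
  by move=> v vp; rewrite !inE; apply/or3P/Or33/flattenP; exists (unzip1 p.1) => //; exact: map_f.
rewrite /strand_frame_arcs => Ha.
have /andP [_ /mem_zip /andP []] := mem_zip Ha.
rewrite inE mem_rcons inE => H1 H2; split.
  by case/orP: H1 => [/eqP ->|/sub //]; rewrite mem_head.
by case/orP: H2 => [/eqP ->|/sub //]; rewrite !inE eqxx orbT.
Qed.

Lemma spur_arc_ends a : a \in spur_arcs l -> a.2.1 \in core l /\ a.2.2 \in tips l.
Proof.
move=> Ha; split; last by apply: map_f.
have : a.2.1 \in roots l by apply: (map_f (fun a => a.2.1)).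
rewrite rootsE !mem_cat !mem_nseq !inE => /or3P [/andP [_ ->]|/andP [_ ->]|->] //;
  by rewrite ?orbT.
Qed.

(** A frame vertex carries at most one hair, so a hair is determined by its root. *)
Lemma uniq_roots : uniq (roots l).
Proof.
have := uniq_core_tips; rewrite cat_uniq rootsE => /andP [/= /and3P [Ac Bc ub] _].
have [ha hb] := hairs_le1; rewrite !cat_uniq ub -/alpha -/beta.
have nu n (x : vert G) : (n <= 1)%N -> uniq (nseq n x) by case: n => [|[]].
rewrite !nu //= andbT; apply/andP; split; last first.
  by apply/hasPn => v vb; apply/nseqP => -[vB _]; move: Bc; rewrite -vB vb.
apply/hasPn => v; rewrite mem_cat mem_nseq => /orP [/andP [_ /eqP vB]|vb];
  apply/nseqP => -[vA _]; move: Ac; rewrite inE -vA ?vb ?orbT //.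
by rewrite vB eqxx.
Qed.

Lemma core_not_tip v : v \in core l -> v \notin tips l.
Proof.
move=> vc; have := uniq_core_tips; rewrite cat_uniq => /and3P [_ /hasPn H _].
by apply/negP => /H /=; rewrite vc.
Qed.

Lemma frame_spur_disjoint a a' : a \in frame_arcs l -> a' \in spur_arcs l -> a.1 != a'.1.
Proof.
move=> Ha Ha'; have := uniq_edges; rewrite /unzip1 map_cat cat_uniq => /and3P [_ /hasPn H _].
by have /= := H _ (map_f fst Ha'); apply: contra => /eqP <-; exact: map_f.
Qed.

End LabelledGraph.

(** * Labelled graphs are two-loop hairy graphs *)

Section Connectivity.

Variable G : ograph.
Implicit Types (C : {set cell G}) (x y z : cell G) (u v w : vert G) (e : edge G).

Lemma cell_adj_sym C : symmetric (cell_adj C).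
Proof. by move=> x y; rewrite /cell_adj andbCA; congr [&& _, _ & _]; case: x; case: y. Qed.

Lemma cell_connect_sym C : connect_sym (cell_adj C).
Proof. by apply: sym_connect_sym; exact: cell_adj_sym. Qed.

Lemma connect_closed (T : finType) (r : rel T) (P : pred T) (x y : T) :
  (forall z t : T, r z t -> P z -> P t) -> connect r x y -> P x -> P y.
Proof.
move=> H /connectP [p]; elim: p x => [|z p IH] x /=; first by move=> _ ->.
by case/andP=> xz pz ey Px; apply: IH pz ey _; exact: H xz Px.
Qed.

Lemma connect_in C x y : connect (cell_adj C) x y -> x \in C -> y \in C.
Proof. by apply: connect_closed => z t /and3P []. Qed.

Lemma parts_connected C x : x \in C -> (forall y, y \in C -> connect (cell_adj C) x y) ->
  #|parts C| = 1%N.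
Proof.
move=> xC H; rewrite -(cards1 C); congr #|pred_of_set _|; apply/setP => D.
have cl z : z \in C -> [set y in C | connect (cell_adj C) z y] = C.
  move=> zC; apply/setP => y; rewrite inE; case yC: (y \in C) => //=.
  by apply: connect_trans (H _ yC); rewrite cell_connect_sym; exact: H.
rewrite inE; apply/imsetP/eqP => [[z zC ->]|->]; first exact: cl.
by exists x; rewrite ?cl.
Qed.

Lemma parts_connect C x y : #|parts C| = 1%N -> x \in C -> y \in C ->
  connect (cell_adj C) x y.
Proof.
move/eqP/cards1P => [D PD] xC yC.
have cl z : z \in C -> [set y in C | connect (cell_adj C) z y] = D.
  by move=> zC; apply/set1P; rewrite -PD; exact: imset_f.
have : y \in D by rewrite -(cl y yC) inE yC connect0.
by rewrite -(cl x xC) inE => /andP [].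
Qed.

Lemma parts_gt1 C x y : x \in C -> y \in C -> ~~ connect (cell_adj C) x y ->
  (1 < #|parts C|)%N.
Proof.
move=> xC yC xy; pose cl z := [set t in C | connect (cell_adj C) z t].
have clP z : z \in C -> cl z \in parts C by move=> zC; exact: imset_f.
suff : cl x != cl y.
  rewrite (cardsD1 (cl x)) clP // ltnS lt0n cards_eq0 => ne.
  by apply/set0Pn; exists (cl y); rewrite in_setD1 eq_sym ne clP.
apply: contra xy => /eqP E; have : y \in cl x by rewrite E inE yC connect0.
by rewrite inE => /andP [].
Qed.

Lemma incident_adj C u e : inl u \in C -> inr e \in C -> incident u e ->
  cell_adj C (inl u) (inr e).
Proof. by move=> uC eC ue; rewrite /cell_adj uC eC. Qed.

Lemma valence1_incident u e e' : valence u = 1%N -> incident u e -> incident u e' -> e = e'.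
Proof.
move/eqP/cards1P => [h Hh]; have hE f b : at_vertex (f, b) = u -> (f, b) = h.
  by move=> E; apply/set1P; rewrite -Hh inE E.
case/orP=> /eqP E; case/orP=> /eqP E'.
- by have := hE e' false E'; rewrite -(hE e false E) => -[].
- by have := hE e' true E'; rewrite -(hE e false E) => -[].
- by have := hE e' false E'; rewrite -(hE e true E) => -[].
- by have := hE e' true E'; rewrite -(hE e true E) => -[].
Qed.

Lemma valence1_other_end u e : valence u = 1%N -> incident u e ->
  exists2 w : vert G, w != u & ends G e = (u, w) \/ ends G e = (w, u).
Proof.
move/eqP/cards1P => [h Hh]; have hE f b : at_vertex (f, b) = u -> (f, b) = h.
  by move=> E; apply/set1P; rewrite -Hh inE E.
rewrite /incident; case Ee: (ends G e) => [a b] /= /orP [] /eqP E; rewrite E in Ee *.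
  exists b; last by left.
  apply/eqP => bu; move: (hE e false) (hE e true); rewrite /at_vertex /= Ee bu /=.
  by move=> /(_ erefl) <- /(_ erefl).
exists a; last by right.
apply/eqP => au; move: (hE e false) (hE e true); rewrite /at_vertex /= Ee au /=.
by move=> /(_ erefl) <- /(_ erefl).
Qed.

(** Removing [e] isolates the leaf [u], which is a tree, and leaves one other part [D], which keeps
    the Betti number 2 and so is not a tree. *)
Lemma tree_type_leaf u e : #|parts [set: cell G]| = 1%N -> betti1 [set: cell G] = 2%N ->
  valence u = 1%N -> incident u e -> tree_type e.
Proof.
move=> conn b2 vu ue; have [w wu Ee] := valence1_other_end vu ue.
have we : incident w e by rewrite /incident; case: Ee => -> /=; rewrite eqxx ?orbT.
have endE v : incident v e -> v = u \/ v = w.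
  by rewrite /incident; case: Ee => -> /= /orP [] /eqP ->; auto.
pose C : {set cell G} := [set~ inr e]; pose D := C :\ inl u.
have uC : inl u \in C by rewrite !inE.
have wC : inl w \in C by rewrite !inE.
have isolated (x : cell G) : connect (cell_adj C) (inl u) x -> x = inl u.
  move=> H; apply/eqP; apply: (connect_closed (P := pred1 (inl u))) H _; last exact: eqxx.
  move=> z t /and3P [_ tC adj] /eqP zE; rewrite zE in adj.
  case: t tC adj => // f fC /(valence1_incident vu ue) ef.
  by rewrite !inE ef eqxx in fC.
have restC (x y : cell G) : x \in D -> y \in D -> connect (cell_adj C) x y.
  rewrite !inE => /andP [xu xe] /andP [yu ye].
  (* What [x] reaches without using [e], enlarged by [u] and [e] once [w] is reached. This set is
     closed under adjacency in the whole graph, so connectedness of the graph puts [y] in it. *)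
  pose P z := connect (cell_adj C) x z || (z \in [:: inl u; inr e]) && connect (cell_adj C) x (inl w).
  have Pcl z t : cell_adj setT z t -> P z -> P t.
    case/and3P=> _ _ zt /orP [xz|/andP [zue xw]].
      have zu : z != inl u.
        apply: contra xu => /eqP zu; apply/eqP/isolated.
        by rewrite cell_connect_sym -zu.
      have zC : z \in C by apply: connect_in xz _; rewrite !inE.
      have [te|te] := eqVneq t (inr e).
        rewrite /P te !inE eqxx /= ?orbT.
        case: z zu xz zt {zC} => [v|f]; last by rewrite te.
        rewrite te => vu' xv /endE [vE|vE]; first by rewrite vE eqxx in vu'.
        by rewrite -vE xv orbT.
      apply/orP; left; apply: connect_trans xz (connect1 _).
      by rewrite /cell_adj zC zt !inE te.
    rewrite /P xw andbT; move: zue zt; rewrite !inE => /orP [] /eqP ->.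
      case: t => // f /(valence1_incident vu ue) <-; by rewrite eqxx !orbT.
    by case: t => // v /endE [] ->; rewrite ?xw ?eqxx ?orbT.
  have : P y.
    apply: (connect_closed Pcl (x := x)); last by rewrite /P connect0.
    by apply: parts_connect => //; rewrite inE.
  rewrite /P; case/orP=> //; rewrite !inE (negbTE yu) /= => /andP [/eqP yE].
  by rewrite yE eqxx in ye.
have wD : inl w \in D by rewrite !inE andbT; apply: contra wu => /eqP [->].
have PE : parts C = [set [set inl u]; D].
  apply/setP => X; rewrite !inE; apply/imsetP/orP => [[x xC ->]|[/eqP ->|/eqP ->]].
  - have [->|xu] := eqVneq x (inl u).
      left; apply/eqP/setP => y; rewrite !inE; apply/andP/eqP => [[_ /isolated //]|->].
      by rewrite connect0.
    right; apply/eqP/setP => y; rewrite !inE; apply/andP/andP => [[ye xy]|[yu ye]].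
      split=> //; apply: contra xu => /eqP yu; apply/eqP/isolated.
      by rewrite cell_connect_sym -yu.
    by split=> //; apply: restC; rewrite !inE ?xu ?yu //; move: xC; rewrite !inE.
  - exists (inl u) => //; apply/setP => y; rewrite !inE.
    apply/eqP/andP => [->|[_ /isolated //]]; by rewrite connect0.
  - exists (inl w) => //; apply/setP => y; rewrite !inE; apply/andP/andP => [[yu ye]|[ye wy]].
      by split=> //; apply: restC => //; rewrite !inE yu.
    split=> //; apply: contra wu => /eqP yu.
    have : connect (cell_adj C) (inl u) (inl w) by rewrite cell_connect_sym -yu.
    by move/isolated => -[->].
have uD : [set inl u] != D.
  by apply/eqP => /setP /(_ (inl u)); rewrite !inE eqxx.
rewrite /tree_type -/C PE cards2 uD /=.
have tu : is_tree [set inl u : cell G].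
  have p1 : #|parts [set inl u : cell G]| = 1%N.
    by apply: (@parts_connected _ (inl u)); rewrite ?set11 // => y /set1P ->; rewrite connect0.
  rewrite /is_tree p1 /= /betti1 p1.
  have -> : [set f | inr f \in [set inl u : cell G]] = set0 by apply/setP => f; rewrite !inE.
  have -> : [set v | inl v \in [set inl u : cell G]] = [set u] by apply/setP => v; rewrite !inE.
  by rewrite cards0 cards1.
(* Passing to [D] loses one vertex and one edge and keeps one component, so the Euler characteristic
   is unchanged. *)
have tD : ~~ is_tree D.
  apply/negP => /andP [/eqP p1 /eqP]; move: b2; rewrite /betti1 conn p1.
  have -> : #|[set f | inr f \in [set: cell G]]| = #|[set f | inr f \in D]|.+1.
    rewrite [LHS](cardsD1 e) !inE /= add1n; congr _.+1; apply: eq_card => f.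
    by rewrite !inE andbT.
  have -> : #|[set v | inl v \in [set: cell G]]| = #|[set v | inl v \in D]|.+1.
    rewrite [LHS](cardsD1 u) !inE /= add1n; congr _.+1; apply: eq_card => v.
    by rewrite !inE !andbT.
  by rewrite !addn1 !subSS => ->.
rewrite (_ : [set X in _ | is_tree X] = [set [set inl u]]) ?cards1 //.
apply/setP => X; rewrite !inE; apply/andP/eqP => [[/orP [] /eqP -> //]|-> ].
  by rewrite (negbTE tD).
by rewrite eqxx.
Qed.

End Connectivity.

(** Alternates edges and vertices: the cells met by a strand strictly between its two ends. *)
Fixpoint weave (V E : Type) (es : seq E) (vs : seq V) : seq (V + E) :=
  match es, vs with
  | e :: es', v :: vs' => inr e :: inl v :: weave es' vs'
  | e :: _, [::] => [:: inr e]
  | [::], _ => [::]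
  end.

Lemma perm_weave (V E : eqType) (es : seq E) (vs : seq V) : size es = (size vs).+1 ->
  perm_eq (weave es vs) (map inr es ++ map inl vs).
Proof.
elim: vs es => [|v vs IH] [|e es] //= [sz]; first by case: es sz.
by rewrite perm_cons perm_sym -cat1s perm_catCA /= perm_cons perm_sym IH.
Qed.

Section ThetaConnectivity.

Variable G : ograph.
Implicit Types (C : {set cell G}).

Lemma weave_path (x y : vert G) (es : seq (edge G)) (vs : seq (vert G)) :
  size es = (size vs).+1 ->
  {in zip es (zip (x :: vs) (rcons vs y)), forall a, incident a.2.1 a.1 && incident a.2.2 a.1} ->
  path (cell_adj [set: cell G]) (inl x) (rcons (weave es vs) (inl y)).
Proof.
elim: vs x es => [|v vs IH] x [|e es] //= [sz] H.
  case: es sz H => // _ /(_ (e, (x, y))); rewrite inE eqxx => /(_ isT) /= /andP [xe ye].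
  by rewrite /cell_adj !inE xe ye.
have /andP [/= xe ve] := H (e, (x, v)) (mem_head _ _).
rewrite {1 2}/cell_adj !inE xe ve /=; apply: IH => // a Ha.
by apply: H; rewrite inE Ha orbT.
Qed.

Lemma path_restrict C (x : cell G) (s : seq (cell G)) :
  path (cell_adj [set: cell G]) x s -> {subset x :: s <= C} -> path (cell_adj C) x s.
Proof.
elim: s x => //= y s IH x /andP [xy ys] sub; apply/andP; split; last first.
  by apply: IH => // z zs; apply: sub; rewrite inE zs orbT.
by move: xy; rewrite /cell_adj !inE /= => ->; rewrite !sub // !inE eqxx ?orbT.
Qed.

(** The path is simple, so [c] lies on at most one side of [z], and the other side still joins [z]
    to an end. *)
Lemma path_punctured C (c x y z : cell G) (s : seq (cell G)) :
  path (cell_adj [set: cell G]) x (rcons s y) -> uniq (x :: rcons s y) ->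
  (forall t, t \in x :: rcons s y -> t != c -> t \in C) -> z \in s -> z != c ->
  (x != c) && connect (cell_adj C) x z || (y != c) && connect (cell_adj C) y z.
Proof.
move=> Hp Hu HC zs zc; case/splitPr: zs Hp Hu HC => s1 s2.
rewrite rcons_cat rcons_cons -cat_rcons cat_path last_rcons => /andP [p1 p2].
rewrite -cat_cons cat_uniq => /and3P [_ disj _] HC.
have [cs1|cs1] := boolP (c \in x :: rcons s1 z); last first.
  apply/orP; left; have xc : x != c by apply: contra cs1 => /eqP <-; exact: mem_head.
  rewrite xc; apply/connectP; exists (rcons s1 z); last by rewrite last_rcons.
  apply: path_restrict p1 _ => t ts; apply: HC; first by rewrite mem_cat ts.
  by apply: contra cs1 => /eqP <-.
have cs2 : c \notin z :: rcons s2 y.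
  rewrite inE negb_or eq_sym zc; apply/negP => cs2; move/hasPn: disj => /(_ _ cs2).
  by rewrite /= cs1.
apply/orP; right; have yc : y != c.
  by apply: contra cs2 => /eqP <-; rewrite inE mem_rcons mem_head orbT.
rewrite yc cell_connect_sym; apply/connectP; exists (rcons s2 y); last by rewrite last_rcons.
apply: path_restrict p2 _ => t ts; apply: HC; last by apply: contra cs2 => /eqP <-.
rewrite mem_cat; move: ts; rewrite (in_cons z) => /orP [/eqP ->|->]; last by rewrite orbT.
by rewrite inE mem_rcons mem_head orbT.
Qed.

Lemma path_unpunctured C (c x y : cell G) (s : seq (cell G)) :
  path (cell_adj [set: cell G]) x (rcons s y) ->
  (forall t, t \in x :: rcons s y -> t != c -> t \in C) -> c \notin x :: rcons s y ->
  connect (cell_adj C) x y.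
Proof.
move=> Hp HC cs; apply/connectP; exists (rcons s y); last by rewrite last_rcons.
apply: path_restrict Hp _ => t ts; apply: HC => //; by apply: contra cs => /eqP <-.
Qed.

End ThetaConnectivity.

Section LabelledIsHairy.

Variables (G : ograph) (l : label (vert G) (edge G)).
Hypothesis hl : labelled l.

Let A := source l.
Let B := target l.

Definition strand_cells (p : strand (vert G) (edge G)) : seq (cell G) :=
  weave p.2 (unzip1 p.1).

Definition frame_cells : seq (cell G) :=
  [:: inl A, inl B & flatten (map strand_cells (strands l))].

Lemma perm_frame_cells :
  perm_eq frame_cells (map inl (core l) ++ map inr (frame_edges l)).
Proof.
rewrite /frame_cells /core /= !perm_cons perm_sym perm_catC perm_sym.
have /and4P [_ _ _ /allP sz] := labelled_shape hl.
apply: perm_trans (perm_flatten_map (fun p ps => perm_weave _)) _.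
  by move=> p ps; rewrite size_map; apply/eqP; exact: sz ps.
apply: perm_trans (perm_flatten_cat _ _ _) _.
by rewrite /frame_edges /beads !map_flatten -!map_comp perm_refl.
Qed.

Lemma uniq_frame_cells : uniq frame_cells.
Proof.
rewrite (perm_uniq perm_frame_cells) cat_uniq !map_inj_uniq; try by move=> ? ? [].
have := uniq_core_tips hl; rewrite cat_uniq => /and3P [-> _ _] /=.
have := uniq_edges hl; rewrite /unzip1 map_cat cat_uniq => /and3P [ue _ _].
rewrite -(frame_arcs_edges (labelled_shape hl)) ue andbT.
by apply/hasPn => _ /mapP [e _ ->]; apply/negP => /mapP [].
Qed.

Lemma mem_frame_cells (x : cell G) :
  (x \in frame_cells) = match x with inl v => v \in core l | inr e => e \in frame_edges l end.
Proof.
rewrite (perm_mem perm_frame_cells) mem_cat; case: x => [v|e].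
  rewrite mem_map; last by move=> ? ? [].
  by rewrite [X in _ || X](_ : _ = false) ?orbF //; apply/negP => /mapP [].
rewrite (mem_map (f := inr)); last by move=> ? ? [].
by rewrite [X in X || _](_ : _ = false) //; apply/negP => /mapP [].
Qed.

Lemma strand_cells_path p : p \in strands l ->
  path (cell_adj [set: cell G]) (inl A) (rcons (strand_cells p) (inl B)).
Proof.
move=> ps; have /and4P [_ _ _ /allP /(_ _ ps) /eqP sz] := labelled_shape hl.
apply: weave_path => [|a Ha]; first by rewrite size_map.
have Ha' : a \in frame_arcs l ++ spur_arcs l.
  rewrite mem_cat; apply/orP; left; apply/flattenP.
  by exists (strand_frame_arcs A B p) => //; exact: map_f.
by rewrite !(incident_arc hl _ Ha') !eqxx orbT.
Qed.

Lemma strand_cells_sub p : p \in strands l ->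
  {subset inl A :: rcons (strand_cells p) (inl B) <= frame_cells}.
Proof.
move=> ps x; rewrite inE mem_rcons !inE orbCA => /or3P [->|->|xp]; rewrite ?orbT //.
suff -> : x \in flatten (map strand_cells (strands l)) by rewrite !orbT.
by apply/flattenP; exists (strand_cells p) => //; exact: map_f.
Qed.

Lemma uniq_strand_cells p : p \in strands l -> uniq (inl A :: rcons (strand_cells p) (inl B)).
Proof.
move=> ps; have := uniq_frame_cells.
have Hp : perm_eq frame_cells ([:: inl A, inl B & strand_cells p] ++
    flatten (map strand_cells (rem p (strands l)))).
  by rewrite /frame_cells /= !perm_cons; exact: (perm_flatten (perm_map _ (perm_to_rem ps))).
rewrite (perm_uniq Hp) cat_uniq => /andP [u _].
rewrite (perm_uniq (s2 := [:: inl A, inl B & strand_cells p])) //.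
by rewrite perm_cons perm_rcons.
Qed.

(* Two of the three strands avoid any given cell, so that deleting a cell leaves the
   theta graph connected. *)
Lemma theta_connect (C : {set cell G}) (c x y : cell G) :
  {subset frame_cells <= [pred t | (t == c) || (t \in C)]} ->
  x \in frame_cells -> y \in frame_cells -> x != c -> y != c -> connect (cell_adj C) x y.
Proof.
move=> HC.
have HC' t : t \in frame_cells -> t != c -> t \in C.
  by move=> /HC /orP [/eqP ->|//]; rewrite eqxx.
have strandC p : p \in strands l ->
    forall t, t \in inl A :: rcons (strand_cells p) (inl B) -> t != c -> t \in C.
  by move=> ps t /(strand_cells_sub ps); exact: HC'.
have punct p z (ps : p \in strands l) := path_punctured (z := z) (strand_cells_path ps)
  (uniq_strand_cells ps) (strandC p ps).
have unpunct p (ps : p \in strands l) := path_unpunctured (strand_cells_path ps) (strandC p ps).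
have AB : inl A != c -> inl B != c -> connect (cell_adj C) (inl A) (inl B).
  move=> Ac Bc; have /and4P [_ _ /eqP sz3 _] := labelled_shape hl.
  (* No cell occurs twice in [frame_cells], so [c] misses the first strand or the second one. *)
  have [p ps cp] : exists2 p, p \in strands l & c \notin strand_cells p.
    have := uniq_frame_cells; rewrite /frame_cells.
    case: (strands l) sz3 => [|p [|q [|r []]]] //= _.
    rewrite !cat_uniq => /and4P [_ _ _ /andP [/hasPn H _]].
    have [cp|cp] := boolP (c \in strand_cells p); last by exists p; rewrite ?mem_head.
    exists q; rewrite ?inE ?eqxx ?orbT //; apply/negP => cq.
    by have := H c; rewrite !mem_cat cq cp => /(_ isT).
  apply: (unpunct p ps); rewrite inE mem_rcons inE !negb_or cp andbT.
  by rewrite !(eq_sym c) Ac Bc.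
(* Every remaining cell of the frame is still joined to a remaining end of the theta graph. *)
have hub z : z \in frame_cells -> z != c ->
    (inl A != c) && connect (cell_adj C) (inl A) z || (inl B != c) && connect (cell_adj C) (inl B) z.
  rewrite !inE => /or3P [/eqP ->|/eqP ->|/flattenP [_ /mapP [p ps ->] zp]] zc.
  - by rewrite zc connect0.
  - by rewrite zc connect0 orbT.
  - exact: punct ps zp zc.
have sym := @cell_connect_sym G C.
move=> xf yf xc yc; have /orP [/andP [A1 Ax]|/andP [B1 Bx]] := hub x xf xc.
  have /orP [/andP [_ Ay]|/andP [B1 By]] := hub y yf yc.
    by apply: connect_trans Ay; rewrite sym.
  by apply: connect_trans By; apply: connect_trans (AB A1 B1); rewrite sym.
have /orP [/andP [A1 Ay]|/andP [_ By]] := hub y yf yc.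
  apply: connect_trans Ay; rewrite sym; apply: connect_trans Bx; exact: AB.
by apply: connect_trans By; rewrite sym.
Qed.

Lemma frame_edgeP e : reflect (exists2 a, a \in frame_arcs l & e = a.1) (e \in frame_edges l).
Proof. by rewrite -(frame_arcs_edges (labelled_shape hl)); exact: mapP. Qed.

Lemma frame_edge_not_spur a : a \in spur_arcs l -> a.1 \notin frame_edges l.
Proof.
move=> Ha; apply/frame_edgeP => -[b Hb E].
by have := frame_spur_disjoint hl Hb Ha; rewrite E eqxx.
Qed.

(** The two closure conditions allow a hair to be retracted inside [C], from its tip over its edge
    to its root. *)
Lemma connect_core (C : {set cell G}) (x : cell G) : x \in C ->
  (forall a, a \in spur_arcs l -> inr a.1 \in C -> inl a.2.1 \in C) ->
  (forall a, a \in spur_arcs l -> inl a.2.2 \in C -> inr a.1 \in C) ->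
  exists2 y, y \in frame_cells & (y \in C) && connect (cell_adj C) y x.
Proof.
move=> xC H1 H2.
have spurE a : a \in spur_arcs l -> inr a.1 \in C ->
    (inl a.2.1 \in C) && connect (cell_adj C) (inl a.2.1) (inr a.1).
  move=> Ha aC; have rC := H1 a Ha aC; rewrite rC /=.
  apply/connect1/incident_adj => //; rewrite (incident_arc hl) ?eqxx //.
  by rewrite mem_cat Ha orbT.
have rootF a : a \in spur_arcs l -> inl a.2.1 \in frame_cells.
  by move=> Ha; rewrite mem_frame_cells; have [] := spur_arc_ends Ha.
case: x xC => [v|e] xC.
  have := mem_core_tips hl v; rewrite mem_cat => /orP [vc|/mapP [a Ha vE]].
    by exists (inl v); rewrite ?mem_frame_cells // xC connect0.
  have aC : inr a.1 \in C by apply: H2; rewrite -?vE.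
  exists (inl a.2.1); first exact: rootF.
  have /andP [-> /connect_trans] := spurE a Ha aC; apply.
  rewrite cell_connect_sym; apply/connect1/incident_adj => //.
  by rewrite vE (incident_arc hl) ?eqxx ?orbT // mem_cat Ha orbT.
have [a] := edge_arc hl e; rewrite mem_cat => /orP [Ha|Ha] eE; rewrite eE in xC *.
  exists (inr a.1); last by rewrite xC connect0.
  by rewrite mem_frame_cells; apply/frame_edgeP; exists a.
exists (inl a.2.1); [exact: rootF | exact: spurE].
Qed.

Lemma labelled_connected : #|parts [set: cell G]| = 1%N.
Proof.
apply: (@parts_connected _ _ (inl A)) => [|y _]; first by rewrite inE.
have [|||z zf /andP [_]] := @connect_core setT y; try by move=> *; rewrite ?inE.
apply: connect_trans; have Af : inl A \in frame_cells by rewrite mem_head.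
have Bf : inl B \in frame_cells by rewrite inE mem_head orbT.
(* [theta_connect] will be used with [inl B] as deleted cell, although nothing is deleted from the
   full set; it requires both ends of the connection to differ from that cell, so [z = inl B] is
   joined to [A] along a strand instead. *)
have [zB|zB] := eqVneq z (inl B).
  have [p ps] : exists p, p \in strands l.
    have /and4P [_ _ + _] := labelled_shape hl.
    by case: (strands l) => // p *; exists p; rewrite mem_head.
  rewrite zB; apply/connectP; exists (rcons (strand_cells p) (inl B)); last by rewrite last_rcons.
  exact: strand_cells_path.
apply: (@theta_connect _ (inl B)) => //; first by move=> t _; rewrite !inE orbT.
by have := uniq_frame_cells; rewrite /= inE negb_or => /andP [/andP [->]].
Qed.

Lemma labelled_betti1 : betti1 [set: cell G] = 2%N.
Proof.
rewrite /betti1 labelled_connected.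
have -> : [set e | inr e \in [set: cell G]] = setT by apply/setP => e; rewrite !inE.
have -> : [set v | inl v \in [set: cell G]] = setT by apply/setP => v; rewrite !inE.
have := label_size_verts hl; have := label_size_edges hl; rewrite !cardsT !card_ord; lia.
Qed.

(** Deleting a frame edge keeps the graph connected by [theta_connect]; every other edge ends at an
    external vertex, where [tree_type_leaf] applies. *)
Lemma tree_type_label e : tree_type e = (e \notin frame_edges l).
Proof.
have [ef|] := boolP (e \in frame_edges l).
  apply/negP => /andP [/eqP P2 _].
  suff P1 : #|parts [set~ inr e]| = 1%N by rewrite P1 in P2.
  have AC : inl A \in [set~ (inr e : cell G)] by rewrite !inE.
  apply: (@parts_connected _ _ (inl A)) => // y yC.
  have [a Ha _|a Ha _|z zf /andP [zC]] := @connect_core _ y yC.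
  - by rewrite !inE.
  - by rewrite !inE; apply: contra (frame_edge_not_spur Ha) => /eqP [->].
  apply: connect_trans; apply: (@theta_connect _ (inr e)) => //.
  - by move=> t _; rewrite !inE orbN.
  - exact: mem_head.
  - by rewrite !inE in zC.
have [a] := edge_arc hl e; rewrite mem_cat => /orP [Ha|Ha] eE eF.
  by case/negP: eF; apply/frame_edgeP; exists a.
have ua : incident a.2.2 e by rewrite eE (incident_arc hl) ?eqxx ?orbT // mem_cat Ha orbT.
apply: tree_type_leaf ua; [exact: labelled_connected | exact: labelled_betti1 |].
by apply/eqP; rewrite -[_ == _]/(external _) (external_tip hl); have [] := spur_arc_ends Ha.
Qed.

Lemma frame_label (x : cell G) : (x \in frame G) = (x \in frame_cells).
Proof.
rewrite mem_frame_cells inE; case: x => [v|e]; last by rewrite tree_type_label negbK.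
apply/existsP/idP => [[e]|vc].
  rewrite tree_type_label negbK => /andP [/frame_edgeP [a Ha ->]].
  rewrite (incident_arc hl) ?mem_cat ?Ha //; have [a1 a2] := frame_arc_ends Ha.
  by case/orP=> /eqP <-.
have [a Ha av] := core_frame_arc hl vc; exists a.1.
rewrite tree_type_label negbK (incident_arc hl) ?mem_cat ?Ha // av andbT.
by apply/frame_edgeP; exists a.
Qed.

Lemma frame_no_cut v : ~~ cut_vertex (frame G) v.
Proof.
apply/negP => /andP [vf]; rewrite ltnNge => /negP; apply.
have AB : inl A != inl B :> cell G.
  by have := uniq_frame_cells; rewrite /= inE negb_or => /andP [/andP [->]].
have Af : inl A \in frame_cells by rewrite mem_head.
have Bf : inl B \in frame_cells by rewrite inE mem_head orbT.
have [x xf xv] : exists2 x, x \in frame_cells & x != inl v.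
  have [Av|Av] := eqVneq (inl A) (inl v : cell G); last by exists (inl A).
  by exists (inl B) => //; rewrite -Av eq_sym.
rewrite (@parts_connected _ _ x) // => [|y]; first by rewrite in_setD1 xv frame_label.
rewrite in_setD1 frame_label => /andP [yv yf].
apply: (@theta_connect _ (inl v)) => // t tf.
by rewrite inE in_setD1 frame_label tf andbT orbN.
Qed.

Lemma tree_hair e : @tree_type G e -> @hair G e.
Proof.
move=> te; rewrite /hair te /=; rewrite tree_type_label in te.
have [a] := edge_arc hl e; rewrite mem_cat => /orP [Ha|Ha] eE.
  by case/negP: te; apply/frame_edgeP; exists a.
have aall b : b \in spur_arcs l -> b \in frame_arcs l ++ spur_arcs l.
  by move=> Hb; rewrite mem_cat Hb orbT.
have [rc tt] := spur_arc_ends Ha.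
apply/existsP; exists a.2.2; apply/existsP; exists a.2.1; apply/and4P; split.
- rewrite eE; case: (arc_endsP hl (aall a Ha)) => ->; last by rewrite eqxx.
  by rewrite -surjective_pairing eqxx orbT.
- by rewrite -[_ == _]/(external _) (external_tip hl).
- by rewrite frame_label mem_frame_cells.
apply/forallP => e'; apply/implyP => /andP []; rewrite tree_type_label => te' ae'.
have [b] := edge_arc hl e'; rewrite mem_cat => /orP [Hb|Hb] eE'.
  by case/negP: te'; apply/frame_edgeP; exists b.
move: ae'; rewrite eE' (incident_arc hl _ (aall b Hb)) => /orP [/eqP ba|/eqP ba].
  by rewrite eE (uniq_map_inj_in (uniq_roots hl) Hb Ha ba).
have := core_not_tip hl rc; rewrite -ba => /negP; case.
by have [] := spur_arc_ends Hb.
Qed.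

Lemma labelled_hairy : (0 < hodge G)%N -> two_loop_hairy G.
Proof.
move=> hk; rewrite /two_loop_hairy /admissible (labelled_order hl) labelled_connected.
rewrite labelled_betti1 !eqxx /=; apply/and3P; split; last 2 first.
- by apply/forallP => v; exact: frame_no_cut.
- by apply/forallP => e; apply/implyP; exact: tree_hair.
apply/andP; split; last first.
  by case/card_gt0P: hk => v; rewrite inE => vx; apply/existsP; exists v.
apply/forallP => v; rewrite (external_tip hl) (internal_core hl).
by have := mem_core_tips hl v; rewrite mem_cat orbC.
Qed.

End LabelledIsHairy.

(** * Invariance of the sign of a label *)

Lemma cat_inj (T : eqType) (s1 s2 t1 t2 : seq T) :
  size s1 = size t1 -> s1 ++ s2 = t1 ++ t2 -> s1 = t1 /\ s2 = t2.
Proof. by move=> sz /eqP; rewrite eqseq_cat // => /andP [/eqP -> /eqP ->]. Qed.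

Section LabelExtensionality.

Variables V E : eqType.

Lemma hairs_ext (s t : seq (V * E)) : unzip1 s = unzip1 t -> unzip2 s = unzip2 t -> s = t.
Proof. by move=> E1 E2; rewrite -[s]zip_unzip -[t]zip_unzip E1 E2. Qed.

Lemma strand_ext (p q : strand V E) : size p.1 = size q.1 -> p.2 = q.2 ->
  strand_verts p = strand_verts q -> [seq b.2.2 | b <- p.1] = [seq b.2.2 | b <- q.1] -> p = q.
Proof.
case: p q => [s es] [t fs] /= sz ->; rewrite /strand_verts /= => Ev Eh; congr pair.
elim: s t sz Ev Eh => [|[v [u h]] s IH] [|[v' [u' h']] t] //= [sz] [-> -> Ev] [-> Eh].
by rewrite (IH t sz Ev Eh).
Qed.

Lemma strands_ext (A B A' B' : V) (ps qs : seq (strand V E)) :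
  [seq size p.1 | p <- ps] = [seq size p.1 | p <- qs] ->
  all (fun p => size p.2 == (size p.1).+1) ps -> all (fun p => size p.2 == (size p.1).+1) qs ->
  flatten (map (@strand_verts V E) ps) = flatten (map (@strand_verts V E) qs) ->
  unzip1 (flatten (map (strand_arcs A B) ps)) = unzip1 (flatten (map (strand_arcs A' B') qs)) ->
  ps = qs.
Proof.
elim: ps qs => [|p ps IH] [|q qs] //= [sz szs] /andP [/eqP sp sps] /andP [/eqP sq sqs].
case/cat_inj; first by rewrite !size_strand_verts sz.
move=> Ev Evs; rewrite /unzip1.
rewrite (map_cat fst (strand_arcs A B p)) (map_cat fst (strand_arcs A' B' q)) => /cat_inj.
have Ep : map fst (strand_arcs A B p) = _ := strand_arcs_edges A B sp.
have Eq : map fst (strand_arcs A' B' q) = _ := strand_arcs_edges A' B' sq.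
rewrite Ep Eq !size_cat !size_map sp sq sz => /(_ erefl) [EE Es].
have [|E1 E2] := cat_inj _ EE; first by rewrite sp sq sz.
by rewrite (strand_ext sz E1 Ev E2) (IH qs).
Qed.

(** Type and shape fix the position of every entry of the label in the two flattened lists, which
    can therefore be cut back into their pieces. *)
Lemma label_ext (l l' : label V E) : label_type l = label_type l' ->
  well_shaped l -> well_shaped l' -> label_verts l = label_verts l' ->
  unzip1 (label_arcs l) = unzip1 (label_arcs l') -> l = l'.
Proof.
case: l l' => [A B hA hB ps] [A' B' hA' hB' ps']; rewrite /label_type /= => -[sA sB sp].
move=> /and4P [_ _ _ /= sps] /and4P [_ _ _ /= sps'].
rewrite /label_verts /label_arcs /= => -[-> EE].
have {EE} [|EA [-> EE]] := cat_inj _ EE; first by rewrite !size_map.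
have {EE} [|EB Ev] := cat_inj _ EE; first by rewrite !size_map.
have edgesE x (hs : seq (V * E)) : map fst (hair_arcs x hs) = unzip2 hs.
  by rewrite /hair_arcs -map_comp.
rewrite /unzip1 !(map_cat fst) !edgesE => EE.
have {EE} [|FA EE] := cat_inj _ EE; first by rewrite !size_map.
have {EE} [|FB Ee] := cat_inj _ EE; first by rewrite !size_map.
by rewrite (hairs_ext EA FA) (hairs_ext EB FB) (strands_ext sp sps sps' Ev Ee).
Qed.

End LabelExtensionality.

Lemma transport_seq (S T : eqType) (x0 : T) (s : seq S) (t : seq T) : uniq s -> size s = size t ->
  map (fun x => nth x0 t (index x s)) s = t.
Proof.
move=> us sz; case: s us sz => [|y s] us sz; first by case: t sz.
apply: (@eq_from_nth _ x0) => [|i]; rewrite size_map // => Hi.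
by rewrite (nth_map y) // index_uniq.
Qed.

Lemma size_label_verts (V E : Type) (l : label V E) : size (label_verts l) =
  (2 + (label_type l).1.1 + (label_type l).1.2 + (sumn (label_type l).2).*2)%N.
Proof.
rewrite /label_verts /= !size_cat /= !size_cat /= !size_map.
suff -> : size (flatten (map (@strand_verts V E) (strands l))) =
  (sumn [seq size p.1 | p <- strands l]).*2 by lia.
by elim: (strands l) => //= p ps IH; rewrite size_cat size_strand_verts IH; lia.
Qed.

Lemma size_label_arcs (V E : Type) (l : label V E) : well_shaped l -> size (label_arcs l) =
  (3 + (label_type l).1.1 + (label_type l).1.2 + (sumn (label_type l).2).*2)%N.
Proof.
case/and4P=> _ _ /eqP <- sz; rewrite /label_arcs /= !size_cat !size_map.
suff -> : size (flatten (map (strand_arcs (source l) (target l)) (strands l))) =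
  (size (strands l) + (sumn [seq size p.1 | p <- strands l]).*2)%N by lia.
elim: (strands l) sz => //= p ps IH /andP [/eqP szp /IH {}IH]; rewrite size_cat IH.
rewrite /strand_arcs size_cat !size_zip /= size_rcons !size_map szp minnn; lia.
Qed.

Lemma count_lt_in (T : eqType) (q p : pred T) (s : seq T) x : x \in s -> p x -> ~~ q x ->
  {in s, forall y, q y -> p y} -> (count q s < count p s)%N.
Proof.
move=> xs px /negbTE qx qp; rewrite -!size_filter.
have -> : filter q s = filter q (filter p s).
  rewrite -filter_predI; apply: eq_in_filter => y ys /=.
  by case qy: (q y); rewrite ?andbF // qp.
rewrite [ltnLHS]size_filter -(count_predC q (filter p s)) -[ltnLHS]addn0 ltn_add2l -has_count.
by apply/hasP; exists x; rewrite ?mem_filter ?px //= qx.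
Qed.

Section Equivalences.

Variables m N : nat.
Hypotheses (hm : odd m) (hN : odd N).

Local Notation "x ~~~ y" := (eqv m N x y) (at level 70).

Definition type_hodge (t : nat * nat * seq nat) : nat := (t.1.1 + t.1.2 + sumn t.2)%N.

Lemma labelled_admissible (G : ograph) (l : label (vert G) (edge G)) :
  labelled l -> (0 < type_hodge (label_type l))%N -> admissible G.
Proof.
by move=> hl hk; have := labelled_hairy hl; rewrite (hodge_label hl) => /(_ hk) /and4P [].
Qed.

(** The vertices along a strand, ends included, are distinct, and a hair joins a core vertex to a
    tip. Without self-loops, reversing an edge always changes [arc_flipped]. *)
Lemma frame_arc_ends_neq (G : ograph) (l : label (vert G) (edge G)) a : labelled l ->
  a \in label_arcs l -> a.2.1 != a.2.2.
Proof.
move=> hl; rewrite (perm_mem (perm_label_arcs l)) mem_cat => /orP [|Ha]; last first.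
  have [rc tt] := spur_arc_ends Ha; apply: contraL rc => /eqP ->.
  by apply: contraL tt; exact: core_not_tip.
case/flattenP => _ /mapP [p ps ->].
have : uniq (source l :: rcons (unzip1 p.1) (target l)).
  have := uniq_core_tips hl; rewrite cat_uniq => /and3P [+ _ _].
  rewrite (perm_uniq (s2 := [:: source l, target l & unzip1 p.1] ++
      flatten [seq unzip1 q.1 | q <- rem p (strands l)])).
    rewrite cat_uniq => /and3P [+ _ _]; rewrite (perm_uniq (s2 := source l :: rcons (unzip1 p.1) (target l))) //.
    by rewrite perm_cons perm_sym perm_rcons.
  by rewrite /= !perm_cons; exact: (perm_flatten (perm_map _ (perm_to_rem ps))).
rewrite /strand_frame_arcs; case: p {ps} => bs es /=.
elim: bs (source l) es => [|b bs IH] x [|e es] //=.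
  by rewrite inE andbT => xy; case: es => [|? ?]; rewrite inE => /eqP ->.
case/andP => xb ub; rewrite inE => /orP [/eqP -> /=|]; last exact: IH ub.
by move: xb; rewrite inE negb_or => /andP [].
Qed.

Lemma labelled_reverse (G : ograph) (e : edge G) (l : label (vert G) (edge G)) :
  @labelled (reverse_edge e) l = labelled l.
Proof.
rewrite /labelled; congr [&& _, _, _, _ & _]; apply: eq_all => -[e' [z t]].
rewrite /arc_matches /= ffunE; case: ifP => // _.
by case: (ends G e') => x y; rewrite !xpair_eqE orbC; congr (_ || _); exact: andbC.
Qed.

Lemma odd_count_addb (T : Type) (p q : pred T) (s : seq T) :
  odd (count (fun x => p x (+) q x) s) = odd (count p s) (+) odd (count q s).
Proof. by elim: s => //= x s IH; rewrite !oddD IH !oddb addbACA. Qed.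

Lemma label_odd_reverse (G : ograph) (e : edge G) (l : label (vert G) (edge G)) :
  labelled l -> @label_odd (reverse_edge e) l = ~~ label_odd l.
Proof.
move=> hl; rewrite /label_odd -[~~ _]addTb addbCA addTb; congr (_ (+) _).
rewrite (eq_in_count (a2 := fun a => @arc_flipped G a (+) (a.1 == e))).
  rewrite odd_count_addb; have -> : count (fun a => a.1 == e) (label_arcs l) = 1%N.
    rewrite -(count_map fst (pred1 e)) -/(unzip1 _); case/and5P: hl => _ _ pE _ _.
    by rewrite (permP pE) count_uniq_mem ?enum_uniq // mem_enum.
  by rewrite addbT.
move=> a Ha; have nl := frame_arc_ends_neq hl Ha.
case/and5P: hl => _ _ _ _ /allP /(_ a Ha); rewrite /arc_flipped /= ffunE.
case: (a.1 == e); rewrite ?addbF // addbT negbK /arc_matches.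
case: a.2 nl => x y /= xy /orP [] /eqP -> /=; rewrite eqxx xpair_eqE.
  by rewrite eq_sym (negbTE xy).
by rewrite (negbTE xy) andbF.
Qed.

Lemma reverse_eqv (G : ograph) (e : edge G) : admissible G ->
  << reverse_edge e >> ~~~ - << G >>.
Proof.
move=> hG; have := null_relator (relator_reverse m N e hG).
by rewrite /eqv -signr_odd hN expr1 scaleN1r.
Qed.

(** Each reversal of a flipped edge negates both the class of the graph and the sign of the label,
    so their product survives; the induction is on the number of flipped arcs. The graph is given by
    its fields because only [ends] varies. *)
Lemma straighten (n p : nat) (ord : seq ('I_n + 'I_p)) (l : label 'I_n 'I_p)
    (ends1 : {ffun 'I_p -> 'I_n * 'I_n}) :
  (0 < type_hodge (label_type l))%N -> @labelled (OGraph ends1 ord) l ->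
  exists ends2, [/\ @labelled (OGraph ends2 ord) l,
    count (@arc_flipped (OGraph ends2 ord)) (label_arcs l) = 0%N &
    @label_sign (OGraph ends1 ord) l *: << OGraph ends1 ord >> ~~~
    @label_sign (OGraph ends2 ord) l *: << OGraph ends2 ord >>].
Proof.
move=> hk; have [k] := ubnP (count (@arc_flipped (OGraph ends1 ord)) (label_arcs l)).
elim: k ends1 => // k IH ends1 hc hl.
have [c0|] := posnP (count (@arc_flipped (OGraph ends1 ord)) (label_arcs l)).
  by exists ends1; split=> //; exact: eqv_refl.
rewrite -has_count => /hasP [a Ha fa].
pose G := OGraph ends1 ord; pose G1 := @reverse_edge G a.1.
have hl1 : @labelled G1 l by rewrite labelled_reverse.
have lt1 : (count (@arc_flipped G1) (label_arcs l) < k)%N.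
  rewrite ltnS in hc; apply: leq_trans _ hc; apply: (count_lt_in Ha fa).
    move: fa; rewrite /arc_flipped /= ffunE eqxx negbK.
    case/and5P: (hl) => _ _ _ _ /allP /(_ a Ha); rewrite /arc_matches /=.
    by case/orP=> /eqP ->; rewrite ?eqxx //= -surjective_pairing.
  move=> y Hy; rewrite /arc_flipped /= ffunE; case: ifP => // /eqP ya _.
  case/and5P: (hl) => _ _ pE _ _; have uE : uniq (unzip1 (label_arcs l)).
    by rewrite (perm_uniq pE) enum_uniq.
  by rewrite (uniq_map_inj_in uE Hy Ha ya).
have [ends2 [h2 c2 e2]] := IH _ lt1 hl1; exists ends2; split=> //.
have sE : @label_sign G1 l = - @label_sign G l.
  by rewrite /label_sign (@label_odd_reverse G a.1 l hl) sgnN.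
apply: eqv_trans e2; rewrite -/G -/G1 sE scaleNr -scalerN.
apply: eqvZ; rewrite -[<< G >>]opprK; apply: eqvN; apply: eqv_sym; apply: (@reverse_eqv G a.1).
exact: labelled_admissible hl hk.
Qed.

Lemma reorder_eqv (G : ograph) (s : seq (cell G)) (l : label (vert G) (edge G)) :
  (0 < type_hodge (label_type l))%N -> labelled l -> perm_eq s (ordr G) ->
  @labelled (reorder s) l /\
  @label_sign (reorder s) l *: << reorder s >> ~~~ label_sign l *: << G >>.
Proof.
move=> hk hl hs; have po := labelled_order hl; split.
  by case/and5P: hl => _ h2 h3 h4 h5; apply/and5P; split=> //; exact: perm_trans hs po.
have := null_relator (relator_reorder m N (labelled_admissible hl hk) hs).
have pv : perm_eq (label_verts l) (enum 'I_(nv G)) by case/and5P: hl.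
rewrite (koszul_sign hm hN po hs pv) => /(eqvZ (@label_sign (reorder s) l)) /eqv_trans; apply.
rewrite scalerA; apply: eq_ind (eqv_refl m N _) _ _; congr (_ *: _).
rewrite /label_sign -sgnD /label_odd; congr sgn.
have -> : count (@arc_flipped (reorder s)) (label_arcs l) = count (@arc_flipped G) (label_arcs l) by [].
by case: (odd (count _ _)); case: (odd (inversions (@rank (reorder s)) _));
  case: (odd (inversions (@rank G) _)).
Qed.

Lemma labelled_map (G H : ograph) (f : vert G -> vert H) (g : edge G -> edge H)
    (l : label (vert G) (edge G)) : bijective f -> bijective g ->
  (forall e, ends H (g e) = (f (ends G e).1, f (ends G e).2)) ->
  ordr H = [seq match x with inl v => inl (f v) | inr e => inr (g e) end | x <- ordr G] ->
  labelled l -> labelled (map_label f g l) /\ label_odd (map_label f g l) = label_odd l.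
Proof.
move=> bf bg Eg Eo hl; have [fi gi] := (bij_inj bf, bij_inj bg).
pose fg (x : cell G) : cell H := match x with inl v => inl (f v) | inr e => inr (g e) end.
have fgi : injective fg by move=> [v|e] [w|e'] //= [] => [/fi ->|/gi ->].
have bijP (S T : finType) (h : S -> T) (s : seq S) : bijective h -> perm_eq s (enum S) ->
    perm_eq (map h s) (enum T).
  move=> bh ps; apply: uniq_perm; rewrite ?enum_uniq //.
    by rewrite map_inj_uniq ?(perm_uniq ps) ?enum_uniq //; exact: bij_inj.
  move=> t; rewrite mem_enum; case: bh => h' hK h'K; rewrite -(h'K t) mem_map; last exact: can_inj hK.
  by rewrite (perm_mem ps) mem_enum.
have bfg : bijective fg.
  case: bf bg => f' fK f'K [g' gK g'K].
  exists (fun x => match x with inl v => inl (f' v) | inr e => inr (g' e) end).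
    by case=> x /=; rewrite ?fK ?gK.
  by case=> x /=; rewrite ?f'K ?g'K.
have mapE a : ends H (map_arc f g a).1 = (map_arc f g (a.1, ends G a.1)).2 by rewrite Eg.
case/and5P: hl => h1 h2 h3 h4 h5; split.
  apply/and5P; split.
  - by rewrite Eo; exact: bijP.
  - by rewrite label_verts_map; exact: bijP.
  - rewrite label_arcs_map /unzip1 -map_comp (map_comp g fst); exact: bijP.
  - by rewrite well_shaped_map.
  rewrite label_arcs_map all_map; apply: sub_all h5 => a /orP [] /eqP Ea;
    by rewrite /arc_matches /= mapE /= Ea eqxx ?orbT.
rewrite /label_odd label_verts_map label_arcs_map count_map.
congr (odd _ (+) odd _).
  have rE v : rank (f v) = rank v by rewrite /rank Eo; exact: (index_map fgi (ordr G) (inl v)).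
  by apply: inversions_map => v w; rewrite !rE.
apply: eq_count => a; rewrite /arc_flipped /= mapE /=; congr (~~ _).
apply/eqP/eqP => [[/fi E1 /fi E2]|-> //].
by case: (ends G a.1) a.2 E1 E2 => ? ? [? ?] /= -> ->.
Qed.

Lemma iso_eqv (G H : ograph) (f : vert G -> vert H) (g : edge G -> edge H)
    (l : label (vert G) (edge G)) : (0 < type_hodge (label_type l))%N ->
  bijective f -> bijective g ->
  (forall e, ends H (g e) = (f (ends G e).1, f (ends G e).2)) ->
  ordr H = [seq match x with inl v => inl (f v) | inr e => inr (g e) end | x <- ordr G] ->
  labelled l -> << H >> ~~~ << G >>.
Proof.
move=> hk bf bg Eg Eo hl; apply: null_relator; apply: relator_iso.
- exact: labelled_admissible hl hk.
- have [hl' _] := labelled_map bf bg Eg Eo hl.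
  by apply: labelled_admissible hl' _; rewrite label_type_map.
- by exists f, g; split.
Qed.

(** The class of a signed labelled graph depends on its type only. Once all edges agree with their
    arcs, matching the entries of the two labels gives an isomorphism up to a change of order, which
    [reorder_eqv] absorbs. *)
Lemma same_type_eqv (G H : ograph) (l : label (vert G) (edge G)) (l' : label (vert H) (edge H)) :
  (0 < type_hodge (label_type l))%N -> labelled l -> labelled l' ->
  label_type l = label_type l' -> label_sign l *: << G >> ~~~ label_sign l' *: << H >>.
Proof.
case: G H l l' => [n p ends1 ord] [n' p' ends1' ord'] /= l l' hk hl hl' tE.
have [ends2 [h2 c2 e2]] := straighten hk hl.
have hk' : (0 < type_hodge (label_type l'))%N by rewrite -tE.
have [ends2' [h2' c2' e2']] := straighten hk' hl'.
apply: eqv_trans e2 (eqv_trans _ (eqv_sym e2')).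
move: h2 h2' c2 c2' {hl hl' e2'}; set G := OGraph ends2 ord; set H := OGraph ends2' ord'.
move=> hl hl' cl cl'.
(* Matches vertices by their position in the two listings; [g] below does the same for edges. *)
pose f (v : vert G) : vert H := nth (source l') (label_verts l') (index v (label_verts l)).
have szV : size (label_verts l) = size (label_verts l') by rewrite !size_label_verts tE.
have wl := labelled_shape hl; have wl' := labelled_shape hl'.
have szE : size (label_arcs l) = size (label_arcs l') by rewrite !size_label_arcs // tE.
case Ea' : (label_arcs l') => [|a0 s0].
  by have := size_label_arcs wl'; rewrite Ea' /= -!addnA.
pose g (e : edge G) : edge H := nth a0.1 (unzip1 (label_arcs l')) (index e (unzip1 (label_arcs l))).
case/and5P: (hl) => h1 h2 h3 h4 h5; case/and5P: (hl') => h1' h2' h3' h4' h5'.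
have uV : uniq (label_verts l) by rewrite (perm_uniq h2) enum_uniq.
have uE : uniq (unzip1 (label_arcs l)) by rewrite (perm_uniq h3) enum_uniq.
have fV : map f (label_verts l) = label_verts l' by apply: transport_seq.
have gE : map g (unzip1 (label_arcs l)) = unzip1 (label_arcs l').
  by apply: transport_seq => //; rewrite !size_map.
have lE : map_label f g l = l'.
  apply: label_ext; rewrite ?label_type_map ?well_shaped_map ?label_verts_map //.
  by rewrite label_arcs_map -gE /unzip1 -!map_comp.
have bijP (k k' : nat) (h : 'I_k -> 'I_k') s s' : perm_eq s (enum 'I_k) ->
    perm_eq s' (enum 'I_k') -> map h s = s' -> bijective h.
  move=> ps ps' E; apply: inj_card_bij; last first.
    have := perm_size ps; have := perm_size ps'; rewrite !card_ord !size_enum_ord -E size_map.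
    by move=> k'E kE; rewrite (eq_leq (etrans (esym k'E) kE)).
  have us : uniq (map h s) by rewrite E (perm_uniq ps') enum_uniq.
  by move=> x y; apply: (uniq_map_inj_in us); rewrite (perm_mem ps) mem_enum.
have bf : bijective f by exact: bijP h2 h2' fV.
have bg : bijective g by exact: bijP h3 h3' gE.
have straight (K : ograph) (k : label (vert K) (edge K)) : count (@arc_flipped K) (label_arcs k) = 0%N ->
    {in label_arcs k, forall a, ends K a.1 = a.2}.
  by move/eqP; rewrite -leqn0 leqNgt -has_count => /hasPn nf a /nf /negbNE /eqP.
have Eg e : ends H (g e) = (f (ends G e).1, f (ends G e).2).
  have : e \in unzip1 (label_arcs l) by rewrite (perm_mem h3) mem_enum.
  case/mapP => a Ha ->; rewrite (straight _ _ cl _ Ha).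
  have Ha' : map_arc f g a \in label_arcs l' by rewrite -lE label_arcs_map map_f.
  by rewrite (straight _ _ cl' _ Ha').
pose fg (x : cell G) : cell H := match x with inl v => inl (f v) | inr e => inr (g e) end.
(* [H] with the order transported from [G], so that [f] and [g] become an isomorphism of oriented
   graphs from [G] to [H']. *)
pose H' := @reorder H (map fg (ordr G)).
have [hl'' so] := @labelled_map G H' f g l bf bg Eg erefl hl.
have ps : perm_eq (map fg (ordr G)) (ordr H).
  by apply: perm_trans (labelled_order hl'') _; rewrite perm_sym; exact: labelled_order hl'.
have [_ e1] := @reorder_eqv H (map fg (ordr G)) l' hk' hl' ps.
apply: eqv_trans e1; rewrite /label_sign -{1}so -lE; apply: eqvZ; apply: eqv_sym.
exact: (@iso_eqv G H' f g l).
Qed.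


End Equivalences.

(** * Permuting the strands and exchanging the two ends *)

Section LabelSymmetries.

Variable G : ograph.
Implicit Type l : label (vert G) (edge G).

Lemma labelled_permute l (ps : seq (strand (vert G) (edge G))) : labelled l ->
  perm_eq (strands l) ps ->
  labelled (permute_label l ps) /\ label_odd (permute_label l ps) = label_odd l.
Proof.
move=> hl hp; case/and5P: (hl) => h1 h2 h3 h4 h5.
have pv : perm_eq (label_verts (permute_label l ps)) (label_verts l).
  by rewrite !perm_cat2l perm_sym; exact/perm_flatten/perm_map.
have pa : perm_eq (label_arcs (permute_label l ps)) (label_arcs l).
  by rewrite !perm_cat2l perm_sym; exact/perm_flatten/perm_map.
split; last first.
  rewrite /label_odd (permP pa); congr (_ (+) _).
  have rinj := rank_inj (labelled_order hl).
  have even_verts p : ~~ odd (size (@strand_verts (vert G) (edge G) p)).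
    by rewrite size_strand_verts odd_double.
  have := odd_inversions_blocks ((source l :: unzip1 (source_hairs l)) ++
    (target l :: unzip1 (target_hairs l))) [::] rinj even_verts _ hp.
  rewrite !cats0 -!catA => -> //.
  by move: (h2) => /perm_uniq; rewrite enum_uniq /label_verts !cat_uniq => /and3P [_ _ /and3P []].
apply/and5P; split=> //; first exact: perm_trans pv h2.
- exact: perm_trans (perm_map _ pa) h3.
- case/and4P: h4 => a b c d; apply/and4P; split=> //=; first by rewrite -(perm_size hp).
  by rewrite -(perm_all _ hp).
- by rewrite (perm_all _ pa).
Qed.

Definition flip_arc (V E : Type) (a : E * (V * V)) : E * (V * V) := (a.1, (a.2.2, a.2.1)).

Lemma strand_frame_arcs_rev (V E : Type) (x y : V) (p : strand V E) :
  size p.2 = (size p.1).+1 ->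
  strand_frame_arcs y x (rev_strand p) = rev (map (@flip_arc V E) (strand_frame_arcs x y p)).
Proof.
case: p => bs es /= sz; rewrite /strand_frame_arcs /=.
have szz : size (unzip1 bs) = size bs by rewrite size_map.
have -> : map (@flip_arc V E) (zip es (zip (x :: unzip1 bs) (rcons (unzip1 bs) y))) =
    zip es (zip (rcons (unzip1 bs) y) (x :: unzip1 bs)).
  elim: es (x :: _) (rcons _ _) {sz szz} => [|e es IH] [|a s] [|b t] //=; by rewrite IH.
rewrite rev_zip; last by rewrite size_zip /= size_rcons szz minnn.
rewrite rev_zip; last by rewrite /= size_rcons szz.
by rewrite /unzip1 map_rev rev_rcons rev_cons.
Qed.

Lemma frame_arcs_rev (V E : eqType) (l : label V E) : well_shaped l ->
  perm_eq (frame_arcs (rev_label l)) (map (@flip_arc V E) (frame_arcs l)).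
Proof.
case/and4P=> _ _ _ sz; rewrite /frame_arcs /= map_flatten -!map_comp.
apply: perm_flatten_map => p ps /=; rewrite strand_frame_arcs_rev ?perm_rev //.
by apply/eqP; exact: (allP sz).
Qed.

Lemma spur_arcs_rev (V E : eqType) (l : label V E) :
  perm_eq (spur_arcs (rev_label l)) (spur_arcs l).
Proof.
rewrite /spur_arcs /= perm_catCA !perm_cat2l -map_comp.
by apply: perm_flatten_map => p _ /=; rewrite /bead_arcs /= map_rev perm_rev.
Qed.

Lemma flattened_strand_verts (V E : Type) (ps : seq (strand V E)) :
  flatten (map (@strand_verts V E) ps) =
  flatten [seq [:: b.1; b.2.1] | b <- flatten [seq p.1 | p <- ps]].
Proof. by elim: ps => //= p ps ->; rewrite map_cat flatten_cat. Qed.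

(** Two signs arise. The end blocks, of sizes one plus their numbers of hairs, are exchanged: this
    is odd when both sizes are odd. All frame edges are read backwards, and there are three more of
    them than beads. Hairs keep their direction. *)
Lemma labelled_rev l : labelled l -> labelled (rev_label l) /\
  label_odd (rev_label l) =
  label_odd l (+) (~~ odd (size (source_hairs l)) && ~~ odd (size (target_hairs l)))
    (+) ~~ odd (sumn (label_type l).2).
Proof.
move=> hl; case/and5P: (hl) => h1 h2 h3 h4 h5.
have pb : perm_eq (flatten [seq p.1 | p <- map (@rev_strand _ _) (strands l)])
    (flatten [seq p.1 | p <- strands l]).
  by rewrite -map_comp; apply: perm_flatten_map => p _; rewrite perm_rev.
have pa : perm_eq (label_arcs (rev_label l)) (map (@flip_arc _ _) (frame_arcs l) ++ spur_arcs l).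
  apply: perm_trans (perm_label_arcs _) _.
  by apply: perm_cat; [exact: frame_arcs_rev | exact: spur_arcs_rev].
have uv : uniq (label_verts l) by rewrite (perm_uniq h2) enum_uniq.
split; last first.
  have rinj := rank_inj (labelled_order hl).
  have E1 : odd (inversions (@rank G) (label_verts (rev_label l))) =
      (~~ odd (size (source_hairs l)) && ~~ odd (size (target_hairs l)))
      (+) odd (inversions (@rank G) (label_verts l)).
    (* Reversing a strand reverses the sequence of its (bead, tip) pairs but not the pairs
       themselves, hence moves blocks of size 2 and costs no sign. *)
    have := odd_inversions_blocks ((target l :: unzip1 (target_hairs l)) ++
      (source l :: unzip1 (source_hairs l))) [::] (F := fun b => [:: b.1; b.2.1]) rinj _ _ pb.
    rewrite -!flattened_strand_verts !cats0 -!catA => -> //; last first.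
      move: (uv); rewrite (perm_uniq (s2 := label_verts (rev_label l))).
        by rewrite /label_verts !cat_uniq => /and3P [_ _ /and3P []].
      rewrite perm_sym /label_verts /= -!cat_cons perm_catCA !perm_cat2l.
      by rewrite !flattened_strand_verts; exact/perm_flatten/perm_map.
    have := odd_inversions_swap [::] (t1 := source l :: unzip1 (source_hairs l))
      (t2 := target l :: unzip1 (target_hairs l)) (flatten (map (@strand_verts _ _) (strands l))) rinj.
    rewrite /= !size_map => H; rewrite /label_verts H ?addbA ?addbb //.
    by move: uv; rewrite /label_verts catA cat_uniq => /andP [].
  have E2 : odd (count (@arc_flipped G) (label_arcs (rev_label l))) =
      odd (count (@arc_flipped G) (label_arcs l)) (+) ~~ odd (sumn (label_type l).2).
    rewrite (permP pa) (permP (perm_label_arcs l)) (count_cat _ (map _ _)) (count_cat _ (frame_arcs l)).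
    rewrite count_map !oddD.
    (* Without loops, an arc read backwards is flipped exactly when the original is not. *)
    have -> : count (preim (@flip_arc (vert G) (edge G)) (@arc_flipped G)) (frame_arcs l) =
        count (predC (@arc_flipped G)) (frame_arcs l).
      apply: eq_in_count => a Ha.
      have Ha' : a \in label_arcs l by rewrite (perm_mem (perm_label_arcs l)) mem_cat Ha.
      have nl := frame_arc_ends_neq hl Ha'; move/allP: h5 => /(_ a Ha').
      rewrite /arc_matches /arc_flipped /=; case: a nl {Ha Ha'} => e [x y] /= xy.
      by case/orP=> /eqP ->; rewrite ?eqxx !xpair_eqE ?(eq_sym y) (negbTE xy).
    have -> : odd (count (predC (@arc_flipped G)) (frame_arcs l)) =
        odd (count (@arc_flipped G) (frame_arcs l)) (+) odd (size (frame_arcs l)).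
      by rewrite -(count_predC (@arc_flipped G) (frame_arcs l)) oddD addbA addbb.
    rewrite -(size_map fst (frame_arcs l)) -/(unzip1 _) (frame_arcs_edges h4).
    rewrite (size_frame_edges h4) oddD addbT.
    by do ![case: (odd _) => //=].
  by rewrite /label_odd E1 E2; do ![case: (odd _) => //=].
apply/and5P; split=> //.
- apply: perm_trans h2; rewrite /label_verts /= -!cat_cons perm_catCA !perm_cat2l.
  by rewrite !flattened_strand_verts; exact/perm_flatten/perm_map.
- apply: perm_trans h3; apply: perm_trans (perm_map _ pa) _; rewrite perm_sym.
  have flE (F S : seq (edge G * (vert G * vert G))) :
      unzip1 (map (@flip_arc _ _) F ++ S) = unzip1 (F ++ S).
    by rewrite /unzip1 !map_cat -map_comp; congr cat; exact: eq_map.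
  by rewrite -/(unzip1 _) flE; exact: perm_map (perm_label_arcs l).
- case/and4P: h4 => a b c d; apply/and4P; split=> //=; first by rewrite size_map.
  by rewrite all_map; apply: sub_all d => p /= ; rewrite !size_rev.
- rewrite (perm_all _ pa) all_cat; move: h5; rewrite (perm_all _ (perm_label_arcs l)) all_cat.
  case/andP=> h5 ->; rewrite andbT all_map; apply: sub_all h5 => a.
  by rewrite /arc_matches /= orbC -surjective_pairing.
Qed.


End LabelSymmetries.

(** * Splitting a labelled graph *)

Section Splitting.

Variables (G : ograph) (v : vert G) (S : {set half_edge G}).
Hypothesis S_at_v : forall h, h \in S -> at_vertex h = v.

Local Notation G' := (split_vertex v S).
Local Notation lv := (lift (@ord0 (nv G))).
Local Notation le := (lift (@ord0 (ne G))).

Definition split_at (h : half_edge G) : vert G' :=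
  if h \in S then ord0 else lv (at_vertex h).

Definition source_half (a : edge G * (vert G * vert G)) : half_edge G := (a.1, arc_flipped a).
Definition target_half (a : edge G * (vert G * vert G)) : half_edge G := (a.1, ~~ arc_flipped a).

Definition split_arc (a : edge G * (vert G * vert G)) : edge G' * (vert G' * vert G') :=
  (le a.1, (split_at (source_half a), split_at (target_half a))).

(** The new edge points from the old vertex to the new one; [b] tells that the label reads it the
    other way, so [b] is its contribution to the flips. *)
Definition new_arc (b : bool) : edge G' * (vert G' * vert G') :=
  (ord0, if b then (ord0, lv v) else (lv v, ord0)).

Lemma at_source_half a : arc_matches a -> at_vertex (source_half a) = a.2.1.
Proof.
case: a => e [x y]; rewrite /arc_matches /at_vertex /source_half /arc_flipped.
rewrite -[(e, (x, y)).1]/e -[(e, (x, y)).2]/(x, y) => /orP [] /eqP ->; first by rewrite eqxx.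
by case: (_ =P (x, y)) => [[->]|].
Qed.

Lemma at_target_half a : arc_matches a -> at_vertex (target_half a) = a.2.2.
Proof.
case: a => e [x y]; rewrite /arc_matches /at_vertex /target_half /arc_flipped.
rewrite -[(e, (x, y)).1]/e -[(e, (x, y)).2]/(x, y) => /orP [] /eqP ->; first by rewrite eqxx.
by case: (_ =P (x, y)) => [[->]|].
Qed.

Lemma split_ends_old e : ends G' (le e) = (split_at (e, false), split_at (e, true)).
Proof. by rewrite ffunE liftK. Qed.

Lemma split_ends_new : ends G' ord0 = (lv v, ord0).
Proof. by rewrite ffunE unlift_none. Qed.

Lemma split_at_away h : at_vertex h != v -> split_at h = lv (at_vertex h).
Proof. by rewrite /split_at; case: ifP => // /S_at_v ->; rewrite eqxx. Qed.

Lemma split_arc_matches a : arc_matches (split_arc a).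
Proof.
rewrite /arc_matches /split_arc /= split_ends_old /source_half /target_half.
by case: (arc_flipped a); rewrite eqxx ?orbT.
Qed.

Lemma split_arc_flipped a : arc_matches a -> a.2.1 != a.2.2 ->
  arc_flipped (split_arc a) = arc_flipped a.
Proof.
move=> am ne; have neq : split_at (source_half a) != split_at (target_half a).
  rewrite /split_at; case: ifP => [/S_at_v|_]; case: ifP => [/S_at_v|_] //.
    by rewrite at_source_half // at_target_half // => E1 E2; rewrite E1 E2 eqxx in ne.
  by rewrite (inj_eq lift_inj) at_source_half // at_target_half.
rewrite {1}/arc_flipped /split_arc /= split_ends_old; move: neq.
rewrite /source_half /target_half; case: (arc_flipped a) => /= neq; last by rewrite eqxx.
by rewrite xpair_eqE eq_sym (negbTE neq).
Qed.

Definition lift_cell (x : cell G) : cell G' :=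
  match x with inl u => inl (lv u) | inr e => inr (le e) end.

Lemma lift_cell_inj : injective lift_cell.
Proof.
move=> [y|y] [z|z] //= H; congr (_ _); apply: (@lift_inj _ ord0).
  by apply: (@inl_inj _ (edge G')).
by apply: (@inr_inj (vert G')).
Qed.

Lemma rank_split_old x : @rank G' (lv x) = (rank x).+2.
Proof. by rewrite /rank /= -(index_map lift_cell_inj). Qed.

(** Splitting creates no loop, so old arcs keep their flips and only the new arc contributes [b].
    The effect on the order of the vertices depends on where [l'] lists the new vertex and is
    computed by the users of the lemma. *)
Lemma labelled_split (l : label (vert G) (edge G)) (l' : label (vert G') (edge G')) (b : bool) :
  labelled l -> perm_eq (label_verts l') (ord0 :: map lv (label_verts l)) ->
  perm_eq (label_arcs l') (new_arc b :: map split_arc (label_arcs l)) -> well_shaped l' ->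
  labelled l' /\
  odd (count (@arc_flipped G') (label_arcs l')) =
    odd (count (@arc_flipped G) (label_arcs l)) (+) b.
Proof.
move=> hl pv pa wl'; case/and5P: (hl) => h1 h2 h3 h4 h5; split; last first.
  rewrite (permP pa) /= count_map oddD oddb addbC; congr (odd _ (+) _).
    apply: eq_in_count => a Ha /=; apply: split_arc_flipped; first exact: (allP h5).
    exact: frame_arc_ends_neq hl Ha.
  rewrite /arc_flipped -[(new_arc b).1]/ord0 split_ends_new /new_arc.
  by case: b {pa}; rewrite ?eqxx //; apply/eqP => -[].
apply/and5P; split=> //.
- apply: uniq_perm; rewrite ?enum_uniq //.
    rewrite /= !inE /= (map_inj_uniq lift_cell_inj) (perm_uniq h1) enum_uniq andbT.
    by apply/andP; split; apply/mapP => -[[y|y] _ //] [] /eqP; rewrite (negbTE (neq_lift _ _)).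
  move=> x; rewrite mem_enum /= !inE; case: x => [x|x].
    case: (unliftP ord0 x) => [y ->|-> //]; apply/orP; right; apply/orP; right.
    by apply/mapP; exists (inl y); rewrite // (perm_mem h1) mem_enum.
  case: (unliftP ord0 x) => [y ->|->]; last by rewrite eqxx !orbT.
  by apply/orP; right; apply/orP; right; apply/mapP; exists (inr y); rewrite // (perm_mem h1) mem_enum.
- by apply: perm_trans pv _; rewrite enum_ordSl perm_cons; exact: perm_map.
- apply: perm_trans (perm_map _ pa) _; rewrite /= enum_ordSl perm_cons -map_comp.
  by rewrite (map_comp le fst); exact: perm_map.
- rewrite (perm_all _ pa) /=; apply/andP; split.
    by rewrite /arc_matches split_ends_new /new_arc; case: b {pa}; rewrite eqxx ?orbT.
  by apply/allP => _ /mapP [a _ ->]; exact: split_arc_matches.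
Qed.

End Splitting.

(** Meant for an edge incident to [v]; otherwise the value is the half at the target of the edge. *)
Definition half_at (G : ograph) (v : vert G) (e : edge G) : half_edge G :=
  (e, (ends G e).1 != v).

Definition strand_tail (V E : Type) (y : V) (bs : seq (V * (V * E))) (es : seq E) :
    seq (E * (V * V)) :=
  zip es (zip (unzip1 bs) (behead (rcons (unzip1 bs) y))) ++
  [seq (b.2.2, (b.1, b.2.1)) | b <- bs].

Lemma strand_arcs_first (V E : Type) (x y : V) bs (e : E) es :
  strand_arcs x y (bs, e :: es) = (e, (x, head y (unzip1 bs))) :: strand_tail y bs es.
Proof. by case: bs. Qed.

Section SplitLabel.

Variables (G : ograph) (l : label (vert G) (edge G)).
Hypothesis hl : labelled l.

Let A := source l.
Let B := target l.

Variable S : {set half_edge G}.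
Hypothesis S_at_A : forall h, h \in S -> at_vertex h = A.

Local Notation G' := (split_vertex A S).
Local Notation lv := (lift (@ord0 (nv G))).
Local Notation le := (lift (@ord0 (ne G))).

Definition split_source (e : edge G) : vert G' :=
  if half_at A e \in S then ord0 else lv A.

Lemma label_arc_matches a : a \in label_arcs l -> arc_matches a.
Proof. by case/and5P: hl => _ _ _ _ /allP H /H. Qed.

Lemma source_not_other x : x \in target l :: beads l ++ tips l -> x != A.
Proof.
have := uniq_core_tips hl; rewrite /= => /andP [Ac _] xc.
by apply/eqP => xA; case/negP: Ac; rewrite -[source l]/A -xA.
Qed.

Lemma half_at_arc a : a \in label_arcs l -> a.2.1 = A -> source_half a = half_at A a.1.
Proof.
move=> Ha aA; have am := label_arc_matches Ha; have ne := frame_arc_ends_neq hl Ha.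
rewrite /source_half /half_at /arc_flipped; congr pair.
case: a am ne aA {Ha} => e [x y]; rewrite /arc_matches => am /= xy xA; rewrite -xA.
by case/orP: am => /eqP -> /=; rewrite ?eqxx // xpair_eqE eq_sym (negbTE xy).
Qed.

Lemma split_arc_source a : a \in label_arcs l -> a.2.1 = A ->
  split_arc A S a = (le a.1, (split_source a.1, lv a.2.2)).
Proof.
move=> Ha aA; have am := label_arc_matches Ha; have ne := frame_arc_ends_neq hl Ha.
have tA : at_vertex (target_half a) != A by rewrite at_target_half // -aA eq_sym.
rewrite /split_arc (split_at_away S_at_A tA) at_target_half //.
by rewrite /split_at /split_source -half_at_arc // at_source_half // aA.
Qed.

Lemma split_arc_away a : a \in label_arcs l -> a.2.1 != A -> a.2.2 != A ->
  split_arc A S a = map_arc lv le a.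
Proof.
move=> Ha a1 a2; have am := label_arc_matches Ha.
by rewrite /split_arc !(split_at_away S_at_A) ?at_target_half ?at_source_half.
Qed.

Lemma mem_strand_arcs p a : p \in strands l -> a \in strand_arcs A B p -> a \in label_arcs l.
Proof.
move=> ps Ha; rewrite !mem_cat; apply/orP; right; apply/orP; right.
by apply/flattenP; exists (strand_arcs A B p) => //; exact: map_f.
Qed.

Lemma split_strand bs e es : (bs, e :: es) \in strands l ->
  map (split_arc A S) (strand_arcs A B (bs, e :: es)) =
  strand_arcs (split_source e) (lv B) (map_strand lv le (bs, e :: es)).
Proof.
move=> ps; have bsub x : x \in unzip1 bs -> x \in beads l.
  by move=> xb; apply/flattenP; exists (unzip1 bs) => //; exact: (map_f (fun p => unzip1 p.1) ps).
have tsub b : b \in bs -> b.2.1 \in tips l.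
  move=> bb; rewrite tipsE !mem_cat; apply/orP; right; apply/orP; right.
  apply/flattenP; exists [seq b.2.1 | b <- bs]; last exact: (map_f (fun b => b.2.1) bb).
  exact: (map_f (fun p => [seq b.2.1 | b <- p.1]) ps).
rewrite [in RHS]/map_strand /= !strand_arcs_first /=; congr cons.
  rewrite split_arc_source //; last by apply: (mem_strand_arcs ps); rewrite strand_arcs_first mem_head.
  by rewrite /= /unzip1 -map_comp; case: bs {ps bsub tsub}.
have -> : strand_tail (lv B) [seq (lv b.1, (lv b.2.1, le b.2.2)) | b <- bs] (map le es) =
    map (map_arc lv le) (strand_tail B bs es).
  rewrite /strand_tail map_cat -!map_comp; congr cat.
  have -> : unzip1 [seq (lv b.1, (lv b.2.1, le b.2.2)) | b <- bs] = map lv (unzip1 bs).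
    by rewrite /unzip1 -!map_comp.
  by rewrite -map_rcons behead_map !zip_map.
apply/eq_in_map => a Ha.
have Ha' : a \in label_arcs l.
  by apply: (mem_strand_arcs ps); rewrite strand_arcs_first inE Ha orbT.
move: Ha; rewrite mem_cat => /orP [/mem_zip /andP [_ /mem_zip /andP [a1 a2]]|/mapP [b bb aE]].
  apply: split_arc_away => //; apply: source_not_other; rewrite inE mem_cat.
    by rewrite (bsub _ a1) orbT.
  by move/mem_behead: a2; rewrite mem_rcons inE => /orP [->|/bsub ->]; rewrite ?orbT.
apply: split_arc_away; rewrite // aE /=; apply: source_not_other; rewrite inE mem_cat.
  by rewrite bsub ?orbT //; exact: map_f.
by rewrite tsub ?orbT.
Qed.

Lemma split_target_hairs :
  map (split_arc A S) (hair_arcs B (target_hairs l)) =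
  hair_arcs (lv B) [seq (lv q.1, le q.2) | q <- target_hairs l].
Proof.
rewrite /hair_arcs -!map_comp; apply/eq_in_map => q qh /=.
rewrite split_arc_away //.
- by rewrite !mem_cat; apply/orP; right; apply/orP; left; exact: (map_f (fun q => (q.2, (B, q.1))) qh).
- by apply: source_not_other; rewrite mem_head.
apply: source_not_other; rewrite inE mem_cat tipsE !mem_cat.
by rewrite (map_f fst qh) !orbT.
Qed.

Lemma split_source_hairs :
  map (split_arc A S) (hair_arcs A (source_hairs l)) =
  [seq (le q.2, (split_source q.2, lv q.1)) | q <- source_hairs l].
Proof.
rewrite /hair_arcs -map_comp; apply/eq_in_map => q qh /=.
rewrite split_arc_source // !mem_cat; apply/orP; left.
exact: (map_f (fun q => (q.2, (A, q.1))) qh).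
Qed.

Lemma split_strands x : {in strands l, forall p, if p.2 is e :: _ then split_source e = x else False} ->
  map (split_arc A S) (flatten (map (strand_arcs A B) (strands l))) =
  flatten (map (strand_arcs x (lv B)) (map (map_strand lv le) (strands l))).
Proof.
move=> H; rewrite map_flatten -!map_comp; congr flatten; apply/eq_in_map => -[bs [|e es]] ps /=.
  by have := H _ ps.
by rewrite split_strand // (H _ ps).
Qed.

End SplitLabel.

Lemma subseq_cons_cat (T : eqType) (x : T) (s1 s2 s3 : seq T) :
  subseq s1 s3 -> subseq (x :: s1) (s2 ++ x :: s3).
Proof. by move=> s13; apply: subseq_trans (suffix_subseq s2 _); rewrite /= eqxx. Qed.

Section SplitAtSource.

Variables (G : ograph) (A B u : vert G) (h : edge G) (hB : seq (vert G * edge G)).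
Variables (bs : seq (vert G * (vert G * edge G))) (e : edge G) (es : seq (edge G)).
Variables (q r : strand (vert G) (edge G)).

Local Notation l := (Label A B [:: (u, h)] hB [:: (bs, e :: es); q; r]).
Hypothesis hl : labelled l.

Local Notation lv := (lift (@ord0 (nv G))).
Local Notation le := (lift (@ord0 (ne G))).
Local Notation first_edge p := (head h p.2).

Lemma half_at_edge_inj : injective (half_at A).
Proof. by move=> x y [->]. Qed.

(** A strand has at least one frame edge, so the default [h] of [head] is never returned: these are
    the hair and the three initial edges at [A], all distinct entries of the list of edges. *)
Lemma first_edges_uniq : uniq [:: h; e; first_edge q; first_edge r].
Proof.
case/and5P: hl => _ _ pE /and4P [_ _ _ /= /and4P [_ szq szr _]] _.
have ue : uniq (unzip1 (label_arcs l)) by rewrite (perm_uniq pE) enum_uniq.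
apply: (@subseq_uniq _ [:: h; e; first_edge q; first_edge r] _ _ ue); case: q r szq szr => [bq [|eq fq]] [br [|er fr]] //= _ _.
rewrite /label_arcs /= !strand_arcs_first /= eqxx /unzip1.
rewrite (map_cat fst (hair_arcs B hB)) /=; apply: subseq_cons_cat.
rewrite (map_cat fst (strand_tail B bs es)) /=; apply: subseq_cons_cat.
by rewrite (map_cat fst (strand_tail B bq fq)) /=; apply: subseq_cons_cat; exact: sub0seq.
Qed.

(** Separating the hair and the edge [e] from the two other strands moves the hair from the end [A]
    onto the strand of [e], as a new first bead. [b] tells which side takes the new vertex; the sign
    is the same for both. *)
Lemma split_hair_first (S : {set half_edge G}) (b : bool) :
  S = (if b then [set half_at A (first_edge q); half_at A (first_edge r)]
       else [set half_at A h; half_at A e]) ->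
  (forall x, x \in S -> at_vertex x = A) ->
  exists l' : label (vert (split_vertex A S)) (edge (split_vertex A S)),
    [/\ labelled l', label_type l' = (0, size hB, [:: (size bs).+1; size q.1; size r.1])%N
      & label_odd l' = ~~ label_odd l].
Proof.
move=> SE SA; pose G' := split_vertex A S.
(* [x] is the trivalent end of the resulting theta graph and [w] the bead that receives the hair. *)
pose x : vert G' := if b then ord0 else lv A; pose w : vert G' := if b then lv A else ord0.
have memS f : (half_at A f \in S) =
    if b then (f == first_edge q) || (f == first_edge r) else (f == h) || (f == e).
  by rewrite SE; case: (b); rewrite !inE !(inj_eq half_at_edge_inj).
have [hN eN qN rN] : [/\ split_source l S h = w, split_source l S e = w,
    split_source l S (first_edge q) = x & split_source l S (first_edge r) = x].
  have := first_edges_uniq; rewrite /= !inE !negb_or => /and4P [/and3P [h1 h2 h3] /andP [h4 h5] h6 _].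
  rewrite /split_source /x /w !memS; case: (b); rewrite !eqxx ?orbT; split=> //.
  - by rewrite (negbTE h2) (negbTE h3).
  - by rewrite (negbTE h4) (negbTE h5).
  - by rewrite !(eq_sym (first_edge q)) (negbTE h2) (negbTE h4).
  - by rewrite !(eq_sym (first_edge r)) (negbTE h3) (negbTE h5).
pose hB' := [seq (lv y.1, le y.2) | y <- hB].
pose p' : strand (vert G') (edge G') :=
  ((w, (lv u, le h)) :: (map_strand lv le (bs, e :: es)).1, ord0 :: map le (e :: es)).
pose l' : label (vert G') (edge G') :=
  Label x (lv B) [::] hB' [:: p'; map_strand lv le q; map_strand lv le r].
have wl : well_shaped l by case/and5P: hl.
have wl' : well_shaped l'.
  case/and4P: wl => _ hb _ /= /and4P [szp szq szr _].
  by rewrite /well_shaped /= !size_map hb szq szr /= andbT; exact: szp.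
have xw : perm_eq [:: x; w] [:: ord0; lv A].
  by rewrite /x /w; case: ifP => _ //; rewrite (perm_catC [:: _] [:: _]).
have pv : perm_eq (label_verts l') (ord0 :: map lv (label_verts l)).
  rewrite -(label_verts_map lv le).
  apply/permP => P; have /permP/(_ P) /= := xw.
  rewrite /label_verts /= !count_cat /= !count_cat /=.
  rewrite -[flatten _]/(strand_verts (map_strand lv le (bs, e :: es))) -/hB'.
  move: (count P (strand_verts (map_strand lv le (bs, e :: es))))
    (count P (strand_verts (map_strand lv le q))) (count P (strand_verts (map_strand lv le r)))
    (count P (unzip1 hB')) (P x : nat) (P w : nat) => n1 n2 n3 n4 n5 n6; lia.
have pa : perm_eq (label_arcs l') (new_arc A S b :: map (split_arc A S) (label_arcs l)).
  have [szq szr] : (size q.2 == (size q.1).+1)%N /\ (size r.2 == (size r.1).+1)%N.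
    by case/and4P: wl => _ _ _ /= /and4P [].
  have -> : label_arcs l = (h, (A, u)) :: hair_arcs B hB ++ strand_arcs A B (bs, e :: es) ++
      strand_arcs A B q ++ strand_arcs A B r by rewrite /label_arcs /= cats0.
  have -> : label_arcs l' = hair_arcs (lv B) hB' ++ strand_arcs x (lv B) p' ++
      strand_arcs x (lv B) (map_strand lv le q) ++ strand_arcs x (lv B) (map_strand lv le r).
    by rewrite /label_arcs /= cats0.
  have qE : map (split_arc A S) (strand_arcs A B q) = strand_arcs x (lv B) (map_strand lv le q).
    case: (q) szq qN (split_strand hl SA (bs := q.1) (e := first_edge q) (es := behead q.2)) => bq [|eq fq] //= _ -> -> //.
    by rewrite !inE eqxx orbT.
  have rE : map (split_arc A S) (strand_arcs A B r) = strand_arcs x (lv B) (map_strand lv le r).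
    case: (r) szr rN (split_strand hl SA (bs := r.1) (e := first_edge r) (es := behead r.2)) => br [|er fr] //= _ -> -> //.
    by rewrite !inE eqxx !orbT.
  have pE : map (split_arc A S) (strand_arcs A B (bs, e :: es)) =
      strand_arcs w (lv B) (map_strand lv le (bs, e :: es)).
    by rewrite -eN; apply: (split_strand hl SA); exact: mem_head.
  have tE : map (split_arc A S) (hair_arcs B hB) = hair_arcs (lv B) hB' := split_target_hairs hl SA.
  have hE : split_arc A S (h, (A, u)) = (le h, (w, lv u)).
    by rewrite -hN; exact: (congr1 (head (new_arc A S b)) (split_source_hairs hl SA)).
  have nE : new_arc A S b = (ord0, (x, w)) by rewrite /new_arc /x /w; case: (b).
  rewrite map_cons (map_cat _ (hair_arcs B hB)) (map_cat _ (strand_arcs A B (bs, e :: es))).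
  rewrite (map_cat _ (strand_arcs A B q)) qE rE pE tE nE hE; apply/permP => P.
  have /permP/(_ P) cE := strand_arcs_cons x (lv B) (w, (lv u, le h))
    (map_strand lv le (bs, e :: es)).1 ord0 (map le (e :: es)).
  rewrite (count_cat P (hair_arcs (lv B) hB')) (count_cat P (strand_arcs x (lv B) p')) cE.
  rewrite -[RHS]/(_ + (_ + count P (_ ++ _)))%N (count_cat P (hair_arcs (lv B) hB')).
  rewrite (count_cat P (strand_arcs w (lv B) (map_strand lv le (bs, e :: es)))).
  rewrite -[count P (_ :: _ :: _)]/(_ + (_ + count P _))%N /=.
  set n1 := count P (strand_arcs w _ _); set n2 := count P (_ ++ _).
  move: n1 n2 (count P (hair_arcs _ _)) (nat_of_bool (P (ord0, _))) (nat_of_bool (P (le h, _))).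
  by move=> n1 n2 n3 n4 n5; lia.
have [hl' cnt] := labelled_split SA hl pv pa wl'; exists l'; split=> //.
  by rewrite /label_type /= !size_map.
have rinj := rank_inj (labelled_order hl').
have [X XE] : {X | X = lv B :: unzip1 hB'} by exists (lv B :: unzip1 hB').
have [Y YE] : {Y | Y = flatten (map (@strand_verts _ _) [:: map_strand lv le (bs, e :: es);
  map_strand lv le q; map_strand lv le r])} by eexists.
have lE : map lv (label_verts l) = [:: lv A; lv u] ++ X ++ Y.
  by rewrite -(label_verts_map lv le) XE YE.
have l'E : label_verts l' = (x :: X) ++ [:: w; lv u] ++ Y by rewrite XE YE.
have uvl : uniq ([:: lv A; lv u] ++ X ++ Y).
  rewrite -lE (map_inj_uniq (@lift_inj _ _)); case/and5P: hl => _ pvl _ _ _.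
  by rewrite (perm_uniq pvl) enum_uniq.
have uX : uniq ([:: lv A; lv u] ++ X).
  by move: uvl; rewrite (catA [:: lv A; lv u]) cat_uniq; case/andP.
have rank_pos y : y \in [:: lv A; lv u] ++ X ++ Y -> (@rank G' ord0 < @rank G' y)%N.
  by rewrite -lE => /mapP [z _ ->]; rewrite rank_split_old.
rewrite /label_odd cnt.
have <- : inversions (@rank G') ([:: lv A; lv u] ++ X ++ Y) = inversions (@rank G) (label_verts l).
  by rewrite -lE; apply: inversions_map => y z; rewrite !rank_split_old.
(* For [b] true, the new vertex opens the listing and the pair [(lv A, lv u)] crosses [X] as an even
   block: no sign, but the new arc is flipped. For [b] false, the new vertex makes [size X + 1]
   inversions and moving [lv u] across [X] makes [size X] more: an odd total, with no flip. *)
have oddE : odd (inversions (@rank G') (label_verts l')) =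
    odd (inversions (@rank G') ([:: lv A; lv u] ++ X ++ Y)) (+) ~~ b.
  rewrite l'E /x /w; case: (b); rewrite ?addbF ?addbT.
    rewrite -[(_ :: X) ++ _]/([::] ++ (ord0 : vert G') :: (X ++ [:: lv A; lv u] ++ Y)).
    rewrite inversions_insert_min => [|y yin]; last first.
      apply: rank_pos; move: yin; rewrite cat0s !mem_cat !inE.
      by move=> yin; repeat (case/orP: yin => yin); rewrite yin ?orbT.
    rewrite addn0 (odd_inversions_swap [::] (t1 := X) (t2 := [:: lv A; lv u])) ?andbF //.
    by rewrite uniq_catC.
  rewrite -[(_ :: X) ++ _]/((lv A :: X) ++ (ord0 : vert G') :: lv u :: Y) inversions_insert_min => [|y yin]; last first.
    apply: rank_pos; move: yin; rewrite !mem_cat !inE.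
    by move=> yin; repeat (case/orP: yin => yin); rewrite yin ?orbT.
  have H := odd_inversions_swap [:: lv A] (t1 := [:: lv u]) (t2 := X) Y rinj.
  rewrite /= in H; rewrite oddD /= H.
    by case: (odd (size X)); case: (odd _).
  by move: uX; rewrite /= => /and3P [_ -> ->].
by rewrite oddE; case: (b); case: (odd _); case: (odd _).
Qed.

End SplitAtSource.

(** * Splittings of a four-valent vertex *)

Section FourValentSplittings.

Variables (G : ograph) (v : vert G).

Lemma splitting_valence (P : {set {set half_edge G}}) : splitting v P -> (4 <= valence v)%N.
Proof.
case/and3P=> pP /eqP c2 /forall_inP big; rewrite /valence (card_partition pP).
have : (\sum_(X in P) 2 <= \sum_(X in P) #|X|)%N by apply: leq_sum => X /big.
by rewrite sum_nat_const c2.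
Qed.

Definition pair_splitting (h k : half_edge G) : {set {set half_edge G}} :=
  [set [set h; k]; halves v :\: [set h; k]].

(** Two blocks of size at least 2 among four half-edges both have size 2, so a splitting amounts to
    the choice of the partner [k] of a fixed half-edge [h]. *)
Lemma splittingP (h : half_edge G) (P : {set {set half_edge G}}) :
  valence v = 4%N -> h \in halves v ->
  reflect (exists2 k, k \in halves v :\ h & P = pair_splitting h k) (splitting v P).
Proof.
move=> v4 hv; apply: (iffP idP) => [sP|[k kv ->]].
  case/and3P: (sP) => pP /eqP c2 /forall_inP big.
  have cP : h \in cover P by rewrite (cover_partition pP).
  pose X := pblock P h; have XP : X \in P := pblock_mem cP.
  have hX : h \in X by rewrite mem_pblock.
  have [Y PE] : exists Y, P :\ X = [set Y].
    by apply/cards1P; have := cardsD1 X P; rewrite XP c2 add1n => -[H]; apply/eqP/esym.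
  have YP : Y \in P by have := set11 Y; rewrite -PE => /setD1P [].
  have XY : Y != X by have := set11 Y; rewrite -PE => /setD1P [].
  have PXY : P = [set X; Y] by rewrite -PE setD1K.
  have XY' : X \notin [set Y] by rewrite inE eq_sym.
  have sum4 : (#|X| + #|Y| = 4)%N.
    by rewrite -v4 /valence (card_partition pP) PXY big_setU1 //= big_set1.
  have bX := big X XP; have bY := big Y YP.
  have /cards1P [k XE] : #|X :\ h| == 1%N.
    move: bX bY sum4; rewrite (cardsD1 h X) hX.
    move: #|X :\ h| #|Y| => n1 n2 b1 b2 b3; apply/eqP; rewrite /= in b1 b3; lia.
  have XE2 : X = [set h; k] by rewrite -XE setD1K.
  have dXY : [disjoint X & Y].
    by case/and3P: pP => _ /trivIsetP tP _; apply: tP => //; rewrite eq_sym.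
  have YE : Y = halves v :\: X.
    rewrite -(cover_partition pP) PXY /cover big_setU1 //= big_set1.
    rewrite setDUl setDv set0U; apply/esym/setDidPl.
    by rewrite disjoint_sym.
  exists k; last by rewrite PXY YE XE2.
  rewrite in_setD1; have := set11 k; rewrite -XE => /setD1P [-> kX].
  by rewrite -(cover_partition pP); apply/bigcupP; exists X.
have /setD1P [kh kv'] := kv; have c2 : #|[set h; k]| = 2 by rewrite cards2 eq_sym kh.
have sub : [set h; k] \subset halves v by apply/subsetP => x; rewrite !inE => /orP [] /eqP ->;
  [rewrite inE in hv | rewrite inE in kv'].
have cY : #|halves v :\: [set h; k]| = 2.
  by rewrite cardsD (setIidPr sub) c2 -/(valence v) v4.
have ne : [set h; k] != halves v :\: [set h; k].
  by apply/eqP => /setP /(_ h); rewrite !inE eqxx.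
apply/and3P; split.
- apply/and3P; split.
  + by rewrite /cover big_setU1 ?inE //= big_set1 -{1}(setIidPr sub) setID eqxx.
  + apply/trivIsetP => X Y; rewrite !inE => /orP [] /eqP -> /orP [] /eqP ->; rewrite ?eqxx // => _.
      by rewrite disjoints_subset; apply/subsetP => x; rewrite !inE => ->.
    by rewrite disjoint_sym disjoints_subset; apply/subsetP => x; rewrite !inE => ->.
  + by apply/negP; rewrite in_set2 => /orP [] /eqP E0; [have := c2 | have := cY]; rewrite -E0 cards0.
- by rewrite cards2 ne.
- by apply/forall_inP => X; rewrite !inE => /orP [] /eqP ->; rewrite ?c2 ?cY.
Qed.

Lemma pair_splitting_inj (h : half_edge G) : h \in halves v ->
  {in halves v :\ h &, injective (pair_splitting h)}.
Proof.
move=> hv k k' /setD1P [kh kv] /setD1P [kh' kv'] /setP /(_ [set h; k]).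
rewrite !inE eqxx /= => /esym /orP [] /eqP /setP.
  by move=> /(_ k); rewrite !inE eqxx orbT (negbTE kh) => /esym /eqP.
by move=> /(_ h); rewrite !inE eqxx.
Qed.

Lemma new_block_pair (h k : half_edge G) :
  new_block (pair_splitting h k) = [set h; k] \/
  new_block (pair_splitting h k) = halves v :\: [set h; k].
Proof.
rewrite /new_block; case: pickP => [X|/(_ [set h; k])]; last by rewrite !inE eqxx.
by rewrite !inE => /orP [] /eqP ->; [left | right].
Qed.

Definition vertex_splits : chain :=
  \sum_(P : {set {set half_edge G}} | splitting v P) << split_vertex v (new_block P) >>.

Lemma vertex_splits0 : (valence v < 4)%N -> vertex_splits = 0.
Proof.
move=> v4; rewrite /vertex_splits big_pred0 // => P; apply/negP => /splitting_valence; lia.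
Qed.

Lemma vertex_splits4 (h k1 k2 k3 : half_edge G) : valence v = 4%N ->
  uniq [:: h; k1; k2; k3] -> {subset [:: h; k1; k2; k3] <= halves v} ->
  vertex_splits = << split_vertex v (new_block (pair_splitting h k1)) >> +
    << split_vertex v (new_block (pair_splitting h k2)) >> +
    << split_vertex v (new_block (pair_splitting h k3)) >>.
Proof.
move=> v4 u sub; have hv : h \in halves v by apply: sub; rewrite mem_head.
have uk : uniq [:: k1; k2; k3] by case/andP: u.
have kE : halves v :\ h =i [:: k1; k2; k3].
  have kv k : k \in [:: k1; k2; k3] -> k \in halves v :\ h.
    move=> kk; rewrite in_setD1 sub ?andbT; last by rewrite inE kk orbT.
    by case/andP: u => hk _; apply: contra hk => /eqP <-.
  have sE : [set k in [:: k1; k2; k3]] = halves v :\ h.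
    apply/eqP; rewrite eqEcard; apply/andP; split.
      by apply/subsetP => k; rewrite inE => /kv.
    have -> : #|[set k in [:: k1; k2; k3]]| = 3 by rewrite cardsE; exact: (card_uniqP uk).
    by have := cardsD1 h (halves v); rewrite hv -/(valence v) v4 add1n => -[<-].
  by move=> k; rewrite -sE inE.
have inj := pair_splitting_inj hv.
have us : uniq (map (pair_splitting h) [:: k1; k2; k3]).
  by rewrite map_inj_in_uniq // => x y; rewrite -!kE; exact: inj.
rewrite /vertex_splits (eq_bigl [in map (pair_splitting h) [:: k1; k2; k3]]) => [|P].
  by rewrite -big_uniq //= !big_cons big_nil addr0 addrA.
apply/(splittingP _ v4 hv)/mapP => -[k]; first by rewrite kE; exists k.
by rewrite -kE; exists k.
Qed.

End FourValentSplittings.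

Lemma split_sum_vertices (G : ograph) (vs : seq (vert G)) : uniq vs -> all (@internal G) vs ->
  (forall v, v \notin vs -> (valence v < 4)%N) ->
  split_sum G = \sum_(v <- vs) vertex_splits v.
Proof.
move=> uvs ivs small; rewrite /split_sum big_uniq //= [LHS]big_mkcond [RHS]big_mkcond /=.
apply: eq_bigr => v _; case: ifP => [vi|/negbT vi].
  by case: ifP => // /negbT /small /vertex_splits0.
case: ifP => // /(allP ivs); by rewrite (negbTE vi).
Qed.

(** * Representatives of the types *)

Section Existence.

Definition realizable (t : nat * nat * seq nat) : Prop :=
  exists G (l : label (vert G) (edge G)), labelled l /\ label_type l = t.

Definition theta_graph : ograph :=
  @OGraph 2 3 [ffun=> (ord0, ord_max)] (enum {: 'I_2 + 'I_3}).

Lemma realizable_theta : realizable (0, 0, [:: 0; 0; 0])%N.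
Proof.
pose s (i : nat) : strand 'I_2 'I_3 := ([::], [:: inord i]).
pose l : label 'I_2 'I_3 := Label ord0 ord_max [::] [::] [:: s 0; s 1; s 2].
exists theta_graph, l; split=> //.
have v2 : label_verts l = enum 'I_2.
  by apply: (inj_map val_inj); rewrite val_enum_ord.
have e3 : unzip1 (label_arcs l) = enum 'I_3.
  by apply: (inj_map val_inj); rewrite val_enum_ord /= !inordK.
apply/and5P; split.
- exact: perm_refl.
- by rewrite v2 perm_refl.
- by rewrite e3 perm_refl.
- by [].
- by rewrite /label_arcs /= /arc_matches /= !ffunE !eqxx.
Qed.

(** [split_vertex] with an empty block is not a term of the differential, but it attaches a new edge
    with a univalent end to [A], that is, a hair. The analysis of split graphs is reused in this way
    to build examples. *)
Lemma realizable_hair (b : nat) (ns : seq nat) : realizable (0, b, ns)%N -> realizable (1, b, ns)%N.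
Proof.
case=> G [[A B hA hB ps] [hl]] /= [sA sB sp].
case: hA sA hl => // _ hl.
pose S : {set half_edge G} := set0; pose G' := split_vertex A S.
have SA h : h \in S -> at_vertex h = A by rewrite inE.
pose lv := lift (@ord0 (nv G)); pose le := lift (@ord0 (ne G)).
pose l' : label (vert G') (edge G') := Label (lv A) (lv B) [:: (ord0, ord0)]
  [seq (lv q.1, le q.2) | q <- hB] (map (map_strand lv le) ps).
have sE e : split_source (Label A B [::] hB ps) S e = lv A by rewrite /split_source inE.
have wl' : well_shaped l'.
  case/and5P: hl => _ _ _ /and4P [_ /= hb s3 sz] _; apply/and4P; split=> //=.
  - by rewrite size_map.
  - by rewrite size_map.
  - by rewrite all_map; apply: sub_all sz => p /=; rewrite !size_map.
exists G', l'; split; last by rewrite /label_type /= size_map sB -sp -map_comp; congr (_, _, _); apply: eq_map => p /=; rewrite size_map.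
have [] // := labelled_split (b := false) (l' := l') SA hl.
  rewrite -(label_verts_map lv le) /label_verts /= (perm_catCA [:: lv A] [:: ord0]) /=.
  by rewrite !perm_cons perm_refl.
rewrite perm_cons /label_arcs !map_cat /=.
rewrite (split_target_hairs hl SA) (split_strands hl SA (x := lv A)) ?perm_refl //.
case=> bs [|e es] ps' /=; last exact: sE.
by case/and5P: hl => _ _ _ /and4P [_ _ _ /allP /(_ _ ps')].
Qed.

Lemma strand_sizes3 (V E : Type) (ps : seq (strand V E)) a b c :
  [seq size p.1 | p <- ps] = [:: a; b; c] -> exists p q r, ps = [:: p; q; r].
Proof. by case: ps => [|p [|q [|r []]]] // _; exists p, q, r. Qed.

Lemma realizable_permute (x y : nat) (ns ns' : seq nat) a b c : ns = [:: a; b; c] ->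
  ns' \in [:: [:: b; a; c]; [:: a; c; b]] -> realizable (x, y, ns) -> realizable (x, y, ns').
Proof.
move=> -> H [G [l [hl]]] [tx ty tn]; have [p [q [r lE]]] := strand_sizes3 tn.
move: H; rewrite lE in tn; case: tn => <- <- <-; rewrite !inE => /orP [] /eqP ->.
  have pE : perm_eq (strands l) [:: q; p; r] by rewrite lE -(cat1s p) -(cat1s q) perm_catCA.
  have [hl' _] := labelled_permute hl pE.
  by exists G, (permute_label l [:: q; p; r]); split=> //; rewrite /label_type /= tx ty.
have pE : perm_eq (strands l) [:: p; r; q] by rewrite lE perm_cons (perm_catC [:: q] [:: r]).
have [hl' _] := labelled_permute hl pE.
by exists G, (permute_label l [:: p; r; q]); split=> //; rewrite /label_type /= tx ty.
Qed.

Lemma half_atP (G : ograph) (v : vert G) (e : edge G) : incident v e -> at_vertex (half_at v e) = v.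
Proof.
by rewrite /incident /at_vertex /half_at /=; case: (_ =P v) => //= _ /eqP.
Qed.

Section SourceHalves.

Variables (G : ograph) (A B u : vert G) (h : edge G) (hB : seq (vert G * edge G)).
Variables (p q r : strand (vert G) (edge G)).

Local Notation l := (Label A B [:: (u, h)] hB [:: p; q; r]).
Hypothesis hl : labelled l.

Local Notation first_edge p := (head h p.2).

Lemma source_halves_sub :
  {subset map (half_at A) [:: h; first_edge p; first_edge q; first_edge r] <= halves A}.
Proof.
have inc s : s \in [:: p; q; r] -> incident A (first_edge s).
  move=> sl; have : s \in strands l by [].
  have /and4P [_ _ _ /allP sz] := labelled_shape hl.
  case: s sl (sz s sl) => bs [|e es] // sl _ sl' /=.
  have Ha : (e, (A, head B (unzip1 bs))) \in frame_arcs l ++ spur_arcs l.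
    rewrite -(perm_mem (perm_label_arcs l)).
    by apply: (mem_strand_arcs sl'); rewrite strand_arcs_first mem_head.
  by rewrite -[e]/((e, (A, head B (unzip1 bs))).1) (incident_arc hl _ Ha) /= eqxx.
have inch : incident A h.
  have Ha : (h, (A, u)) \in frame_arcs l ++ spur_arcs l.
    by rewrite -(perm_mem (perm_label_arcs l)) mem_head.
  by rewrite -[h]/((h, (A, u)).1) (incident_arc hl _ Ha) /= eqxx.
move=> x /mapP [e ein ->]; rewrite inE half_atP //.
move: ein; rewrite !inE => /or4P [] /eqP -> //; apply: inc; by rewrite !inE eqxx ?orbT.
Qed.

Lemma source_valence : valence A = 4%N.
Proof.
rewrite (valenceE hl) /=; have := vertex_count hl A; rewrite /= eqxx.
by case: (B == A) => /=; rewrite ?muln0; lia.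
Qed.

End SourceHalves.

(** The split of [split_hair_first] pushes the hair at the source onto the first strand. *)
Lemma realizable_split (b x y z : nat) :
  realizable (1, b, [:: x; y; z])%N -> realizable (0, b, [:: x.+1; y; z])%N.
Proof.
case=> G [[A B hA hB ps] [hl]] /= [sA sB sp]; have [p [q [r psE]]] := strand_sizes3 sp.
case: hA sA hl => [|[u h] []] // _ hl; rewrite psE in hl sp.
case: p hl sp {psE} => bs [|e es] hl sp.
  by case/and5P: hl => _ _ _ /and4P [_ _ _ /andP []].
have sub := source_halves_sub hl.
have [||l' [hl' tl' _]] := @split_hair_first G A B u h hB bs e es q r hl
  [set half_at A h; half_at A e] false; first by [].
  move=> k; rewrite !inE => kk; have : k \in halves A; last by rewrite inE => /eqP.
  by apply: sub; rewrite !inE !orbA kk.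
case: sp => <- <- <-; rewrite -sB -tl'.
by exists (split_vertex A [set half_at A h; half_at A e]), l'.
Qed.

Lemma realizable_rev (a b : nat) (ns : seq nat) : realizable (a, b, ns) -> realizable (b, a, ns).
Proof.
case=> G [l [hl [ta tb tn]]]; have [hl' _] := labelled_rev hl.
exists G, (rev_label l); split=> //; rewrite /label_type /= ta tb -tn -map_comp.
by congr (_, _, _); apply: eq_map => p /=; rewrite size_rev.
Qed.

(** A strand of the bare theta graph is lengthened by growing a hair at the source and pushing it
    onto the strand; the hairs that stay at the ends are added last. *)
Lemma realizable_all (a b : bool) (x y z : nat) : realizable (a : nat, b : nat, [:: x; y; z]).
Proof.
have R : forall x y z, realizable (0, 0, [:: x; y; z])%N.
  have step x' y' z' : realizable (0, 0, [:: x'; y'; z'])%N -> realizable (0, 0, [:: x'.+1; y'; z'])%N.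
    by move/realizable_hair/realizable_split.
  have Rz z' : realizable (0, 0, [:: z'; 0; 0])%N.
    by elim: z' => [|z' /step //]; exact: realizable_theta.
  have Ry y' z' : realizable (0, 0, [:: y'; z'; 0])%N.
    elim: y' => [|y' /step //].
    by apply: realizable_permute (Rz z') => //; rewrite mem_head.
  move=> x' y' z'; elim: x' => [|x' /step //].
  have R1 : realizable (0, 0, [:: y'; 0; z'])%N.
    by apply: realizable_permute (Ry y' z') => //; rewrite !inE eqxx orbT.
  by apply: realizable_permute R1 => //; rewrite mem_head.
have R1 x' y' z' : realizable (1, 0, [:: x'; y'; z'])%N by exact: realizable_hair.
case: a; case: b => //; last by apply: realizable_rev.
exact/realizable_hair/realizable_rev.
Qed.

End Existence.

(** * Signed representatives of the types *)

Section Representatives.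

Variables m N : nat.
Hypotheses (hm : odd m) (hN : odd N).

Local Notation "x ~~~ y" := (eqv m N x y) (at level 70).

Definition represents (t : nat * nat * seq nat) (x : chain) : Prop :=
  exists G (l : label (vert G) (edge G)),
    [/\ labelled l, label_type l = t & x = label_sign l *: << G >>].

(** An arbitrary choice, immaterial modulo [null] by [same_type_eqv]. The sign of the label is
    included, so that the class does not depend on the orientation of the chosen graph. *)
Definition rep (t : nat * nat * seq nat) : chain := epsilon (inhabits 0) (represents t).

Lemma repP t : realizable t -> represents t (rep t).
Proof.
case=> G [l [hl tl]]; apply: epsilon_spec.
by exists (label_sign l *: << G >>), G, l.
Qed.

Lemma rep_eqv (G : ograph) (l : label (vert G) (edge G)) : labelled l ->
  (0 < type_hodge (label_type l))%N -> label_sign l *: << G >> ~~~ rep (label_type l).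
Proof.
move=> hl hk; have [|H [l' [hl' tl ->]]] := @repP (label_type l); first by exists G, l.
exact: (same_type_eqv hm hN hk hl hl' (esym tl)).
Qed.

Lemma graph_eqv_rep (G : ograph) (l : label (vert G) (edge G)) : labelled l ->
  (0 < type_hodge (label_type l))%N -> << G >> ~~~ label_sign l *: rep (label_type l).
Proof.
move=> hl hk; have := eqvZ (label_sign l) (rep_eqv hl hk).
by rewrite scalerA sgn_sq scale1r.
Qed.

Lemma rep_swap12 (a b : bool) (x y z : nat) : (0 < a + b + x + y + z)%N ->
  rep (a : nat, b : nat, [:: x; y; z]) ~~~ rep (a : nat, b : nat, [:: y; x; z]).
Proof.
move=> hk; have [G [l [hl tl ->]]] := repP (realizable_all a b x y z).
case: (tl) => ta tb tn; have [p [q [r lE]]] := strand_sizes3 tn.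
rewrite lE in tn; case: tn => px qy rz.
have pE : perm_eq (strands l) [:: q; p; r] by rewrite lE -(cat1s p) -(cat1s q) perm_catCA.
have [hl' so] := labelled_permute hl pE; rewrite /label_sign -so.
have tl' : label_type (permute_label l [:: q; p; r]) = (a : nat, b : nat, [:: y; x; z]).
  by rewrite /label_type /= ta tb px qy rz.
by rewrite -tl'; apply: rep_eqv => //; rewrite tl' /type_hodge /=; lia.
Qed.

Lemma rep_swap23 (a b : bool) (x y z : nat) : (0 < a + b + x + y + z)%N ->
  rep (a : nat, b : nat, [:: x; y; z]) ~~~ rep (a : nat, b : nat, [:: x; z; y]).
Proof.
move=> hk; have [G [l [hl tl ->]]] := repP (realizable_all a b x y z).
case: (tl) => ta tb tn; have [p [q [r lE]]] := strand_sizes3 tn.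
rewrite lE in tn; case: tn => px qy rz.
have pE : perm_eq (strands l) [:: p; r; q] by rewrite lE perm_cons (perm_catC [:: q] [:: r]).
have [hl' so] := labelled_permute hl pE; rewrite /label_sign -so.
have tl' : label_type (permute_label l [:: p; r; q]) = (a : nat, b : nat, [:: x; z; y]).
  by rewrite /label_type /= ta tb px qy rz.
by rewrite -tl'; apply: rep_eqv => //; rewrite tl' /type_hodge /=; lia.
Qed.

Lemma label_type_rev (V E : Type) (l : label V E) :
  label_type (rev_label l) = ((label_type l).1.2, (label_type l).1.1, (label_type l).2).
Proof. by rewrite /label_type /= -map_comp; congr (_, _, _); apply: eq_map => p /=; rewrite size_rev. Qed.

Lemma rep_rev (a b : bool) (x y z : nat) : (0 < a + b + x + y + z)%N ->
  rep (a : nat, b : nat, [:: x; y; z]) ~~~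
  sgn ((~~ a && ~~ b) (+) ~~ odd (x + y + z)) *: rep (b : nat, a : nat, [:: x; y; z]).
Proof.
move=> hk; have [G [l [hl tl ->]]] := repP (realizable_all a b x y z).
have [hl' so] := labelled_rev hl; have tl' := label_type_rev l; rewrite tl /= in tl'.
case: (tl) => ta tb tn; rewrite tl ta tb !oddb /= addn0 addnA in so.
have <- : sgn ((~~ a && ~~ b) (+) ~~ odd (x + y + z)) * label_sign (rev_label l) = label_sign l.
  by rewrite /label_sign so -sgnD; case: (label_odd l); case: (_ && _); case: (~~ odd _).
rewrite -scalerA -tl'; apply/eqvZ/rep_eqv => //.
by rewrite tl' /type_hodge /=; lia.
Qed.

(** The three splittings of the four-valent source pair its hair with the initial edge of one strand
    each. [split_hair_first] gives all three the same sign: this is the multiplication by X + Y +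
    Z. *)
Lemma source_splits (G : ograph) (l : label (vert G) (edge G)) b x y z : labelled l ->
  label_type l = (1, b, [:: x; y; z])%N ->
  vertex_splits (source l) ~~~ - (label_sign l *:
    (rep (0, b, [:: x.+1; y; z]) + rep (0, b, [:: x; y.+1; z]) + rep (0, b, [:: x; y; z.+1])))%N.
Proof.
case: l => A B hA hB ps hl [sA sB sp]; have [p [q [r psE]]] := strand_sizes3 sp.
case: hA sA hl => [|[u h] []] // _ hl; rewrite psE in hl sp *.
have sub := source_halves_sub hl; have v4 := source_valence hl.
have ue : uniq (map (half_at A) [:: h; head h p.2; head h q.2; head h r.2]).
  rewrite (map_inj_uniq (@half_at_edge_inj G A)).
  case: p hl {sp psE sub} => bs [|e es] hl; last exact: first_edges_uniq hl.
  by case/and5P: hl => _ _ _ /and4P [_ _ _ /andP []].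
rewrite (vertex_splits4 v4 ue sub) /=.
pose F (s : strand (vert G) (edge G)) := half_at A (head h s.2).
pose l := Label A B [:: (u, h)] hB [:: p; q; r].
(* Stated for any listing of the strands, so that the strand receiving the hair may be put first. *)
have one s1 s2 s3 : perm_eq [:: p; q; r] [:: s1; s2; s3] ->
    << split_vertex A (new_block (pair_splitting A (half_at A h) (F s1))) >> ~~~
    - label_sign l *: rep (0, size hB, [:: (size s1.1).+1; size s2.1; size s3.1])%N.
  move=> pm; have [hl1 so] := labelled_permute hl pm.
  have sub1 := source_halves_sub hl1.
  case: s1 pm hl1 so sub1 => bs [|e es] pm hl1 so sub1.
    by case/and5P: hl1 => _ _ _ /and4P [_ _ _ /andP []].
  set S := new_block _; pose hs := half_at A.
  have ue1 := first_edges_uniq hl1.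
  have hE : halves A = [set hs h; hs e; hs (head h s2.2); hs (head h s3.2)].
    apply/esym/eqP; rewrite eqEcard -/(valence A) v4; apply/andP; split.
      by apply/subsetP => k kk; apply: sub1; move: kk; rewrite !inE -!orbA.
    rewrite -!setUA cardsU1 cardsU1 cardsU1 cards1 !inE.
    move: ue1; rewrite -(map_inj_uniq (@half_at_edge_inj G A)) /= !inE !negb_or.
    by case/and4P=> /and3P [/negbTE -> /negbTE -> /negbTE ->] /andP [/negbTE -> /negbTE ->] /negbTE ->.
  (* [new_block] picks one of the two blocks in an unspecified way; [b0] records which. *)
  have [b0 SE] : exists b0 : bool, S = if b0 then [set hs (head h s2.2); hs (head h s3.2)]
      else [set hs h; hs e].
    have [SE|SE] := new_block_pair A (hs h) (hs e); [by exists false | exists true].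
    rewrite /S [LHS]SE hE; apply/setP => k; rewrite !inE.
    move: ue1; rewrite -(map_inj_uniq (@half_at_edge_inj G A)) /= !inE !negb_or.
    case/and4P=> /and3P [_ h2 h3] /andP [e2 e3] _.
    have [->|_] := eqVneq k (hs h); first by rewrite (negbTE h2) (negbTE h3).
    by have [->|_] := eqVneq k (hs e); first by rewrite (negbTE e2) (negbTE e3).
  have SA k : k \in S -> at_vertex k = A.
    move=> kS; have : k \in halves A; last by rewrite inE => /eqP.
    by rewrite hE; move: kS; rewrite SE; case: (b0); rewrite !inE => /orP [] ->; rewrite ?orbT.
  have [l' [hl' tl' so']] := @split_hair_first G A B u h hB bs e es s2 s3 hl1 S b0 SE SA.
  have := graph_eqv_rep hl'; rewrite tl' /label_sign so'.
  have -> : label_odd (Label A B [:: (u, h)] hB [:: (bs, e :: es); s2; s3]) = label_odd l by exact: so.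
  by rewrite sgnN; apply; rewrite /type_hodge /= addSn addnS.
have e1 := one p q r (perm_refl _).
have e2 : << split_vertex A (new_block (pair_splitting A (half_at A h) (F q))) >> ~~~
    - label_sign l *: rep (0, size hB, [:: (size q.1).+1; size p.1; size r.1])%N.
  by apply: one; rewrite -(cat1s p) -(cat1s q) perm_catCA.
have e3 : << split_vertex A (new_block (pair_splitting A (half_at A h) (F r))) >> ~~~
    - label_sign l *: rep (0, size hB, [:: (size r.1).+1; size p.1; size q.1])%N.
  by apply: one; rewrite (perm_catC [:: p; q] [:: r]).
case: sp => <- <- <-; rewrite -sB -scaleNr !scalerDr.
have hb : size hB = (size hB == 1%N) :> nat.
  by case/and5P: hl => _ _ _ /and4P [_ /= hb _ _] _; case: (size hB) hb => [|[]].
rewrite hb in e1 e2 e3 *.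
apply: eqvD; first apply: eqvD => //.
  apply: eqv_trans e2 _; apply: eqvZ; apply: (@rep_swap12 false); lia.
apply: eqv_trans e3 _; apply: eqvZ.
apply: eqv_trans (@rep_swap12 false _ _ _ _ _) _; first lia.
apply: (@rep_swap23 false); lia.
Qed.

End Representatives.

(** * Uniqueness of labels *)

Section FrameDegree.

Variable G : ograph.

Definition frame_halves (v : vert G) : {set half_edge G} :=
  [set h in halves v | ~~ tree_type h.1].

(** Valence within the frame, defined without a label. It will be 3 at the two ends, 2 at the beads
    and 0 at the tips, which lets a label be recovered from its graph. *)
Definition frame_degree (v : vert G) : nat := #|frame_halves v|.

Lemma half_at_inj (v : vert G) : injective (half_at v).
Proof. by move=> x y [->]. Qed.

Lemma half_at_frame (v : vert G) e : incident v e -> ~~ tree_type e ->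
  half_at v e \in frame_halves v.
Proof. by move=> ve te; rewrite !inE half_atP // eqxx. Qed.

Lemma frame_degree2 (v : vert G) e e1 e2 : frame_degree v = 2 ->
  incident v e -> incident v e1 -> incident v e2 ->
  ~~ tree_type e -> ~~ tree_type e1 -> ~~ tree_type e2 -> e != e1 -> e != e2 -> e1 = e2.
Proof.
move=> d2 ie i1 i2 te t1 t2 n1 n2; apply/eqP; apply: contraT => n12.
have sub : {subset map (half_at v) [:: e; e1; e2] <= frame_halves v}.
  by move=> h /mapP [f]; rewrite !inE => /or3P [] /eqP -> ->; rewrite half_atP ?eqxx.
have u : uniq (map (half_at v) [:: e; e1; e2]).
  by rewrite (map_inj_uniq (@half_at_inj v)) /= !inE negb_or n1 n2 n12.
have : (size (map (half_at v) [:: e; e1; e2]) <= size (enum (frame_halves v)))%N.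
  by apply: uniq_leq_size u _ => h /sub hh; rewrite mem_enum.
by rewrite -cardE -/(frame_degree v) d2.
Qed.

Variable l : label (vert G) (edge G).
Hypothesis hl : labelled l.

Let A := source l.
Let B := target l.

Lemma frame_degreeE v : frame_degree v =
  (3 * (A == v) + 3 * (B == v) + (count_mem v (beads l)).*2)%N.
Proof.
rewrite -(count_frame_arcs v (labelled_shape hl)) /frame_degree -sum1_card.
transitivity (\sum_(e : edge G | ~~ tree_type e) (((ends G e).1 == v) + ((ends G e).2 == v)))%N.
  rewrite big_mkcond [RHS]big_mkcond /=.
  rewrite (eq_bigr (fun h : edge G * bool => nat_of_bool ((at_vertex (h.1, h.2) == v) && ~~ tree_type h.1))).
    rewrite -(pair_big xpredT xpredT (fun e b => nat_of_bool ((at_vertex (e, b) == v) && ~~ tree_type e))) /=.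
    apply: eq_bigr => e _; rewrite big_bool /= addnC.
    by case: (tree_type e); rewrite ?andbF ?andbT.
  by case=> e b _; rewrite !inE; case: (_ && _).
have fe := frame_arcs_edges (labelled_shape hl).
have ue : uniq (frame_edges l).
  by have := uniq_edges hl; rewrite /unzip1 map_cat cat_uniq => /andP [+ _]; rewrite -fe.
rewrite (eq_bigl [in frame_edges l]) => [|e]; last by rewrite (tree_type_label hl) negbK.
rewrite -big_uniq // -fe big_map big_seq [RHS]big_seq; apply: eq_bigr => a Ha.
have := arc_endsP hl (a := a); rewrite mem_cat Ha => /(_ isT) [] -> //=; exact: addnC.
Qed.

Lemma frame_degree3 v : (frame_degree v == 3) = (v == A) || (v == B).
Proof.
rewrite frame_degreeE !(eq_sym v); have := vertex_count hl v; rewrite -/A -/B.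
by case: (A == v); case: (B == v) => /=; rewrite ?muln0 ?muln1; lia.
Qed.

Lemma frame_degree_bead v : v \in beads l -> frame_degree v = 2.
Proof.
rewrite -has_pred1 has_count frame_degreeE; have := vertex_count hl v; rewrite -/A -/B.
by case: (A == v); case: (B == v) => /=; rewrite ?muln0 ?muln1; lia.
Qed.

Lemma source_target_neq : A != B.
Proof.
by have := uniq_core_tips hl; rewrite /= inE negb_or => /andP [/andP []].
Qed.

(** The right-hand side does not mention [l], so any two labels of a graph have the same hairs. The
    direction of the arc is fixed by its external end. *)
Lemma spur_arcs_intrinsic a : (a \in spur_arcs l) =
  [&& @tree_type G a.1, arc_matches a & external a.2.2].
Proof.
apply/idP/and3P => [Ha|[ta am xa]].
  rewrite (tree_type_label hl) (frame_edge_not_spur hl Ha) (external_tip hl).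
  have [_ ->] := spur_arc_ends Ha; split=> //; apply: (label_arc_matches hl).
  by rewrite (perm_mem (perm_label_arcs l)) mem_cat Ha orbT.
have [b] := edge_arc hl a.1; rewrite mem_cat => /orP [Hb|Hb] ab.
  rewrite (tree_type_label hl) in ta; case/negP: ta.
  by apply/(frame_edgeP hl); exists b.
suff -> : a = b by [].
have [rc tb] := spur_arc_ends Hb; rewrite -(internal_core hl) in rc; rewrite -(external_tip hl) in tb.
have bm : arc_matches b.
  by apply: (label_arc_matches hl); rewrite (perm_mem (perm_label_arcs l)) mem_cat Hb orbT.
have xi (v : vert G) : external v -> internal v -> False by rewrite /external /internal => /eqP ->.
case: a b ab am bm xa rc tb {ta Hb} => [e [x y]] [f [z t]] /= ->; rewrite /arc_matches /=.
case/orP=> /eqP ->; case/orP=> /eqP [-> ->] // xa rc tb; case: (xi _ xa rc).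
Qed.

Lemma strand_first p : p \in strands l -> exists e es, p = (p.1, e :: es).
Proof.
move=> ps; have /and4P [_ _ _ /allP /(_ p ps)] := labelled_shape hl.
by case: p {ps} => bs [|e es] // _; exists e, es.
Qed.

Lemma frame_arc_at_source a : a \in frame_arcs l -> (a.2.1 == A) || (a.2.2 == A) ->
  exists bs es, (bs, a.1 :: es) \in strands l.
Proof.
case/flattenP => _ /mapP [p ps ->]; have [e [es pE]] := strand_first ps; rewrite pE in ps *.
rewrite -/A -/B; case: (p.1) ps => [|b bs] ps; rewrite /strand_frame_arcs /= inE.
  case/orP=> [/eqP -> _|]; first by exists [::], es.
  by case: es {pE} ps.
case/orP=> [/eqP -> _|/mem_zip /andP [_ /mem_zip /andP [a1 a2]]]; first by exists (b :: bs), es.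
have bsub x : x \in unzip1 (b :: bs) -> x \in beads l.
  by move=> xb; apply/flattenP; exists (unzip1 (b :: bs)) => //; exact: (map_f (fun p => unzip1 p.1) ps).
have notA x : x \in unzip1 (b :: bs) -> x != A.
  by move=> /bsub xb; apply: (source_not_other hl); rewrite inE mem_cat xb orbT.
case/orP=> xA; first by move: (notA _ a1); rewrite xA.
have : a.2.2 != A.
  move: a2; rewrite mem_rcons inE => /orP [/eqP ->|a2]; first by rewrite eq_sym source_target_neq.
  by apply: notA; rewrite /= inE a2 orbT.
by rewrite xA.
Qed.

Lemma uniq_strands : uniq (strands l).
Proof.
have ue : uniq (frame_edges l).
  have := uniq_edges hl; rewrite /unzip1 map_cat cat_uniq => /andP [+ _].
  by rewrite -(frame_arcs_edges (labelled_shape hl)).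
have /and4P [_ _ _] := labelled_shape hl; move: ue; rewrite /frame_edges.
elim: (strands l) => //= p ps IH; rewrite cat_uniq => /and3P [_ /hasPn disj ue] /andP [szp /(IH ue) ->].
rewrite andbT; apply/negP => pps; case: p szp pps disj => bs [|e es] // _ pps disj.
have ein : e \in flatten (map snd ps).
  by apply/flattenP; exists (e :: es); rewrite ?mem_head //; exact: (map_f snd pps).
by have := disj e ein; rewrite /= mem_head.
Qed.

End FrameDegree.

Lemma strand_frame_arcs_cons (V E : Type) (x y : V) b bs (e : E) es :
  strand_frame_arcs x y (b :: bs, e :: es) = (e, (x, b.1)) :: strand_frame_arcs b.1 y (bs, es).
Proof. by []. Qed.

Section LabelUniqueness.

Variable G : ograph.
Variables l l' : label (vert G) (edge G).
Hypotheses (hl : labelled l) (hl' : labelled l').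

Lemma spur_arcs_eq : spur_arcs l =i spur_arcs l'.
Proof. by move=> a; rewrite (spur_arcs_intrinsic hl) (spur_arcs_intrinsic hl'). Qed.

Lemma other_end_eq (x y z : vert G) (e : edge G) :
  arc_matches (e, (x, y)) -> arc_matches (e, (x, z)) -> y = z.
Proof. by rewrite /arc_matches /= => /orP [] /eqP -> /orP [] /eqP [] => [->|-> ->|-> ->|->]. Qed.

(** A strand is determined by its first vertex and edge: at a vertex of frame degree 2 the next edge
    is forced, as is the hair, and the strand stops when it reaches frame degree 3. *)
Lemma strand_determined (B x : vert G) (bs bs' : seq (vert G * (vert G * edge G)))
    (e : edge G) (es es' : seq (edge G)) :
  size es = size bs -> size es' = size bs' -> uniq (e :: es) -> uniq (e :: es') ->
  frame_degree B = 3 ->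
  {in bs, forall b, frame_degree b.1 = 2} -> {in bs', forall b, frame_degree b.1 = 2} ->
  all [pred a | arc_matches a && ~~ @tree_type G a.1] (strand_frame_arcs x B (bs, e :: es)) ->
  all [pred a | arc_matches a && ~~ @tree_type G a.1] (strand_frame_arcs x B (bs', e :: es')) ->
  {subset bead_arcs (bs, e :: es) <= spur_arcs l} ->
  {subset bead_arcs (bs', e :: es') <= spur_arcs l} -> (bs, es) = (bs', es').
Proof.
elim: bs bs' x e es es' => [|b bs IH] [|b' bs'] x e es es'.
- by case: es es' => [|? ?] [|? ?].
- rewrite /strand_frame_arcs /= => _ _ _ _ dB _ d' /andP [/andP [m _] _] /andP [/andP [m' _] _] _ _.
  by have := d' b' (mem_head _ _); rewrite -(other_end_eq m m') dB.
- rewrite /strand_frame_arcs /= => _ _ _ _ dB d _ /andP [/andP [m _] _] /andP [/andP [m' _] _] _ _.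
  by have := d b (mem_head _ _); rewrite (other_end_eq m m') dB.
case: es es' => [|e1 es] [|e1' es'] // [sz] [sz'] u u' dB d d'.
rewrite !strand_frame_arcs_cons.
move=> /andP [/andP [m t] H] /andP [/andP [m' t'] H'] S S'.
have bb : b.1 = b'.1 := other_end_eq m m'.
have ab : (b.2.2, (b.1, b.2.1)) \in spur_arcs l by apply: S; exact: mem_head.
have ab' : (b'.2.2, (b'.1, b'.2.1)) \in spur_arcs l by apply: S'; exact: mem_head.
have bE : b = b'.
  have [E1 E2 E3] := uniq_map_inj_in (uniq_roots hl) ab ab' bb.
  by rewrite [b]surjective_pairing [b.2]surjective_pairing E1 E2 E3 -!surjective_pairing.
have inc (z t1 t2 : vert G) (f : edge G) : arc_matches (f, (t1, t2)) -> z \in [:: t1; t2] -> incident z f.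
  by rewrite /arc_matches /incident !inE /= => /orP [] /eqP -> /= /orP [] /eqP ->; rewrite eqxx ?orbT.
have first z zs f fs : all [pred a | arc_matches a && ~~ @tree_type G a.1]
    (strand_frame_arcs z B (zs, f :: fs)) -> incident z f && ~~ tree_type f.
  case: zs => [|y zs] /= /andP [/andP [mm tt] _]; rewrite tt andbT;
    by apply: inc mm _; rewrite inE eqxx.
have /andP [i1 t1] := first _ _ _ _ H; have /andP [i1' t1'] := first _ _ _ _ H'.
have ie : incident b.1 e by apply: inc m _; rewrite !inE eqxx orbT.
have eE : e1 = e1'.
  apply: (@frame_degree2 G b.1 e) => //; rewrite ?bE //.
  - by rewrite -bE; apply: d; exact: mem_head.
  - by move: u; rewrite /= inE negb_or => /andP [/andP []].
  - by move: u'; rewrite /= inE negb_or => /andP [/andP []].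
subst b' e1'.
suff [-> ->] : (bs, es) = (bs', es') by [].
apply: (IH bs' b.1 e1 es es') => //.
- by case/andP: u.
- by case/andP: u'.
- by move=> y yb; apply: d; rewrite inE yb orbT.
- by move=> y yb; apply: d'; rewrite inE yb orbT.
- by move=> a aa; apply: S; rewrite inE aa orbT.
- by move=> a aa; apply: S'; rewrite inE aa orbT.
Qed.

End LabelUniqueness.

Lemma strand_in_frame (G : ograph) (l : label (vert G) (edge G)) p : labelled l -> p \in strands l ->
  [/\ uniq p.2, {in p.1, forall b, frame_degree b.1 = 2},
    all [pred a | arc_matches a && ~~ @tree_type G a.1] (strand_frame_arcs (source l) (target l) p) &
    {subset bead_arcs p <= spur_arcs l}].
Proof.
move=> hl ps; split.
- have : uniq (frame_edges l).
    have := uniq_edges hl; rewrite /unzip1 map_cat cat_uniq => /andP [+ _].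
    by rewrite -(frame_arcs_edges (labelled_shape hl)).
  rewrite (perm_uniq (perm_flatten (perm_map snd (perm_to_rem ps)))) /= cat_uniq.
  by case/andP.
- move=> b bp; apply: (frame_degree_bead hl); apply/flattenP; exists (unzip1 p.1).
    exact: (map_f (fun p => unzip1 p.1) ps).
  exact: map_f.
- apply/allP => a Ha /=; have Ha' : a \in frame_arcs l.
    by apply/flattenP; exists (strand_frame_arcs (source l) (target l) p) => //; exact: map_f.
  rewrite (label_arc_matches hl) ?(perm_mem (perm_label_arcs l)) ?mem_cat ?Ha' //.
  by rewrite (tree_type_label hl) negbK; apply/(frame_edgeP hl); exists a.
- move=> a ap; rewrite !mem_cat; apply/orP; right; apply/orP; right.
  by apply/flattenP; exists (bead_arcs p) => //; exact: map_f.
Qed.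

Lemma mem_source_hairs (G : ograph) (l : label (vert G) (edge G)) q : labelled l ->
  (q \in source_hairs l) = ((q.2, (source l, q.1)) \in spur_arcs l).
Proof.
move=> hl; have := uniq_core_tips hl; rewrite cat_uniq => /and3P [/= /and3P [Ac _ _] _ _].
move: Ac; rewrite inE negb_or => /andP [AB Ab].
rewrite !mem_cat; apply/idP/or3P => [ql|[/mapP [q' ql' [E1 E2]]|/mapP [q' _ [_ E _]]|]].
- by apply: Or31; exact: (map_f (fun q => (q.2, (source l, q.1))) ql).
- by rewrite [q]surjective_pairing E1 E2 -surjective_pairing.
- by rewrite E eqxx in AB.
case/flattenP => _ /mapP [p ps ->] /mapP [b bp [_ E _]]; case/negP: Ab; rewrite E.
by apply/flattenP; exists (unzip1 p.1); [exact: (map_f (fun p => unzip1 p.1) ps) | exact: map_f].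
Qed.

Lemma mem_target_hairs (G : ograph) (l : label (vert G) (edge G)) q : labelled l ->
  (q \in target_hairs l) = ((q.2, (target l, q.1)) \in spur_arcs l).
Proof.
move=> hl; have [hl' _] := labelled_rev hl.
by rewrite (mem_source_hairs q hl') (perm_mem (spur_arcs_rev l)).
Qed.

(** The initial edge of a strand of [l] is a frame edge at the common source, hence also begins a
    strand of [l'], and [strand_determined] identifies the two strands. Hairs at the ends are
    intrinsic. *)
Lemma same_ends_label (G : ograph) (l l' : label (vert G) (edge G)) : labelled l -> labelled l' ->
  source l = source l' -> target l = target l' ->
  exists2 ps, perm_eq (strands l) ps & l' = permute_label l ps.
Proof.
move=> hl hl' sE tE.
have sub : {subset strands l <= strands l'}.
  move=> p ps; have [e [es pE]] := strand_first hl ps.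
  have [up dp ap bp] := strand_in_frame hl ps.
  have [bs' [es' ps']] : exists bs es0, (bs, e :: es0) \in strands l'.
    have a0 : (e, (source l, head (target l) (unzip1 p.1))) \in strand_frame_arcs (source l) (target l) p.
      by rewrite pE /strand_frame_arcs; case: (p.1) => [|b bs]; rewrite /= mem_head.
    have /andP [m t] := allP ap _ a0; rewrite /= in t.
    have [a] := edge_arc hl' e; rewrite mem_cat => /orP [Ha|Ha] eE; last first.
      by move: t; rewrite (tree_type_label hl') eE (frame_edge_not_spur hl' Ha).
    rewrite eE; apply: (frame_arc_at_source hl' Ha).
    have : incident (source l) a.1.
      by rewrite -eE /incident; move: m; rewrite /arc_matches /= => /orP [] /eqP -> /=; rewrite eqxx ?orbT.
    by rewrite (incident_arc hl') ?mem_cat ?Ha // sE.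
  have [up' dp' ap' bp'] := strand_in_frame hl' ps'.
  have /and4P [_ _ _ sz] := labelled_shape hl; have /and4P [_ _ _ sz'] := labelled_shape hl'.
  have H : (p.1, es) = (bs', es').
    apply: (strand_determined hl (x := source l) (B := target l) (e := e)).
    - by move/allP: sz => /(_ p ps); rewrite pE eqSS => /eqP.
    - by move/allP: sz' => /(_ _ ps'); rewrite eqSS => /eqP.
    - by rewrite pE in up.
    - by [].
    - by apply/eqP; rewrite (frame_degree3 hl) eqxx orbT.
    - exact: dp.
    - exact: dp'.
    - by rewrite -pE.
    - by rewrite sE tE.
    - by rewrite pE in bp.
    - by move=> a /bp'; rewrite (spur_arcs_eq hl hl').
  by rewrite pE; case: H ps' => -> ->.
have /and4P [ha hb /eqP s3 _] := labelled_shape hl.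
have /and4P [ha' hb' /eqP s3' _] := labelled_shape hl'.
have pm : perm_eq (strands l) (strands l').
  apply: uniq_perm; [exact: uniq_strands | exact: uniq_strands |].
  by have [] := uniq_min_size (uniq_strands hl) sub; rewrite ?s3 ?s3'.
exists (strands l') => //.
have spE := spur_arcs_eq hl hl'.
have eq1 (T : eqType) (s t : seq T) : (size s <= 1)%N -> (size t <= 1)%N -> s =i t -> s = t.
  case: s t => [|x [|? ?]] // [|y [|? ?]] // _ _ E; first by have := E y; rewrite !inE eqxx.
    by have := E x; rewrite !inE eqxx.
  by have := E x; rewrite !inE eqxx => /esym /eqP ->.
have hAE : source_hairs l = source_hairs l'.
  by apply: eq1 => // q; rewrite (mem_source_hairs q hl) (mem_source_hairs q hl') spE sE.
have hBE : target_hairs l = target_hairs l'.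
  by apply: eq1 => // q; rewrite (mem_target_hairs q hl) (mem_target_hairs q hl') spE tE.
by rewrite /permute_label sE tE hAE hBE; case: (l').
Qed.

Lemma valence_source (G : ograph) (l : label (vert G) (edge G)) : labelled l ->
  valence (source l) = (3 + (label_type l).1.1)%N.
Proof.
move=> hl; rewrite (valenceE hl) eqxx; have := vertex_count hl (source l); rewrite eqxx.
by case: (target l == source l) => /=; rewrite ?muln0 ?muln1; lia.
Qed.

Lemma valence_target (G : ograph) (l : label (vert G) (edge G)) : labelled l ->
  valence (target l) = (3 + (label_type l).1.2)%N.
Proof. by move=> hl; have [hl' _] := labelled_rev hl; rewrite (valence_source hl'). Qed.

(* For equal numbers [a] of hairs at the two ends, the reversal of a label preserves the sign
   exactly when the number of the other hairs has the parity of [a]. *)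
Lemma label_unique (G : ograph) (l l' : label (vert G) (edge G)) : labelled l -> labelled l' ->
  (label_type l).1 = (label_type l').1 ->
  ((label_type l).1.1 = (label_type l).1.2 -> odd (sumn (label_type l).2) = odd (label_type l).1.1) ->
  perm_eq (label_type l).2 (label_type l').2 /\ label_odd l = label_odd l'.
Proof.
move=> hl hl' tE good.
have same (k : label (vert G) (edge G)) : labelled k -> source k = source l' -> target k = target l' ->
    perm_eq (label_type k).2 (label_type l').2 /\ label_odd k = label_odd l'.
  move=> hk sE tE'; have [ps pm ->] := same_ends_label hk hl' sE tE'.
  by have [_ ->] := labelled_permute hk pm; split=> //; exact: perm_map.
have s3 : (source l' == source l) || (source l' == target l).
  by rewrite -(frame_degree3 hl) (frame_degree3 hl') eqxx.
have t3 : (target l' == source l) || (target l' == target l).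
  by rewrite -(frame_degree3 hl) (frame_degree3 hl') eqxx orbT.
have ne' := source_target_neq hl'.
case/orP: s3 => /eqP sE; case/orP: t3 => /eqP tE'.
- by rewrite sE tE' eqxx in ne'.
- exact: same.
(* The ends are exchanged, so [l'] is compared with the reversal of [l]. Comparing valences shows
   that both ends carry equally many hairs, and then [good] makes the reversal sign trivial. *)
- have [hr so] := labelled_rev hl; have [pr or] := same _ hr (esym sE) (esym tE').
  have ab : (label_type l).1.1 = (label_type l).1.2.
    apply/eqP; rewrite -(eqn_add2l 3) -(valence_target hl) -sE (valence_source hl') -tE eqxx //.
  rewrite label_type_rev in pr; split=> //; rewrite -or so good //.
  rewrite -[size (source_hairs l)]/((label_type l).1.1) -[size (target_hairs l)]/((label_type l).1.2) -ab.
  by rewrite andbb -addbA addbb addbF.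
- by rewrite sE tE' eqxx in ne'.
Qed.

(** * Two-loop hairy graphs are labelled *)

Section HairyCounting.

Variable G : ograph.
Hypothesis hG : two_loop_hairy G.

Lemma hairy_order : perm_eq (ordr G) (enum {: cell G}).
Proof. by case/and4P: hG => /and4P []. Qed.

Lemma hairy_connected : #|parts [set: cell G]| = 1%N.
Proof. by case/and4P: hG => /and4P [_ /eqP]. Qed.

Lemma hairy_betti1 : betti1 [set: cell G] = 2.
Proof. by case/and4P: hG => _ /eqP. Qed.

Lemma hairy_vertex v : external v || @internal G v.
Proof. by case/and4P: hG => /and4P [_ _ /forallP H _] _ _ _; exact: H. Qed.

Lemma hairy_no_cut v : ~~ cut_vertex (frame G) v.
Proof. by case/and4P: hG => _ _ /forallP H _; exact: H. Qed.

Lemma external_not_internal v : @external G v -> internal v = false.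
Proof. by rewrite /external /internal => /eqP ->. Qed.

Lemma external_tree v e : @external G v -> incident v e -> tree_type e.
Proof.
by move=> /eqP; apply: tree_type_leaf; [exact: hairy_connected | exact: hairy_betti1].
Qed.

Lemma hairP e : @tree_type G e -> exists u v, [/\ ends G e = (u, v) \/ ends G e = (v, u),
  external u, internal v & forall e', tree_type e' -> incident v e' -> e' = e].
Proof.
move=> te; case/and4P: (hG) => _ _ _ /forallP /(_ e); rewrite te /= /hair te /=.
case/existsP=> u /existsP [v /and4P [E xu vf /forallP H]]; exists u, v; split=> //.
- by case/orP: E => /eqP; auto.
- have := hairy_vertex v; case/orP=> // xv.
  move: vf; rewrite inE => /existsP [f /andP [/negP nt vfi]]; case: nt; exact: external_tree xv vfi.
- by move=> e' te' ve'; apply/eqP; have := H e'; rewrite te' ve'.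
Qed.

Definition tree_halves (v : vert G) : {set half_edge G} := [set h in halves v | tree_type h.1].

Lemma valence_split v : valence v = (frame_degree v + #|tree_halves v|)%N.
Proof.
rewrite /valence -(cardsID [set h | tree_type h.1]) addnC /frame_degree; congr addn;
  by apply: eq_card => h; rewrite !inE // andbC.
Qed.

Lemma at_vertex_incident (h : half_edge G) : incident (at_vertex h) h.1.
Proof. by case: h => e []; rewrite /incident /at_vertex /= eqxx ?orbT. Qed.

Definition flip_half (h : half_edge G) : half_edge G := (h.1, ~~ h.2).

Lemma flip_halfK : involutive flip_half.
Proof. by case=> e b; rewrite /flip_half /= negbK. Qed.

Lemma half_at_same_edge (h k : half_edge G) : h.1 = k.1 -> k = h \/ k = flip_half h.
Proof. by case: h k => e [] [f []] /= <-; auto. Qed.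

Lemma tree_half_flip (h : half_edge G) : tree_type h.1 ->
  external (at_vertex (flip_half h)) = ~~ external (at_vertex h).
Proof.
move=> te; have [u [v [E xu iv _]]] := hairP te.
have xv : external v = false by apply: contraTF iv => /external_not_internal ->.
by case: h {te} E => e [] /= [] E; rewrite /at_vertex /flip_half /= E /= ?xu ?xv.
Qed.

Lemma tree_halves_internal v : @internal G v -> (#|tree_halves v| <= 1)%N.
Proof.
move=> iv; apply/card_le1_eqP => h k; rewrite !inE => /andP [/eqP hv th] /andP [/eqP kv tk].
have nx x : at_vertex x = v -> external (at_vertex x) = false.
  by move=> ->; apply: contraTF iv => /external_not_internal ->.
have [u [w [E xu iw uniqw]]] := hairP th.
have vw : v = w.
  have := at_vertex_incident h; rewrite hv /incident.
  have uv : (u == v) = false by apply: contraTF iv => /eqP <-; rewrite (external_not_internal xu).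
  by case: E => -> /=; rewrite uv ?orbF /= => /eqP.
have kh : k.1 = h.1 by apply: uniqw => //; rewrite -vw -kv; exact: at_vertex_incident.
case: (half_at_same_edge (esym kh)) => // kE.
by have := tree_half_flip th; rewrite -kE (nx k kv) (nx h hv).
Qed.

Lemma card_halves_sum (P : pred (half_edge G)) :
  (\sum_v #|[set h in halves v | P h]| = #|[set h | P h]|)%N.
Proof.
rewrite -sum1_card (partition_big (@at_vertex G) xpredT) //=.
by apply: eq_bigr => v _; rewrite -sum1_card; apply: eq_bigl => h; rewrite !inE andbC.
Qed.

Lemma card_half_edges (P : pred (edge G)) :
  (#|[set h : half_edge G | P h.1]| = 2 * #|[set e | P e]|)%N.
Proof.
rewrite -!sum1_card big_distrr /= [LHS]big_mkcond [RHS]big_mkcond /=.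
rewrite (eq_bigr (fun h : edge G * bool => nat_of_bool (P h.1))); last first.
  by move=> h _; rewrite inE; case: (P _).
rewrite -(pair_big xpredT xpredT (fun e (b : bool) => nat_of_bool (P e))) /=.
by apply: eq_bigr => e _; rewrite big_bool /= inE; case: (P e).
Qed.

(** Each tree-type edge has exactly one external end. The count runs over half-edges, on which
    [flip_half] exchanges the external and the internal ends. *)
Lemma card_external_tree : #|[set v | @external G v]| = #|[set e | @tree_type G e]|.
Proof.
transitivity #|[set h : half_edge G | tree_type h.1 && external (at_vertex h)]|.
  rewrite -card_halves_sum -sum1_card big_mkcond /=; apply: eq_bigr => v _; rewrite inE.
  case: ifP => xv; last first.
    apply/esym/eqP; rewrite cards_eq0; apply/eqP/setP => h; rewrite !inE.
    by apply/negP => /and3P [/eqP hv _]; rewrite hv xv.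
  have <- : valence v = 1%N by exact/eqP.
  apply: eq_card => h; apply/idP/idP => [hv|]; last by rewrite inE => /andP [].
  move: (hv); rewrite !inE => hv'; rewrite hv' (eqP hv') xv andbT /=.
  by apply: (external_tree xv); rewrite -(eqP hv'); exact: at_vertex_incident.
have H : (#|[set h : half_edge G | tree_type h.1 && external (at_vertex h)]| +
    #|[set h : half_edge G | tree_type h.1 && external (at_vertex h)]| =
    #|[set h : half_edge G | @tree_type G h.1]|)%N.
  rewrite -[in RHS](cardsID [set h : half_edge G | external (at_vertex h)]); congr addn.
    by apply: eq_card => h; rewrite !inE.
  rewrite -(card_imset _ (inv_inj flip_halfK)); apply: eq_card => h.
  apply/imsetP/idP => [[k]|]; rewrite !inE.
    by move=> /andP [tk xk] ->; rewrite tree_half_flip // xk.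
  move=> /andP [nx th]; exists (flip_half h); last by rewrite flip_halfK.
  by rewrite !inE /= th tree_half_flip.
by have := card_half_edges (@tree_type G); rewrite -H mul2n -addnn; lia.
Qed.

Lemma frame_degree_external v : @external G v -> frame_degree v = 0%N.
Proof.
move=> xv; apply/eqP; rewrite cards_eq0; apply/eqP/setP => h; rewrite !inE.
apply/negP => /andP [/eqP hv /negP []]; apply: (external_tree xv).
by rewrite -hv; exact: at_vertex_incident.
Qed.

Lemma frame_degree_internal v : @internal G v -> (2 <= frame_degree v)%N.
Proof.
move=> iv; have := tree_halves_internal iv; have := valence_split v.
by move: iv; rewrite /internal; lia.
Qed.

(** Tree-type edges and external vertices cancel in the Euler characteristic, so the frame has one
    edge more than there are internal vertices; the sum of the frame degrees is twice the number of
    frame edges. *)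
Lemma frame_excess : (\sum_(v | @internal G v) (frame_degree v - 2) = 2)%N.
Proof.
have sumF : (\sum_v @frame_degree G v = 2 * #|[set e | ~~ @tree_type G e]|)%N.
  by rewrite -(card_half_edges (fun e => ~~ tree_type e)) -card_halves_sum.
have sumI : (\sum_v @frame_degree G v = \sum_(v | @internal G v) frame_degree v)%N.
  rewrite [RHS]big_mkcond; apply: eq_bigr => v _; case: ifP => // iv.
  by have := hairy_vertex v; rewrite iv orbF => /frame_degree_external.
have sum2 : (\sum_(v | @internal G v) frame_degree v =
    \sum_(v | @internal G v) (frame_degree v - 2) + 2 * #|[set v | @internal G v]|)%N.
  rewrite mulnC -sum_nat_cond_const -big_split; apply: eq_bigr => v /frame_degree_internal /=; lia.
have cE := cardsC [set e | @tree_type G e]; have cV := cardsC [set v | @external G v].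
have iE : #|~: [set v | @external G v]| = #|[set v | @internal G v]|.
  apply: eq_card => v; rewrite !inE; have := hairy_vertex v.
  by have [xv|//] := boolP (external v); rewrite (external_not_internal xv).
have tE : #|~: [set e | @tree_type G e]| = #|[set e | ~~ @tree_type G e]|.
  by apply: eq_card => e; rewrite !inE.
have := hairy_betti1; rewrite /betti1 hairy_connected.
have -> : [set e | inr e \in [set: cell G]] = setT by apply/setP => e; rewrite !inE.
have -> : [set v | inl v \in [set: cell G]] = setT by apply/setP => v; rewrite !inE.
move: cE cV; rewrite iE tE card_external_tree !cardsT !card_ord.
move: sumF; rewrite sumI sum2.
move: (\sum_(v | _) _)%N #|[set e | tree_type e]| #|[set e | ~~ tree_type e]| #|[set v | internal v]| => s a b c.
by move: (nv G) (ne G) => n p; lia.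
Qed.

End HairyCounting.

(** * Walks along the frame *)

Section Walk.

Variable G : ograph.
Hypothesis hG : two_loop_hairy G.

(* At a vertex of frame degree 2, [turn] exchanges the two frame half-edges; elsewhere it
   fixes everything, so that [turn] and [flip_half] are involutions and the walk along the
   frame is the permutation [step]. *)
Definition turn (h : half_edge G) : half_edge G :=
  if (frame_degree (at_vertex h) == 2) && ~~ tree_type h.1 then
    odflt h [pick k in frame_halves (at_vertex h) | k != h]
  else h.

Lemma turnP (h : half_edge G) : frame_degree (at_vertex h) = 2 -> ~~ tree_type h.1 ->
  [/\ turn h != h, at_vertex (turn h) = at_vertex h & frame_halves (at_vertex h) = [set h; turn h]].
Proof.
move=> d2 th; have hf : h \in frame_halves (at_vertex h) by rewrite !inE eqxx.
have [k ke] : exists k, frame_halves (at_vertex h) :\ h = [set k].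
  by apply/cards1P; have := cardsD1 h (frame_halves (at_vertex h));
    rewrite hf -/(frame_degree (at_vertex h)) d2 add1n => -[<-].
have tE : turn h = k.
  rewrite /turn d2 th eqxx /=; case: pickP => [k' /andP [kf kh]|/(_ k)] /=.
    by apply/eqP; rewrite -in_set1 -ke in_setD1 kh.
  by have := set11 k; rewrite -ke => /setD1P [-> ->].
have := set11 k; rewrite -ke => /setD1P [kh kf]; rewrite tE; split=> //.
  by move: kf; rewrite !inE => /andP [/eqP].
by rewrite -ke setD1K.
Qed.

Lemma turn_id (h : half_edge G) : frame_degree (at_vertex h) != 2 -> turn h = h.
Proof. by rewrite /turn => /negbTE ->. Qed.

Lemma turn_tree (h : half_edge G) : tree_type h.1 -> turn h = h.
Proof. by rewrite /turn => ->; rewrite andbF. Qed.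

Lemma turn_frame (h : half_edge G) : tree_type (turn h).1 = tree_type h.1.
Proof.
have [th|th] := boolP (tree_type h.1); first by rewrite turn_tree.
have [d2|d2] := eqVneq (frame_degree (at_vertex h)) 2; last by rewrite turn_id // (negbTE th).
have [_ _ E] := turnP d2 th; have : turn h \in frame_halves (at_vertex h) by rewrite E !inE eqxx orbT.
by rewrite !inE => /andP [_ /negbTE].
Qed.

Lemma at_turn (h : half_edge G) : at_vertex (turn h) = at_vertex h.
Proof.
have [th|th] := boolP (tree_type h.1); first by rewrite turn_tree.
have [d2|d2] := eqVneq (frame_degree (at_vertex h)) 2; last by rewrite turn_id.
by have [] := turnP d2 th.
Qed.

Lemma turnK : involutive turn.
Proof.
move=> h; have [th|th] := boolP (tree_type h.1); first by rewrite !(turn_tree th).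
have [d2|d2] := eqVneq (frame_degree (at_vertex h)) 2; last by rewrite !(turn_id d2).
have [th1 a1 E1] := turnP d2 th.
have d2' : frame_degree (at_vertex (turn h)) = 2 by rewrite a1.
have th' : ~~ tree_type (turn h).1 by rewrite turn_frame.
have [th2 _ E2] := turnP d2' th'.
have : turn (turn h) \in [set h; turn h] by rewrite -E1 -a1 E2 !inE eqxx orbT.
by rewrite !inE (negbTE th2) orbF => /eqP.
Qed.

Definition step (h : half_edge G) : half_edge G := turn (flip_half h).

Lemma step_inj : injective step.
Proof. exact: inj_comp (inv_inj turnK) (inv_inj (@flip_halfK G)). Qed.

Lemma iter_step_inj j : injective (iter j step).
Proof. by elim: j => // j IH x y /= /step_inj /IH. Qed.

Lemma turn_step (h : half_edge G) : turn (step h) = flip_half h.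
Proof. exact: turnK. Qed.

Lemma at_step (h : half_edge G) : at_vertex (step h) = at_vertex (flip_half h).
Proof. exact: at_turn. Qed.

Lemma step_frame (h : half_edge G) : tree_type (step h).1 = tree_type h.1.
Proof. exact: turn_frame. Qed.

Lemma iter_step_frame j (h : half_edge G) : tree_type (iter j step h).1 = tree_type h.1.
Proof. by elim: j => //= j <-; rewrite step_frame. Qed.

Definition walk_end (h : half_edge G) (j : nat) : bool :=
  frame_degree (at_vertex (flip_half (iter j step h))) != 2.

(** Index of the last edge of the walk from [h], counted from 0, hence also the number of inner
    vertices. The orbit of [h] under [step] bounds the search. *)
Definition walk_length (h : half_edge G) : nat := find (walk_end h) (iota 0 (order step h)).

Section From.

Variable h : half_edge G.
Hypothesis start : frame_degree (at_vertex h) != 2.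

(** [step] is injective, so its orbit comes back to [h]; the last move arrives at the starting
    vertex, which does not have frame degree 2. *)
Lemma walk_has : has (walk_end h) (iota 0 (order step h)).
Proof.
apply: contraT => /hasPn H; have o0 := order_gt0 step h.
have := H (order step h).-1; rewrite mem_iota add0n prednK // leqnn => /(_ isT).
rewrite /walk_end negbK -at_step -[step _]/(iter (order step h).-1.+1 step h) prednK //.
by rewrite (iter_order step_inj) (negbTE start).
Qed.

Lemma walk_length_end : walk_end h (walk_length h).
Proof.
have := nth_find 0%N walk_has; rewrite nth_iota ?add0n //.
by rewrite -[X in (_ < X)%N](size_iota 0) -has_find; exact: walk_has.
Qed.

Lemma walk_before j : (j < walk_length h)%N ->
  frame_degree (at_vertex (flip_half (iter j step h))) = 2.
Proof.
move=> jl; have jo : (j < order step h)%N.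
  by apply: ltn_trans jl _; rewrite -(size_iota 0 (order step h)) -has_find walk_has.
have := before_find 0%N jl; rewrite nth_iota // add0n /walk_end.
by move/negbFE/eqP.
Qed.

Lemma walk_inner j : (0 < j <= walk_length h)%N -> frame_degree (at_vertex (iter j step h)) = 2.
Proof. by case: j => // j /=; rewrite at_step => /walk_before. Qed.

End From.

(** Cancelling the common steps puts one starting half-edge inside the other walk; inner vertices
    have frame degree 2 and starting vertices do not, so nothing remains to be walked. *)
Lemma walk_distinct (h h' : half_edge G) i j :
  frame_degree (at_vertex h) != 2 -> frame_degree (at_vertex h') != 2 ->
  (i <= walk_length h)%N -> (j <= walk_length h')%N ->
  iter i step h = iter j step h' -> h = h' /\ i = j.
Proof.
clear hG; wlog ij : h h' i j / (i <= j)%N.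
  move=> W s s' il jl E; case/orP: (leq_total i j) => ij; first exact: W.
  by have [-> ->] := W h' h j i ij s' s jl il (esym E).
move=> s s' il jl; rewrite -(subnKC ij) iterD => /iter_step_inj hE.
suff ji : (j - i)%N = 0%N by rewrite ji in hE; split=> //; lia.
apply/eqP; apply: contraT; rewrite -lt0n => ji.
have : frame_degree (at_vertex h) = 2 by rewrite hE; apply: walk_inner => //; lia.
by move/eqP; rewrite (negbTE s).
Qed.

(** If the two walks used an edge in opposite directions, following the first forwards would retrace
    the second backwards, down to its start at [A]; the first walk would then end at [A]. *)
Lemma walk_no_return (h h' : half_edge G) (A : vert G) i j :
  frame_degree A != 2 -> at_vertex h = A -> at_vertex h' = A ->
  at_vertex (flip_half (iter (walk_length h) step h)) != A ->
  (i <= walk_length h)%N -> (j <= walk_length h')%N ->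
  iter i step h <> flip_half (iter j step h').
Proof.
move=> dA hA hA' ne; have s : frame_degree (at_vertex h) != 2 by rewrite hA.
have s' : frame_degree (at_vertex h') != 2 by rewrite hA'.
elim: j i => [|j IH] i il jl E.
  have E' : flip_half (iter i step h) = h' by rewrite E flip_halfK.
  have [iw|iw] := ltnP i (walk_length h).
    by have := walk_before s iw; rewrite E' => /eqP; rewrite (negbTE s').
  have iE : i = walk_length h by apply/eqP; rewrite eqn_leq il.
  by rewrite -iE E' hA' eqxx in ne.
have E' : flip_half (iter i step h) = iter j.+1 step h' by rewrite E flip_halfK.
have [iw|iw] := ltnP i (walk_length h); last first.
  have iE : i = walk_length h by apply/eqP; rewrite eqn_leq il.
  have := walk_length_end s; rewrite /walk_end -iE E' walk_inner ?eqxx //.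
apply: (IH i.+1) => //; first exact: ltnW.
by rewrite /= /step E' -turn_step.
Qed.

(* If the walk from [D] comes back to [D], it uses at most two of the frame half-edges at [D],
   and removing [D] separates the walk from the others. *)
Lemma walk_cut (D : vert G) (h : half_edge G) : (2 < frame_degree D)%N ->
  h \in frame_halves D -> at_vertex (flip_half (iter (walk_length h) step h)) <> D.
Proof.
move=> dD hD back; have /negP [] := hairy_no_cut hG D.
move: (hD); rewrite !inE => /andP [/eqP hv th].
have s : frame_degree (at_vertex h) != 2 by rewrite hv; apply/eqP; lia.
pose x j := iter j step h; pose t := walk_length h.
have xf j : tree_type (x j).1 = false by rewrite iter_step_frame (negbTE th).
(* More than two frame half-edges meet at [D], so one of them is neither the departure nor the
   return of the walk. *)
have [k kD] : exists k, k \in frame_halves D :\: [set h; flip_half (x t)].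
  apply/set0Pn; rewrite -cards_eq0 cardsD subn_eq0 -ltnNge; apply: leq_trans dD.
  rewrite ltnS; apply: leq_trans (subset_leq_card (subsetIr _ _)) _.
  by rewrite cards2; case: (_ != _).
move: kD; rewrite !inE negb_or => /andP [/andP [kh kt] /andP [/eqP kv tk]].
have inF e v : incident v e -> ~~ tree_type e -> inl v \in frame G.
  by move=> ve te; rewrite inE; apply/existsP; exists e; rewrite te.
have DF : inl D \in frame G by apply: (inF h.1) => //; rewrite -hv; exact: at_vertex_incident.
have fD e : inr e \in frame G :\ inl D = ~~ tree_type e by rewrite !inE.
(* The cells of the walk other than [D]. They are closed under adjacency in the frame without [D],
   so the edge of [k] cannot be reached from that of [h] unless it belongs to the walk. *)
pose P (c : cell G) : bool := match c with
  | inl v => (v != D) && [exists j : 'I_t.+1, at_vertex (x j) == v]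
  | inr e => [exists j : 'I_t.+1, (x j).1 == e] end.
have jt (j : 'I_t.+1) : (j <= walk_length h)%N by rewrite -ltnS.
have Pcl c d : cell_adj (frame G :\ inl D) c d -> P c -> P d.
  case/and3P; case: c d => [v|e] [w|f] // vF eF.
    move=> vf /= /andP [vD /existsP [j /eqP jv]].
    have j0 : (0 < j)%N by rewrite lt0n; apply: contra vD => /eqP j0; rewrite -jv j0 -hv.
    have d2 : frame_degree v = 2 by rewrite -jv; apply: walk_inner => //; rewrite j0 jt.
    have hf : half_at v f \in frame_halves v by apply: half_at_frame => //; rewrite -fD.
    have d2' : frame_degree (at_vertex (x j)) = 2 by rewrite jv.
    have [_ _ E] := turnP d2' (negbT (xf j)); rewrite jv in E.
    move: hf; rewrite E !inE => /orP [] /eqP fE; first by apply/existsP; exists j; rewrite -fE.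
    have j1 : (j.-1 < t.+1)%N by exact: leq_ltn_trans (leq_pred _) (ltn_ord j).
    apply/existsP; exists (Ordinal j1) => /=.
    move: fE; rewrite -(prednK j0) -[x _]/(step (x j.-1)) turn_step /flip_half => -[->].
    by rewrite eqxx.
  move=> we /= /existsP [j /eqP je].
  have wD : w != D by move: eF; rewrite !inE => /andP [].
  rewrite wD /=; have := we; rewrite -je => wj.
  have wE : w = at_vertex (x j) \/ w = at_vertex (flip_half (x j)).
    move: wj; rewrite /incident /at_vertex; case: (x j) => f [] /= /orP [] /eqP; auto.
  case: wE => wE; first by apply/existsP; exists j; rewrite wE.
  have jlt : (j < t)%N.
    rewrite ltn_neqAle -ltnS ltn_ord andbT; apply: contra wD => /eqP jE.
    by rewrite wE jE; apply/eqP.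
  by apply/existsP; exists (Ordinal (jlt : (j.+1 < t.+1)%N)); rewrite wE /= at_step.
rewrite /cut_vertex DF /=; apply: (@parts_gt1 _ _ (inr h.1) (inr k.1)); rewrite ?fD //.
apply/negP => /connect_closed -/(_ P Pcl) /=.
have -> : [exists j : 'I_t.+1, (x j).1 == h.1] by apply/existsP; exists ord0; rewrite /= eqxx.
move/(_ isT)/existsP => -[j /eqP jk].
(* Since [k] is at [D], it could only be the first half-edge of the walk or the flip of the last
   one, and both were excluded. *)
have [kE|kE] := half_at_same_edge jk.
  have j0 : (j : nat) = 0%N.
    apply/eqP; rewrite -leqn0 leqNgt; apply/negP => j0.
    have := @walk_inner h s j; rewrite j0 jt => /(_ isT).
    by rewrite -/(x j) -kE kv => d2; rewrite d2 in dD.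
  by rewrite kE j0 eqxx in kh.
have [jlt|jt'] := ltnP j t.
  by have := walk_before s jlt; rewrite -/(x j) -kE kv => d2; rewrite d2 in dD.
have jE : (j : nat) = t by apply/eqP; rewrite eqn_leq -ltnS ltn_ord.
by rewrite kE jE eqxx in kt.
Qed.

End Walk.

Lemma uniq_allpairs (S : eqType) (R : eqType) (f : S -> nat -> R) (s : seq S) (t : S -> seq nat) :
  uniq s -> {in s, forall x, uniq (t x)} ->
  (forall x y i j, x \in s -> y \in s -> i \in t x -> j \in t y -> f x i = f y j -> x = y /\ i = j) ->
  uniq (flatten [seq [seq f x i | i <- t x] | x <- s]).
Proof.
elim: s => //= x s IH /andP [xs us] Ut inj; rewrite cat_uniq map_inj_in_uniq => [|i j it jt E].
  rewrite Ut ?mem_head //= IH //; first 1 last.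
  - by move=> y ys; apply: Ut; rewrite inE ys orbT.
  - by move=> y z i j ys zs; apply: inj; rewrite inE (ys, zs) orbT.
  rewrite andbT; apply/hasPn => _ /flattenP [_ /mapP [y ys ->] /mapP [j jt ->]].
  apply/mapP => -[i it E]; have [||yx _] := inj y x j i _ _ jt it E; rewrite ?mem_head //.
    by rewrite inE ys orbT.
  by rewrite -yx ys in xs.
by have [] := inj x x i j (mem_head _ _) (mem_head _ _) it jt E.
Qed.

(** * The label read off from the three walks *)

Section HairyLabel.

Variable G : ograph.
Hypothesis hG : two_loop_hairy G.

Variables A B : vert G.
Hypotheses (AB : A != B) (dA : frame_degree A = 3) (dB : frame_degree B = 3).
Hypotheses (iA : internal A) (iB : internal B).
Hypothesis d2 : forall v, internal v -> v != A -> v != B -> frame_degree v = 2.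

Local Notation len h := (walk_length h).
Local Notation x h j := (iter j (@step G) h).
Local Notation starts := (enum (frame_halves A)).

Definition vertex_tips (v : vert G) : seq (vert G * edge G) :=
  [seq (at_vertex (flip_half h), h.1) | h <- enum (tree_halves v)].

Definition vertex_tip (e : edge G) (v : vert G) : vert G * edge G :=
  head (v, e) (vertex_tips v).

Definition walk_strand (h : half_edge G) : strand (vert G) (edge G) :=
  ([seq (at_vertex (x h j), vertex_tip h.1 (at_vertex (x h j))) | j <- iota 1 (len h)],
   [seq (x h j).1 | j <- iota 0 (len h).+1]).

Definition hairy_label : label (vert G) (edge G) :=
  Label A B (vertex_tips A) (vertex_tips B) (map walk_strand starts).

Local Notation l := hairy_label.

Lemma startP h : h \in starts -> [/\ h \in frame_halves A, at_vertex h = A, ~~ tree_type h.1 &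
  frame_degree (at_vertex h) != 2].
Proof.
rewrite mem_enum => hA; have [hv th] : at_vertex h = A /\ ~~ tree_type h.1.
  by move: hA; rewrite !inE => /andP [/eqP].
by split=> //; rewrite hv dA.
Qed.

Lemma frame_half_internal (h : half_edge G) : ~~ tree_type h.1 -> internal (at_vertex h).
Proof.
move=> th; have := hairy_vertex hG (at_vertex h); case/orP=> // xv.
case/negP: th; apply: (external_tree hG xv); exact: at_vertex_incident.
Qed.

Lemma walk_to_target h : h \in starts -> at_vertex (flip_half (x h (len h))) = B.
Proof.
move=> hs; have [hA hv th s] := startP hs.
have ne := @walk_cut _ hG A h; rewrite dA in ne; have {}ne := ne isT hA.
have := walk_length_end s; rewrite /walk_end => e2.
have [vA|/eqP vA] := eqVneq (at_vertex (flip_half (x h (len h)))) A; first by [].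
have [//|/eqP vB] := eqVneq (at_vertex (flip_half (x h (len h)))) B.
case/eqP: e2; apply: d2; [|exact/eqP|exact/eqP].
by apply: frame_half_internal; rewrite /= iter_step_frame.
Qed.

Lemma walk_frame h j : h \in starts -> ~~ tree_type (x h j).1.
Proof. by case/startP => _ _ th _; rewrite iter_step_frame. Qed.

Lemma walk_vertex h j : h \in starts -> (0 < j <= len h)%N -> frame_degree (at_vertex (x h j)) = 2.
Proof. by case/startP => _ _ _ s; exact: walk_inner. Qed.

(** An edge met twice in the same direction is handled by [walk_distinct], in opposite directions by
    [walk_no_return]; the latter applies because the walks end at [B], not at [A]. *)
Lemma edge_index_inj h h' i j : h \in starts -> h' \in starts -> (i <= len h)%N -> (j <= len h')%N ->
  (x h i).1 = (x h' j).1 -> h = h' /\ i = j.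
Proof.
move=> hs hs' il jl E; have [_ hv _ s] := startP hs; have [_ hv' _ s'] := startP hs'.
have [E'|E'] := half_at_same_edge E; first exact: (walk_distinct s s' il jl (esym E')).
have [] := @walk_no_return G h' h A j i _ hv' hv _ jl il E'; first by rewrite dA.
by rewrite walk_to_target // eq_sym.
Qed.

Lemma vertex_index_inj h h' i j : h \in starts -> h' \in starts ->
  (0 < i <= len h)%N -> (0 < j <= len h')%N ->
  at_vertex (x h i) = at_vertex (x h' j) -> h = h' /\ i = j.
Proof.
move=> hs hs' il jl E; have [_ hv _ s] := startP hs; have [_ hv' _ s'] := startP hs'.
have [_ _ H] := turnP (walk_vertex hs il) (walk_frame i hs).
have : x h' j \in frame_halves (at_vertex (x h i)) by rewrite !inE E eqxx walk_frame.
have /andP [i0 il'] := il; have /andP [j0 jl'] := jl.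
rewrite H !inE => /orP [] /eqP E'; first exact: (walk_distinct s s' il' jl' (esym E')).
have E2 : x h' j = flip_half (x h i.-1).
  by rewrite E' -{1}(prednK i0) -[iter _ _ h]/(step (x h i.-1)) turn_step.
have [] := @walk_no_return G h' h A j i.-1 _ hv' hv _ jl' (leq_trans (leq_pred _) il') E2.
  by rewrite dA.
by rewrite walk_to_target // eq_sym.
Qed.

Lemma walk_strand_vertices h : unzip1 (walk_strand h).1 = [seq at_vertex (x h j) | j <- iota 1 (len h)].
Proof. by rewrite /unzip1 -map_comp. Qed.

Lemma beads_hairy : beads l =
  flatten [seq [seq at_vertex (x h j) | j <- iota 1 (len h)] | h <- starts].
Proof.
rewrite /beads /= -map_comp; congr flatten; apply: eq_map => h /=; exact: walk_strand_vertices.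
Qed.

Lemma frame_edges_hairy : frame_edges l =
  flatten [seq [seq (x h j).1 | j <- iota 0 (len h).+1] | h <- starts].
Proof. by rewrite /frame_edges /= -map_comp. Qed.

Lemma strand_frame_arcs_hairy h : h \in starts -> strand_frame_arcs A B (walk_strand h) =
  [seq ((x h j).1, (at_vertex (x h j), at_vertex (flip_half (x h j)))) | j <- iota 0 (len h).+1].
Proof.
move=> hs; have [_ hv _ _] := startP hs.
rewrite /strand_frame_arcs walk_strand_vertices /walk_strand.
have -> : A :: [seq at_vertex (x h j) | j <- iota 1 (len h)] =
    [seq at_vertex (x h j) | j <- iota 0 (len h).+1] by rewrite /= hv.
have -> : rcons [seq at_vertex (x h j) | j <- iota 1 (len h)] B =
    [seq at_vertex (flip_half (x h j)) | j <- iota 0 (len h).+1].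
  have -> n : iota 0 n.+1 = rcons (iota 0 n) n by rewrite -cats1 -[in LHS]addn1 iotaD.
  rewrite map_rcons walk_to_target //; congr rcons.
  by rewrite (iotaDl 1 0) -map_comp; apply: eq_map => j /=; rewrite at_step.
by rewrite !zip_map; elim: (iota _ _) => //= j s ->.
Qed.

Lemma flip_half_ends (h : half_edge G) :
  ends G h.1 = (at_vertex h, at_vertex (flip_half h)) \/
  ends G h.1 = (at_vertex (flip_half h), at_vertex h).
Proof. by case: h => e [] /=; rewrite /at_vertex /=; case: (ends G e); auto. Qed.

Lemma half_arc_matches (h : half_edge G) :
  arc_matches (h.1, (at_vertex h, at_vertex (flip_half h))).
Proof. by rewrite /arc_matches /=; case: (flip_half_ends h) => ->; rewrite eqxx ?orbT. Qed.

Lemma mem_vertex_tips v q : internal v -> q \in vertex_tips v ->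
  exists2 h, h \in tree_halves v & (q.2, (v, q.1)) = (h.1, (at_vertex h, at_vertex (flip_half h))).
Proof.
move=> iv /mapP [h]; rewrite mem_enum => hv ->; exists h => //=.
by move: hv; rewrite !inE => /andP [/eqP ->].
Qed.

Lemma vertex_tipP e v : internal v -> frame_degree v = 2 -> vertex_tip e v \in vertex_tips v.
Proof.
move=> iv dv; rewrite /vertex_tip.
case E: (vertex_tips v) => [|q s]; last exact: mem_head.
have := valence_split v; have : size (vertex_tips v) = 0%N by rewrite E.
by rewrite size_map -cardE => ->; rewrite dv; move: iv; rewrite /internal => + vE; rewrite vE.
Qed.

Lemma size_vertex_tips v : internal v -> (size (vertex_tips v) <= 1)%N.
Proof. by move=> iv; rewrite size_map -cardE; exact: tree_halves_internal. Qed.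

Lemma walk_internal h j : h \in starts -> internal (at_vertex (x h j)).
Proof. by move=> hs; apply: frame_half_internal; exact: walk_frame. Qed.

Lemma spur_arcs_hairy a : a \in spur_arcs l -> [/\ internal a.2.1, tree_type a.1,
  arc_matches a & external a.2.2].
Proof.
have fromP v q : internal v -> q \in vertex_tips v -> [/\ internal v, tree_type q.2,
    arc_matches (q.2, (v, q.1)) & external q.1].
  move=> iv /(mem_vertex_tips iv) [h hv [-> vE ->]]; move: (hv); rewrite !inE => /andP [/eqP hv' th].
  split=> //; first by rewrite vE; exact: half_arc_matches.
  by rewrite (tree_half_flip hG th) hv'; apply: contraL iv => /external_not_internal ->.
rewrite !mem_cat => /or3P [/mapP [q qA ->]|/mapP [q qB ->]|].
- exact: fromP.
- exact: fromP.
case/flattenP => _ /mapP [_ /mapP [h hs ->] ->] /mapP [b /mapP [j jl ->] ->] /=.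
apply: fromP; first exact: walk_internal.
apply: vertex_tipP; first exact: walk_internal.
by apply: walk_vertex => //; move: jl; rewrite mem_iota; lia.
Qed.

Lemma beads_degree v : v \in beads l -> frame_degree v = 2 /\ internal v.
Proof.
rewrite beads_hairy => /flattenP [_ /mapP [h hs ->] /mapP [j jl ->]].
split; last exact: walk_internal.
by apply: walk_vertex => //; move: jl; rewrite mem_iota; lia.
Qed.

Lemma uniq_core_hairy : uniq (core l).
Proof.
rewrite /core /= inE negb_or AB /=; apply/and3P; split.
- by apply/negP => /beads_degree []; rewrite dA.
- by apply/negP => /beads_degree []; rewrite dB.
rewrite beads_hairy; apply: uniq_allpairs => [|h hs|h h' i j hs hs']; [exact: enum_uniq | exact: iota_uniq |].
rewrite !mem_iota !add1n !ltnS => il jl E; exact: (vertex_index_inj hs hs' il jl E).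
Qed.

Lemma uniq_roots_hairy : uniq (roots l).
Proof.
have := uniq_core_hairy; rewrite /core /= inE negb_or => /andP [/andP [_ Ab] /andP [Bb ub]].
rewrite rootsE /= !cat_uniq ub andbT.
have nu n (v : vert G) : (n <= 1)%N -> uniq (nseq n v) by case: n => [|[]].
rewrite (nu _ A (size_vertex_tips iA)) (nu _ B (size_vertex_tips iB)) /=; apply/andP; split; last first.
  by apply/hasPn => v vb; apply/nseqP => -[vB _]; case/negP: Bb; rewrite -vB.
apply/hasPn => v; rewrite mem_cat mem_nseq => /orP [/andP [_ /eqP vB]|vb];
  apply/nseqP => -[vA _].
  by case/eqP: AB; rewrite -vA -vB.
by case/negP: Ab; rewrite -vA.
Qed.

Lemma arc_other_end (a b : edge G * (vert G * vert G)) : arc_matches a -> arc_matches b ->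
  internal a.2.1 -> internal b.2.1 -> external a.2.2 -> external b.2.2 -> a.1 = b.1 -> a = b.
Proof.
have xi (v : vert G) : external v -> internal v -> False by move=> /external_not_internal ->.
case: a b => [e [v w]] [f [v' w']] /=; rewrite /arc_matches /= => am bm iv iv' xw xw' E.
rewrite -E in bm *; case/orP: am bm => /eqP -> /orP [] /eqP [] E1 E2; rewrite ?E1 ?E2 //.
- by case: (xi w); rewrite // E2.
- by case: (xi w); rewrite // E1.
Qed.

Lemma uniq_spur_edges_hairy : uniq (unzip1 (spur_arcs l)).
Proof.
rewrite map_inj_in_uniq; first exact: map_uniq uniq_roots_hairy.
move=> a b /spur_arcs_hairy [ia _ ma xa] /spur_arcs_hairy [ib _ mb xb]; exact: arc_other_end.
Qed.

Lemma uniq_tips_hairy : uniq (tips l).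
Proof.
rewrite map_inj_in_uniq; first exact: map_uniq uniq_roots_hairy.
move=> a b /spur_arcs_hairy [ia _ ma xa] /spur_arcs_hairy [ib _ mb xb] E.
apply: arc_other_end => //; apply: (valence1_incident (u := a.2.2)); first exact/eqP.
  by rewrite /incident; case/orP: ma => /eqP -> /=; rewrite eqxx ?orbT.
by rewrite /incident; case/orP: mb => /eqP -> /=; rewrite E eqxx ?orbT.
Qed.

End HairyLabel.

Section HairyLabelled.

Variable G : ograph.
Hypothesis hG : two_loop_hairy G.

Variables A B : vert G.
Hypotheses (AB : A != B) (dA : frame_degree A = 3) (dB : frame_degree B = 3).
Hypotheses (iA : internal A) (iB : internal B).
Hypothesis d2 : forall v, internal v -> v != A -> v != B -> frame_degree v = 2.

Local Notation len h := (walk_length h).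
Local Notation x h j := (iter j (@step G) h).
Local Notation starts := (enum (frame_halves A)).
Local Notation l := (hairy_label A B).

Lemma hairy_label_shape : well_shaped l.
Proof.
apply/and4P; split; [exact: size_vertex_tips | exact: size_vertex_tips | |].
  by rewrite size_map -cardE -/(frame_degree A) dA.
by apply/allP => _ /mapP [h _ ->]; rewrite /= !size_map !size_iota.
Qed.

Lemma frame_arcs_hairy a : a \in frame_arcs l -> exists h j, [/\ h \in starts, (j <= len h)%N &
  a = ((x h j).1, (at_vertex (x h j), at_vertex (flip_half (x h j))))].
Proof.
case/flattenP => _ /mapP [_ /mapP [h hs ->] ->].
rewrite (strand_frame_arcs_hairy hG dA d2 hs) => /mapP [j jl ->].
by exists h, j; split=> //; move: jl; rewrite mem_iota add0n ltnS.
Qed.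

Lemma mem_bead h j : h \in starts -> (0 < j <= len h)%N -> at_vertex (x h j) \in core l.
Proof.
move=> hs jl; rewrite !inE beads_hairy; apply/orP; right; apply/orP; right.
apply/flattenP; exists [seq at_vertex (x h j) | j <- iota 1 (len h)]; first exact: map_f.
by apply: map_f; rewrite mem_iota add1n ltnS.
Qed.

Lemma mem_frame_edge h j : h \in starts -> (j <= len h)%N -> (x h j).1 \in frame_edges l.
Proof.
move=> hs jl; rewrite frame_edges_hairy.
apply/flattenP; exists [seq (x h j).1 | j <- iota 0 (len h).+1]; first exact: map_f.
by apply: (map_f (fun j => (x h j).1)); rewrite mem_iota.
Qed.

Lemma frame_arc_ends_core a : a \in frame_arcs l -> (a.2.1 \in core l) && (a.2.2 \in core l).
Proof.
case/frame_arcs_hairy => h [j [hs jl ->]] /=; have [_ hv _ _] := startP dA hs.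
apply/andP; split.
  case: j jl => [|j] jl; last exact: mem_bead.
  by rewrite /= hv mem_head.
have [jlt|jge] := ltnP j (len h); first by rewrite -at_step; exact: (@mem_bead h j.+1).
have -> : j = len h by apply/eqP; rewrite eqn_leq jl.
by rewrite (walk_to_target hG dA d2 hs) !inE eqxx orbT.
Qed.

Lemma core_internal v : v \in core l -> internal v.
Proof. by rewrite !inE => /or3P [/eqP -> //|/eqP -> //|/(beads_degree hG AB dA dB iA iB) []]. Qed.

Lemma hairy_label_arcs a : a \in label_arcs l -> arc_matches a.
Proof.
rewrite (perm_mem (perm_label_arcs l)) mem_cat => /orP [/frame_arcs_hairy [h [j [_ _ ->]]]|].
  exact: half_arc_matches.
by case/(spur_arcs_hairy hG AB dA dB iA iB).
Qed.

Lemma frame_edge_not_tree e : e \in frame_edges l -> ~~ tree_type e.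
Proof.
rewrite frame_edges_hairy => /flattenP [_ /mapP [h hs ->] /mapP [j _ ->]].
exact: (walk_frame dA).
Qed.

Lemma uniq_hairy_edges : uniq (unzip1 (frame_arcs l ++ spur_arcs l)).
Proof.
rewrite /unzip1 map_cat -!/(unzip1 _) (frame_arcs_edges hairy_label_shape) cat_uniq.
rewrite (uniq_spur_edges_hairy hG AB dA dB iA iB d2) andbT; apply/andP; split.
  rewrite frame_edges_hairy; apply: uniq_allpairs => [|h hs|h h' i j hs hs'].
  - exact: enum_uniq.
  - exact: iota_uniq.
  rewrite !mem_iota !add0n !ltnS => il jl; exact: (edge_index_inj hG AB dA d2 hs hs' il jl).
apply/hasPn => _ /mapP [a Ha ->]; apply/negP => /frame_edge_not_tree.
by have [_ ->] := spur_arcs_hairy hG AB dA dB iA iB Ha.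
Qed.

Lemma uniq_hairy_verts : uniq (core l ++ tips l).
Proof.
rewrite cat_uniq (uniq_core_hairy hG AB dA dB iA iB d2) (uniq_tips_hairy hG AB dA dB iA iB d2) andbT.
apply/hasPn => _ /mapP [a Ha ->]; apply/negP => /core_internal.
by have [_ _ _ xa] := spur_arcs_hairy hG AB dA dB iA iB Ha; rewrite (external_not_internal xa).
Qed.

Lemma vertex_tips_edge (v : vert G) (e : edge G) : incident v e -> tree_type e ->
  exists2 q : vert G * edge G, q \in vertex_tips v & q.2 = e.
Proof.
move=> ve te; exists (at_vertex (flip_half (half_at v e)), e) => //.
apply: (map_f (fun h => (at_vertex (flip_half h), h.1)) (x := half_at v e)).
by rewrite mem_enum !inE half_atP // eqxx.
Qed.

Lemma core_tree_edge (v : vert G) (e : edge G) : v \in core l -> incident v e -> tree_type e ->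
  e \in unzip1 (spur_arcs l).
Proof.
move=> vc ve te; have [q qv <-] := vertex_tips_edge ve te.
have iv := core_internal vc.
suff H : (q.2, (v, q.1)) \in spur_arcs l by exact: (map_f fst H).
move: vc; rewrite !inE => /or3P [/eqP vA|/eqP vB|vb].
- rewrite mem_cat -vA; apply/orP; left; rewrite vA in qv *.
  exact: (map_f (fun q => (q.2, (A, q.1))) qv).
- rewrite !mem_cat; apply/orP; right; apply/orP; left; rewrite vB in qv *.
  exact: (map_f (fun q => (q.2, (B, q.1))) qv).
rewrite !mem_cat; apply/orP; right; apply/orP; right.
move: (vb); rewrite beads_hairy => /flattenP [_ /mapP [h hs ->] /mapP [j jl vE]].
apply/flattenP; exists (bead_arcs (walk_strand h)).
  by rewrite /= -map_comp; exact: (map_f (fun h => bead_arcs (walk_strand h)) hs).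
have [dv _] := beads_degree hG AB dA dB iA iB vb.
have qE : vertex_tip h.1 v = q.
  move: qv (vertex_tipP h.1 iv dv) (size_vertex_tips hG iv).
  by case: (vertex_tips v) => [|q1 [|? ?]] //; rewrite !inE => /eqP -> /eqP.
apply/mapP; exists (v, vertex_tip h.1 v); last by rewrite qE.
by rewrite vE; exact: (map_f (fun j => (at_vertex (x h j), vertex_tip h.1 (at_vertex (x h j)))) jl).
Qed.

Lemma core_frame_edge (v : vert G) (e : edge G) : v \in core l -> incident v e -> ~~ tree_type e ->
  e \in frame_edges l.
Proof.
move=> vc ve te; have hf := half_at_frame ve te.
move: vc; rewrite !inE => /or3P [/eqP vA|/eqP vB|].
- rewrite vA in hf; have hs : half_at A e \in starts by rewrite mem_enum.
  exact: (@mem_frame_edge (half_at A e) 0).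
(* The three walks arrive at [B] by distinct half-edges, which exhaust the three frame half-edges
   there. *)
- pose last_half h := flip_half (x h (len h)).
  have sub : {subset map last_half starts <= frame_halves B}.
    move=> _ /mapP [h hs ->]; rewrite !inE (walk_to_target hG dA d2 hs) eqxx.
    exact: (walk_frame dA).
  have u : uniq (map last_half starts).
    rewrite map_inj_in_uniq ?enum_uniq // => h h' hs hs' /(inv_inj (@flip_halfK G)) E.
    by have [] := edge_index_inj hG AB dA d2 hs hs' (leqnn _) (leqnn _) (congr1 fst E).
  have sub' : {subset map last_half starts <= enum (frame_halves B)}.
    by move=> h /sub; rewrite mem_enum.
  have sz : (size (enum (frame_halves B)) <= size (map last_half starts))%N.
    by rewrite size_map -!cardE -/(frame_degree A) -/(frame_degree B) dA dB.
  have [_ E] := uniq_min_size u sub' sz.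
  have : half_at v e \in map last_half starts by rewrite E mem_enum vB in hf *.
  case/mapP => h hs hE; have -> : e = (x h (len h)).1 by rewrite -[e]/((half_at v e).1) hE.
  exact: mem_frame_edge.
rewrite beads_hairy => /flattenP [_ /mapP [h hs ->] /mapP [j jl vE]].
rewrite mem_iota add1n ltnS in jl; have /andP [j0 jl'] := jl.
have [_ _ H] := turnP (walk_vertex dA hs jl) (walk_frame dA j hs).
move: hf; rewrite vE H !inE => /orP [] /eqP hE.
  have -> : e = (x h j).1 by rewrite -hE.
  exact: mem_frame_edge.
have -> : e = (x h j.-1).1.
  rewrite -[e]/((half_at v e).1) vE hE -{1}(prednK j0) -[iter _ _ h]/(step (x h j.-1)).
  by rewrite turn_step.
by apply: mem_frame_edge => //; exact: leq_trans (leq_pred _) jl'.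
Qed.

(** The cells listed by the label contain [A] and are closed under incidence, and the graph is
    connected. *)
Lemma hairy_cover (c : cell G) : match c with
  | inl v => v \in core l ++ tips l
  | inr e => e \in frame_edges l ++ unzip1 (spur_arcs l) end.
Proof.
pose P (c : cell G) : bool := match c with
  | inl v => v \in core l ++ tips l
  | inr e => e \in frame_edges l ++ unzip1 (spur_arcs l) end.
suff : P c by case: c.
apply: (connect_closed (r := cell_adj [set: cell G]) (P := P) (x := inl A)); last first.
- by rewrite /P mem_cat mem_head.
- by apply: parts_connect; rewrite ?inE //; exact: hairy_connected.
move=> {}c d /and3P [_ _]; case: c d => [v|e] [w|f] // ve; rewrite /P.
  rewrite mem_cat => /orP [vc|/mapP [a Ha vE]].
    have [te|te] := boolP (@tree_type G f); rewrite mem_cat.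
      by rewrite (core_tree_edge vc ve te) orbT.
    by rewrite (core_frame_edge vc ve te).
  have [_ _ am xa] := spur_arcs_hairy hG AB dA dB iA iB Ha.
  have -> : f = a.1.
    apply: (valence1_incident (u := v)) => //; first by rewrite vE; exact/eqP.
    by rewrite vE /incident; case/orP: am => /eqP -> /=; rewrite eqxx ?orbT.
  by rewrite mem_cat; apply/orP; right; exact: map_f.
rewrite mem_cat -(frame_arcs_edges hairy_label_shape) => /orP [/mapP [a Ha eE]|/mapP [a Ha eE]].
  have am : arc_matches a.
    by apply: hairy_label_arcs; rewrite (perm_mem (perm_label_arcs l)) mem_cat Ha.
  have /andP [c1 c2] := frame_arc_ends_core Ha.
  by move: ve; rewrite eE /incident mem_cat; case/orP: am => /eqP -> /= /orP [] /eqP <-; rewrite ?c1 ?c2.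
have am : arc_matches a.
  by apply: hairy_label_arcs; rewrite (perm_mem (perm_label_arcs l)) mem_cat Ha orbT.
have t2 : a.2.2 \in tips l by exact: map_f.
have c1 : a.2.1 \in core l.
  have : a.2.1 \in roots l by exact: (map_f (fun a => a.2.1)).
  by rewrite rootsE !mem_cat !mem_nseq !inE => /or3P [/andP [_ ->]|/andP [_ ->]|->]; rewrite ?orbT.
by move: ve; rewrite eE /incident mem_cat; case/orP: am => /eqP -> /= /orP [] /eqP <-; rewrite ?c1 ?t2 ?orbT.
Qed.

Lemma labelled_hairy_label : labelled l.
Proof.
apply/and5P; split.
- exact: hairy_order.
- apply: perm_trans (perm_label_verts l) _; apply: uniq_perm; rewrite ?enum_uniq ?uniq_hairy_verts //.
  by move=> v; rewrite mem_enum; exact: (hairy_cover (inl v)).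
- apply: perm_trans (perm_map fst (perm_label_arcs l)) _.
  apply: uniq_perm; rewrite ?enum_uniq ?uniq_hairy_edges // => e.
  rewrite mem_enum map_cat; have := hairy_cover (inr e).
  by rewrite -(frame_arcs_edges hairy_label_shape).
- exact: hairy_label_shape.
- by apply/allP => a; exact: hairy_label_arcs.
Qed.

End HairyLabelled.

(** The total excess of the frame degrees over 2 is 2. A vertex [A] with positive excess exists, and
    a walk from it ends at another such vertex, since a return to [A] would make it a cut vertex. So
    two vertices have frame degree 3 and the other internal ones have frame degree 2. *)
Lemma hairy_labelled (G : ograph) : two_loop_hairy G ->
  exists2 l : label (vert G) (edge G), labelled l &
    ((label_type l).1.2 <= (label_type l).1.1)%N.
Proof.
move=> hG; have ex := frame_excess hG.
have [A iA A3] : exists2 A, @internal G A & (2 < frame_degree A)%N.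
  apply/exists_inP; apply: contraT; rewrite negb_exists_in => /forall_inP H.
  have := ex; rewrite big1 // => v iv; apply/eqP; rewrite subn_eq0 leqNgt; exact: H.
have walkA h : h \in frame_halves A -> exists2 v, v != A & @internal G v && (2 < frame_degree v)%N.
  move=> hA; have ne := walk_cut hG A3 hA.
  have /andP [/eqP hv th] : (at_vertex h == A) && ~~ tree_type h.1 by move: hA; rewrite !inE.
  have s : frame_degree (at_vertex h) != 2 by rewrite hv; apply: contraTN A3 => /eqP ->.
  exists (at_vertex (flip_half (iter (walk_length h) (@step G) h))); first exact/eqP.
  have iv : internal (at_vertex (flip_half (iter (walk_length h) (@step G) h))).
    by apply: frame_half_internal => //; rewrite /= iter_step_frame.
  have ne2 := walk_length_end s; rewrite /walk_end in ne2.
  by rewrite iv ltn_neqAle eq_sym ne2 /=; exact: frame_degree_internal.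
have [h hA] : exists h, h \in frame_halves A by apply/card_gt0P; exact: leq_trans A3.
have [B BA /andP [iB B3]] := walkA h hA.
have sum3 : (frame_degree A - 2 + (frame_degree B - 2) +
    \sum_(v | [&& internal v, v != A & v != B]) (frame_degree v - 2) = 2)%N.
  move: ex; rewrite (bigD1 A) //= (bigD1 B) ?iB ?BA //= addnA => H; apply: etrans H; congr addn.
  by apply: eq_bigl => v; rewrite -andbA.
have dA : frame_degree A = 3 by lia.
have dB : frame_degree B = 3 by lia.
have d2 v : internal v -> v != A -> v != B -> frame_degree v = 2.
  move=> iv vA vB; have := frame_degree_internal hG iv.
  have : (\sum_(v | [&& internal v, v != A & v != B]) (frame_degree v - 2) == 0)%N by apply/eqP; lia.
  by rewrite sum_nat_eq0 => /forall_inP /(_ v); rewrite iv vA vB => /(_ isT) /eqP; lia.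
have AB : A != B by rewrite eq_sym.
have hl := labelled_hairy_label hG AB dA dB iA iB d2.
(* Exchanging the ends if necessary puts the larger number of hairs at the source. *)
have [le|/ltnW lt] := leqP (label_type (hairy_label A B)).1.2 (label_type (hairy_label A B)).1.1.
  by exists (hairy_label A B).
by exists (rev_label (hairy_label A B)); [have [] := labelled_rev hl | rewrite label_type_rev].
Qed.

(** * Multiplication of symmetric polynomials by the first elementary one *)

Section Weights.

Definition triple_eq (x y z a b c : nat) : nat := [&& x == a, y == b & z == c].

(* The coefficient of [X^a Y^b Z^c] in the sum of the six monomials obtained from
   [X^x Y^y Z^z] by permuting the variables. *)
Definition weight (x y z a b c : nat) : nat :=
  (triple_eq x y z a b c + triple_eq x z y a b c + triple_eq y x z a b c +
   triple_eq y z x a b c + triple_eq z x y a b c + triple_eq z y x a b c)%N.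

Definition weight_seq (s : seq nat) (a b c : nat) : nat :=
  weight (nth 0%N s 0) (nth 0%N s 1) (nth 0%N s 2) a b c.

Lemma weight_swap12 x y z a b c : weight x y z a b c = weight y x z a b c.
Proof. by rewrite /weight; ring. Qed.

Lemma weight_swap23 x y z a b c : weight x y z a b c = weight x z y a b c.
Proof. by rewrite /weight; ring. Qed.

Lemma perm_eq2 (T : eqType) (y z b c : T) : perm_eq [:: y; z] [:: b; c] ->
  [:: b; c] = [:: y; z] \/ [:: b; c] = [:: z; y].
Proof.
move=> H; have := perm_mem H b; rewrite !inE eqxx /= => /orP [] /eqP E; rewrite E in H *.
  by left; move: H; rewrite perm_cons => /perm_small_eq -> //.
right; move: H; rewrite (perm_catC [:: y] [:: z]) /= perm_cons => /perm_small_eq -> //.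
Qed.

Lemma weight_perm s s' a b c : size s = 3 -> perm_eq s s' -> weight_seq s a b c = weight_seq s' a b c.
Proof.
case: s => [|x [|y [|z []]]] // _ H; have := perm_size H; case: s' H => [|a' [|b' [|c' []]]] // H _.
have : x \in [:: a'; b'; c'] by rewrite -(perm_mem H) mem_head.
rewrite /weight_seq /= !inE => /or3P [] /eqP E; rewrite -E in H *.
- by move: H; rewrite perm_cons => /perm_eq2 [] [-> ->]; rewrite // weight_swap23.
- move: H; rewrite perm_sym (perm_catCA [:: a'] [:: x]) perm_sym /= perm_cons weight_swap12.
  by case/perm_eq2 => -[-> ->]; rewrite weight_swap12 // weight_swap23 // weight_swap12.
- move: H; rewrite perm_sym (perm_catC [:: a'; b'] [:: x]) perm_sym /= perm_cons.
  case/perm_eq2 => -[-> ->]; rewrite weight_swap12 weight_swap23 //.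
  by rewrite weight_swap12 weight_swap23 weight_swap12.
Qed.

Lemma triple_eq_swap12 x y z a b c : triple_eq x y z b a c = triple_eq y x z a b c.
Proof. by rewrite /triple_eq andbCA. Qed.

Lemma triple_eq_swap23 x y z a b c : triple_eq x y z a c b = triple_eq x z y a b c.
Proof. by rewrite /triple_eq [in RHS](andbC (z == b)). Qed.

Lemma weight_index_swap12 x y z a b c : weight x y z a b c = weight x y z b a c.
Proof. by rewrite /weight !(triple_eq_swap12 _ _ _ a b); ring. Qed.

Lemma weight_index_swap23 x y z a b c : weight x y z a b c = weight x y z a c b.
Proof. by rewrite /weight !(triple_eq_swap23 _ _ _ a b c); ring. Qed.

Definition lower (R : nmodType) (f : nat -> R) (a : nat) : R := if a is a'.+1 then f a' else 0.

(** The coefficient of [X^a Y^b Z^c] in (X + Y + Z) times the polynomial with coefficients [f];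
    [lower] supplies 0 for a variable that cannot be divided out. *)
Definition lower_sum (R : nmodType) (f : nat -> nat -> nat -> R) (a b c : nat) : R :=
  lower (fun a => f a b c) a + lower (fun b => f a b c) b + lower (fun c => f a b c) c.

(** Multiplication by X + Y + Z commutes with the symmetrisation of monomials. *)
Lemma weight_raise x y z a b c :
  ((weight x.+1 y z a b c)%:R + (weight x y.+1 z a b c)%:R + (weight x y z.+1 a b c)%:R =
  lower_sum (fun a b c => (weight x y z a b c)%:R) a b c :> rat).
Proof.
rewrite /lower_sum /lower /weight /triple_eq.
by case: a b c => [|a] [|b] [|c]; rewrite ?eqSS ?andbF /= ?natrD; ring.
Qed.

Lemma weight_self x y z : (0 < weight x y z x y z)%N.
Proof. by rewrite /weight {1}/triple_eq !eqxx. Qed.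

Lemma weight_sum x y z a b c : weight x y z a b c != 0%N -> (x + y + z = a + b + c)%N.
Proof.
rewrite /weight /triple_eq => H; apply/eqP; apply: contraR H => ne.
have ne1 x' y' z' : (x' + y' + z' = x + y + z)%N -> [&& x' == a, y' == b & z' == c] = false.
  by move=> E; apply: contraNF ne => /and3P [/eqP <- /eqP <- /eqP <-]; rewrite -E.
by rewrite !ne1; lia.
Qed.

(** Descending induction on the largest exponent: in the coefficient at [(a+1, b, c)] of the
    product, [g a b c] appears together with coefficients of [g] whose largest exponent is at least
    [a+1]. Only coefficients with strictly largest first exponent are tested, so that basis
    monomials of the cokernel may be added to the product. *)
Lemma lower_sum_inj (R : zmodType) (K : nat) (g : nat -> nat -> nat -> R) :
  (forall a b c, g a b c = g b a c) -> (forall a b c, g a b c = g a c b) ->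
  (forall a b c, (a + b + c)%N != K -> g a b c = 0) ->
  (forall a b c, (c <= b <= a)%N -> lower_sum g a.+1 b c = 0) ->
  forall a b c, g a b c = 0.
Proof.
move=> s12 s23 deg eq0.
suff H n : forall a b c, (K < n + maxn a (maxn b c))%N -> g a b c = 0.
  by move=> a b c; apply: (H K.+1); lia.
elim: n => [|n IH] a b c Hm; first by apply: deg; apply/eqP; lia.
have sorted : forall a b c, (c <= b <= a)%N -> (K < n.+1 + a)%N -> g a b c = 0.
  move=> {Hm}a {}b {}c le Hm; have := eq0 a b c le; rewrite /lower_sum /=.
  have -> : lower (fun b => g a.+1 b c) b = 0 by case: b {le} => //= b; apply: IH; lia.
  have -> : lower (fun c => g a.+1 b c) c = 0 by case: c {le} => //= c; apply: IH; lia.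
  by rewrite !addr0.
case: (leqP a b) => ab; case: (leqP b c) => bc; case: (leqP a c) => ac.
- by rewrite s12 s23 s12 sorted //; lia.
- by exfalso; lia.
- by rewrite s12 s23 sorted //; lia.
- by rewrite s12 sorted //; lia.
- by rewrite s23 s12 sorted //; lia.
- by rewrite s23 sorted //; lia.
- by exfalso; lia.
- by rewrite sorted //; lia.
Qed.

End Weights.

(** * Coefficient functionals *)

Section LinearExtension.

Variables (M : lmodType rat) (f : ograph -> M).

Lemma fgliftB : {morph fglift f : D D' / D - D'}.
Proof. exact: lift_is_additive. Qed.

Lemma fglift0 : fglift f 0 = 0.
Proof. by rewrite -[X in fglift f X](subrr 0) fgliftB subrr. Qed.

Lemma fgliftD : {morph fglift f : D D' / D + D'}.
Proof. by move=> D D'; rewrite -{1}[D']opprK fgliftB -[- D']sub0r fgliftB fglift0 sub0r opprK. Qed.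

Lemma fglift_big (I : Type) (r : seq I) (F : I -> chain) :
  fglift f (\sum_(i <- r) F i) = \sum_(i <- r) fglift f (F i).
Proof. exact: (big_morph _ fgliftD fglift0). Qed.

Lemma fglift_sum (D : chain) : fglift f D = \sum_(G <- dom D) coeff G D *: f G.
Proof. by rewrite -{1}(freeg_sumE D) fglift_big; apply: eq_bigr => G _; rewrite liftU. Qed.

Lemma fgliftZ (a : rat) (D : chain) : fglift f (a *: D) = a *: fglift f D.
Proof.
have -> : a *: D = \sum_(G <- dom D) << a * coeff G D *g G >>.
  rewrite -{1}(freeg_sumE D) scaler_sumr; apply: eq_bigr => G _.
  by apply/eqP/freeg_eqP => H; rewrite coeffZ !coeffU mulrA.
by rewrite [in RHS]fglift_sum scaler_sumr fglift_big; apply: eq_bigr => G _; rewrite liftU scalerA.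
Qed.

Lemma fglift1 (G : ograph) : fglift f << G >> = f G.
Proof. by rewrite liftU scale1r. Qed.

End LinearExtension.

Lemma chain_sum (D : chain) : D = \sum_(G <- dom D) coeff G D *: << G >>.
Proof.
rewrite -{1}(freeg_sumE D); apply: eq_bigr => G _.
apply/eqP/freeg_eqP => H; rewrite coeffZ !coeffU; by rewrite mul1r.
Qed.

Section Functional.

Variables m N : nat.
Hypotheses (hm : odd m) (hN : odd N).

(** The types that reversal does not kill: either the ends carry different numbers of hairs, or
    reversing preserves the sign. *)
Definition good_type (t : nat * nat * seq nat) : Prop :=
  t.1.1 = t.1.2 -> odd (sumn t.2) = odd t.1.1.

Definition good_label (G : ograph) (t : nat * nat) (l : label (vert G) (edge G)) : Prop :=
  [/\ labelled l, (label_type l).1 = t & good_type (label_type l)].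

(** Specified on all oriented graphs because relators are not restricted to hairy ones; graphs
    without a good label get 0. [weight] makes the value insensitive to the order of the strands and
    the sign of the label compensates the orientation, so any good label gives the same value. *)
Definition is_phi (t : nat * nat) (a b c : nat) (G : ograph) (r : rat) : Prop :=
  (exists2 l : label (vert G) (edge G), good_label t l &
    r = label_sign l * (weight_seq (label_type l).2 a b c)%:R) \/
  ((forall l : label (vert G) (edge G), ~ good_label t l) /\ r = 0).

Definition phi (t : nat * nat) (a b c : nat) (G : ograph) : rat^o :=
  epsilon (inhabits 0) (is_phi t a b c G).

Lemma is_phi_phi t a b c G : is_phi t a b c G (phi t a b c G).
Proof.
apply: epsilon_spec.
have [[l hl]|H] := classic (exists l : label (vert G) (edge G), good_label t l).
  by exists (label_sign l * (weight_seq (label_type l).2 a b c)%:R); left; exists l.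
by exists 0; right; split=> // l hl; apply: H; exists l.
Qed.

Lemma phi_label t a b c G (l : label (vert G) (edge G)) : good_label t l ->
  phi t a b c G = label_sign l * (weight_seq (label_type l).2 a b c)%:R.
Proof.
move=> hl; have [[l' [hl' t' g'] ->]|[H]] := is_phi_phi t a b c G; last by case: (H l).
case: hl => hl tl gl; have [|pl ol] := label_unique hl hl' _ gl; first by rewrite tl t'.
rewrite /label_sign ol (weight_perm a b c _ pl) //.
by have /and4P [_ _ /eqP s3 _] := labelled_shape hl; rewrite size_map.
Qed.

Lemma phi_no_label t a b c G : (forall l : label (vert G) (edge G), ~ good_label t l) ->
  phi t a b c G = 0.
Proof. by move=> H; have [[l hl]|[_ ->]] := is_phi_phi t a b c G; first by case: (H l). Qed.

(** A correspondence of good labels with constant sign ratio [r] suffices; this treats the three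
    kinds of relators alike, including graphs without a label. *)
Lemma phi_transfer t a b c G H (r : rat) :
  (forall l : label (vert G) (edge G), good_label t l ->
    exists2 l' : label (vert H) (edge H), good_label t l' &
      label_sign l' = r * label_sign l /\ (label_type l').2 = (label_type l).2) ->
  (forall l' : label (vert H) (edge H), good_label t l' ->
    exists l : label (vert G) (edge G), good_label t l) ->
  phi t a b c H = r * phi t a b c G.
Proof.
move=> GH HG; have [[l hl]|nG] := classic (exists l : label (vert G) (edge G), good_label t l).
  have [l' hl' [sE tE]] := GH l hl.
  by rewrite (phi_label _ _ _ hl) (phi_label _ _ _ hl') sE tE mulrA.
rewrite !phi_no_label ?mulr0 // => l hl; first by apply: nG; exists l.
by apply: nG; exact: HG hl.
Qed.

Lemma phi_iso t a b c G H : ograph_iso G H -> phi t a b c H = phi t a b c G.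
Proof.
case=> f [g [bf bg Eg Eo]]; rewrite -[RHS]mul1r; apply: phi_transfer => l [hl tl gl].
  have [hl' ol'] := labelled_map bf bg Eg Eo hl.
  exists (map_label f g l); last by rewrite /label_sign ol' mul1r label_type_map.
  by split; rewrite ?label_type_map.
have [[f' fK f'K] [g' gK g'K]] := (bf, bg).
have bf' : bijective f' by exists f.
have bg' : bijective g' by exists g.
have Eg' e : ends G (g' e) = (f' (ends H e).1, f' (ends H e).2).
  by rewrite -{2 3}(g'K e) Eg /= !fK -surjective_pairing.
have Eo' : ordr G = [seq match x with inl v => inl (f' v) | inr e => inr (g' e) end | x <- ordr H].
  rewrite Eo -map_comp -[LHS]map_id; apply: eq_map => -[v|e] /=; by rewrite ?fK ?gK.
have [hl' _] := labelled_map bf' bg' Eg' Eo' hl.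
by exists (map_label f' g' l); split; rewrite ?label_type_map.
Qed.

Lemma phi_reverse t a b c G (e : edge G) :
  phi t a b c (reverse_edge e) = (-1) ^+ N * phi t a b c G.
Proof.
rewrite -signr_odd hN expr1; apply: phi_transfer => l [hl tl gl].
  exists l; first by split=> //; rewrite labelled_reverse.
  by rewrite /label_sign label_odd_reverse // sgnN mulN1r.
by exists l; split=> //; rewrite -(labelled_reverse e).
Qed.

Lemma phi_reorder t a b c G (s : seq (cell G)) : admissible G -> perm_eq s (ordr G) ->
  phi t a b c (reorder s) = koszul m N (ordr G) s * phi t a b c G.
Proof.
case/and4P=> po _ _ _ ps; apply: phi_transfer => l [hl tl gl].
  exists l.
    split=> //; case/and5P: hl => _ h2 h3 h4 h5; apply/and5P; split=> //; exact: perm_trans ps po.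
  split=> //; rewrite (koszul_sign hm hN po ps (vs := label_verts l)); last by case/and5P: hl.
  rewrite /label_sign -sgnD /label_odd; congr sgn.
  have -> : count (@arc_flipped (reorder s)) (label_arcs l) = count (@arc_flipped G) (label_arcs l) by [].
  by case: (odd (count _ _)); case: (odd (inversions (@rank (reorder s)) _));
    case: (odd (inversions (@rank G) _)).
by exists l; split=> //; case/and5P: hl => _ h2 h3 h4 h5; apply/and5P; split.
Qed.

Definition Phi (t : nat * nat) (a b c : nat) (x : chain) : rat := fglift (phi t a b c) x.

Lemma PhiD t a b c x y : Phi t a b c (x + y) = Phi t a b c x + Phi t a b c y.
Proof. exact: (@fgliftD rat^o (phi t a b c) x y). Qed.

Lemma PhiZ t a b c r x : Phi t a b c (r *: x) = r * Phi t a b c x.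
Proof. exact: (@fgliftZ rat^o (phi t a b c) r x). Qed.

Lemma PhiN t a b c x : Phi t a b c (- x) = - Phi t a b c x.
Proof. by rewrite -scaleN1r PhiZ mulN1r. Qed.

Lemma PhiG t a b c G : Phi t a b c << G >> = phi t a b c G.
Proof. exact: (@fglift1 rat^o (phi t a b c) G). Qed.

Lemma Phi0 t a b c : Phi t a b c 0 = 0.
Proof. by rewrite -(scale0r (0 : chain)) PhiZ mul0r. Qed.

Lemma Phi_sum t a b c (I : Type) (r : seq I) (P : pred I) (F : I -> chain) :
  Phi t a b c (\sum_(i <- r | P i) F i) = \sum_(i <- r | P i) Phi t a b c (F i).
Proof. by apply: (big_morph (Phi t a b c)); [exact: PhiD | exact: Phi0]. Qed.

Lemma Phi_null t a b c x : null m N x -> Phi t a b c x = 0.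
Proof.
elim=> [|r y z Hy _ IH]; first exact: Phi0.
rewrite PhiD PhiZ IH addr0; apply/eqP; rewrite mulf_eq0; apply/orP; right; apply/eqP.
case: Hy => [G H _ _ iGH|G e _|G s aG ps]; rewrite PhiD PhiN ?PhiZ !PhiG.
- by rewrite (phi_iso _ _ _ _ iGH) subrr.
- by rewrite phi_reverse subrr.
- by rewrite phi_reorder // subrr.
Qed.

Lemma Phi_eqv t a b c x y : eqv m N x y -> Phi t a b c x = Phi t a b c y.
Proof. by move/(Phi_null t a b c); rewrite PhiD PhiN => /eqP; rewrite subr_eq0 => /eqP. Qed.

Lemma Phi_rep (u v : bool) x y z a b c : good_type (u : nat, v : nat, [:: x; y; z]) ->
  Phi (u : nat, v : nat) a b c (rep (u : nat, v : nat, [:: x; y; z])) = (weight x y z a b c)%:R.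
Proof.
move=> gt; have [G [l [hl tl ->]]] := repP (realizable_all u v x y z).
have gl : good_label (u : nat, v : nat) l by split=> //; rewrite tl.
by rewrite PhiZ PhiG (phi_label _ _ _ gl) mulrA sgn_sq mul1r tl.
Qed.

Lemma phi_index_swap12 t a b c G : phi t a b c G = phi t b a c G.
Proof.
have [[l hl]|nG] := classic (exists l : label (vert G) (edge G), good_label t l).
  by rewrite !(phi_label _ _ _ hl) /weight_seq weight_index_swap12.
by rewrite !phi_no_label // => l hl; apply: nG; exists l.
Qed.

Lemma phi_index_swap23 t a b c G : phi t a b c G = phi t a c b G.
Proof.
have [[l hl]|nG] := classic (exists l : label (vert G) (edge G), good_label t l).
  by rewrite !(phi_label _ _ _ hl) /weight_seq weight_index_swap23.
by rewrite !phi_no_label // => l hl; apply: nG; exists l.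
Qed.

Lemma Phi_index_swap12 t a b c x : Phi t a b c x = Phi t b a c x.
Proof. by rewrite /Phi !fglift_sum; apply: eq_bigr => G _; rewrite phi_index_swap12. Qed.

Lemma Phi_index_swap23 t a b c x : Phi t a b c x = Phi t a c b x.
Proof. by rewrite /Phi !fglift_sum; apply: eq_bigr => G _; rewrite phi_index_swap23. Qed.

End Functional.

(** * Homology *)

Section Hairy.

Lemma hairy_chainP i k (x : chain) : reflect
  (forall G, coeff G x != 0 -> [/\ two_loop_hairy G, defect G = i & hodge G = k])
  (hairy_chain i k x).
Proof.
apply: (iffP allP) => H G.
  by rewrite -mem_dom => /H /and3P [h1 /eqP h2 /eqP h3].
by rewrite mem_dom => /H [h1 h2 h3]; rewrite /= h1 h2 h3 !eqxx.
Qed.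

Lemma hairy_chain0 i k : hairy_chain i k 0.
Proof. by apply/hairy_chainP => G; rewrite coeff0 eqxx. Qed.

Lemma hairy_chainD i k x y : hairy_chain i k x -> hairy_chain i k y -> hairy_chain i k (x + y).
Proof.
move=> /hairy_chainP Hx /hairy_chainP Hy; apply/hairy_chainP => G; rewrite coeffD => ne0.
have [x0|/Hx //] := eqVneq (coeff G x) 0.
by apply: Hy; move: ne0; rewrite x0 add0r.
Qed.

Lemma hairy_chainZ i k a x : hairy_chain i k x -> hairy_chain i k (a *: x).
Proof.
move=> /hairy_chainP Hx; apply/hairy_chainP => G; rewrite coeffZ => ne0; apply: Hx.
by apply: contraNneq ne0 => ->; rewrite mulr0.
Qed.

Lemma hairy_chainG i k G : two_loop_hairy G -> defect G = i -> hodge G = k ->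
  hairy_chain i k << G >>.
Proof.
move=> h1 h2 h3; apply/hairy_chainP => H; rewrite coeffU mul1r.
by case: (G =P H) => [<-|_]; rewrite ?eqxx.
Qed.

Lemma hairy_chain_ind (i k : nat) (P : chain -> Prop) : P 0 ->
  (forall x y, P x -> P y -> P (x + y)) -> (forall a x, P x -> P (a *: x)) ->
  (forall G, two_loop_hairy G -> defect G = i -> hodge G = k -> P << G >>) ->
  forall x, hairy_chain i k x -> P x.
Proof.
move=> P0 PD PZ PG x /hairy_chainP Hx; rewrite (chain_sum x) big_seq.
by apply: big_ind => // G; rewrite mem_dom => /Hx [h1 h2 h3]; apply/PZ/PG.
Qed.

Lemma differentialD x y : differential (x + y) = differential x + differential y.
Proof. exact: fgliftD. Qed.

Lemma differentialZ a x : differential (a *: x) = a *: differential x.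
Proof. exact: fgliftZ. Qed.

Lemma differentialG G : differential << G >> = split_sum G.
Proof. exact: fglift1. Qed.

Lemma differential0 : differential 0 = 0.
Proof. exact: fglift0. Qed.

Lemma two_loop_hairy_label G : two_loop_hairy G ->
  exists (l : label (vert G) (edge G)) (a b : bool) x y z,
    [/\ labelled l, label_type l = (a : nat, b : nat, [:: x; y; z]), (b <= a)%N,
        defect G = (a + b)%N & hodge G = (a + b + x + y + z)%N].
Proof.
move=> hG; have [l hl le] := hairy_labelled hG.
have [a1 b1] := hairs_le1 hl; have /and4P [_ _ /eqP s3 _] := labelled_shape hl.
have hE := hodge_label hl; have dE := defect_label hl.
move: s3 hE; rewrite -(size_map (fun p => size p.1)).
case tn: [seq size p.1 | p <- strands l] => [|x [|y [|z []]]] // _ hE.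
have tE : label_type l = (size (source_hairs l) == 1%N : nat, size (target_hairs l) == 1%N : nat, [:: x; y; z]).
  by rewrite /label_type tn; case: (size _) a1 => [|[]] //; case: (size _) b1 => [|[]].
exists l, (size (source_hairs l) == 1%N), (size (target_hairs l) == 1%N), x, y, z; split=> //.
- by move: le; rewrite tE.
- by rewrite dE; case: (size _) a1 => [|[]] //; case: (size _) b1 => [|[]].
- rewrite hE tE /= !addn0 addnA addnA.
  by case: (size _) a1 => [|[]] //; case: (size _) b1 => [|[]].
Qed.

Lemma hairy_chain_rep (a b : bool) x y z : (0 < a + b + x + y + z)%N ->
  hairy_chain (a + b) (a + b + x + y + z) (rep (a : nat, b : nat, [:: x; y; z])).
Proof.
move=> hk; have [G [l [hl tl ->]]] := repP (realizable_all a b x y z).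
have hE := hodge_label hl; have dE := defect_label hl; case: (tl) => ta tb _.
rewrite tl ta tb /= addn0 !addnA in hE; rewrite ta tb in dE.
apply/hairy_chainZ/hairy_chainG => //; apply: labelled_hairy hl _.
by rewrite hE.
Qed.

End Hairy.

Section Boundaries.

Variables m N i k : nat.
Local Notation bd := (boundary m N i k).

Lemma boundary_null x : null m N x -> bd x.
Proof. by move=> Hx; exists 0; rewrite ?hairy_chain0 // differential0 subr0. Qed.

Lemma boundaryD x y : bd x -> bd y -> bd (x + y).
Proof.
move=> [u hu xu] [v hv yv]; exists (u + v); first exact: hairy_chainD.
by rewrite differentialD opprD addrACA; exact: nullD.
Qed.

Lemma boundaryZ a x : bd x -> bd (a *: x).
Proof.
move=> [u hu xu]; exists (a *: u); first exact: hairy_chainZ.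
by rewrite differentialZ -scalerBr; exact: nullZ.
Qed.

Lemma boundary_differential y : hairy_chain i.+1 k y -> bd (differential y).
Proof. by move=> hy; exists y; rewrite // subrr; exact: null0. Qed.

End Boundaries.

Section SplitSum.

Variables m N : nat.
Hypotheses (hm : odd m) (hN : odd N).

Local Notation "x ~~~ y" := (eqv m N x y) (at level 70).

Lemma split_sum_label G (l : label (vert G) (edge G)) : labelled l ->
  split_sum G = vertex_splits (source l) + vertex_splits (target l).
Proof.
move=> hl; have ne := source_target_neq hl.
rewrite (@split_sum_vertices G [:: source l; target l]); first last.
- move=> v; rewrite !inE negb_or => /andP [nA nB]; rewrite (valenceE hl).
  rewrite !(eq_sym _ v) (negbTE nA) (negbTE nB) !muln0.
  by have := vertex_count hl v; clear; lia.
- by rewrite /= /internal valence_source // valence_target //.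
- by rewrite /= inE andbT.
by rewrite !big_cons big_nil addr0.
Qed.

Lemma split_sum0 G (l : label (vert G) (edge G)) : labelled l ->
  (label_type l).1 = (0, 0)%N -> split_sum G = 0.
Proof.
move=> hl tl; rewrite (split_sum_label hl) !vertex_splits0 ?addr0 //.
  by rewrite valence_target // tl.
by rewrite valence_source // tl.
Qed.

Lemma split_sum1 G (l : label (vert G) (edge G)) x y z : labelled l ->
  label_type l = (1, 0, [:: x; y; z])%N ->
  split_sum G ~~~ - (label_sign l *: (rep (0, 0, [:: x.+1; y; z]) +
    rep (0, 0, [:: x; y.+1; z]) + rep (0, 0, [:: x; y; z.+1])))%N.
Proof.
move=> hl tl; rewrite (split_sum_label hl) [X in _ + X]vertex_splits0 ?addr0.
  exact: source_splits.
by rewrite valence_target // tl.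
Qed.

(** Both ends are four-valent. Splitting the target is splitting the source of the reversed label,
    whose sign is the same as [x + y + z] is odd. Turning the resulting types [(0, 1)] into [(1, 0)]
    cancels the minus sign of [source_splits], so the two ends contribute equally. *)
Lemma split_sum2 G (l : label (vert G) (edge G)) x y z : labelled l ->
  label_type l = (1, 1, [:: x; y; z])%N -> odd (x + y + z) ->
  split_sum G ~~~ (2 : rat) *: (label_sign l *: (rep (1, 0, [:: x.+1; y; z]) +
    rep (1, 0, [:: x; y.+1; z]) + rep (1, 0, [:: x; y; z.+1])))%N.
Proof.
move=> hl tl o; rewrite (split_sum_label hl).
have [hl' so] := labelled_rev hl; have tl' := label_type_rev l; rewrite tl /= in tl'.
have sE : label_sign (rev_label l) = label_sign l.
  have [sA sB _] := tl.
  by rewrite /label_sign so sA sB tl /= addn0 addnA o !addbF.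
have H1 := source_splits hm hN hl tl; have H2 := source_splits hm hN hl' tl'.
rewrite sE in H2.
have neg x' y' z' : (0 < x' + y' + z')%N -> ~~ odd (x' + y' + z') ->
    rep (0, 1, [:: x'; y'; z'])%N ~~~ - rep (1, 0, [:: x'; y'; z'])%N.
  move=> pos ev; have := rep_rev (m := m) hm hN (a := false) (b := true) (x := x') (y := y') (z := z').
  by rewrite /= ev scaleN1r; apply; lia.
set X := (_ + _ + _) in H2 *; 
have HX : X ~~~ - (rep (1, 0, [:: x.+1; y; z])%N +
    rep (1, 0, [:: x; y.+1; z])%N + rep (1, 0, [:: x; y; z.+1])%N).
  rewrite !opprD; apply: eqvD; first apply: eqvD; apply: neg; rewrite ?addnS ?addSn //= o //.
set Y := (_ + _ + _) in HX *.
rewrite (_ : 2 *: _ = label_sign l *: Y + label_sign l *: Y); last first.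
  by rewrite -mulr2n -scaler_nat.
have HY : - (label_sign l *: X) ~~~ label_sign l *: Y.
  by rewrite -[Y]opprK scalerN; apply/eqvN/eqvZ.
apply: eqvD; first by apply: eqv_trans H1 _.
by apply: eqv_trans H2 _.
Qed.

End SplitSum.

Lemma triple_sort (P : nat -> nat -> nat -> Prop) :
  (forall x y z, P x y z -> P y x z) -> (forall x y z, P x y z -> P x z y) ->
  (forall x y z, (z <= y <= x)%N -> P x y z) -> forall x y z, P x y z.
Proof.
move=> s12 s23 H x y z.
case: (leqP x y) => xy; case: (leqP y z) => yz; case: (leqP x z) => xz.
- by apply/s12/s23/s12/H; lia.
- by exfalso; lia.
- by apply/s12/s23/H; lia.
- by apply/s12/H; lia.
- by apply/s23/s12/H; lia.
- by apply/s23/H; lia.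
- by exfalso; lia.
- by apply/H; lia.
Qed.

Lemma lower_sumD (f g : nat -> nat -> nat -> rat) a b c :
  lower_sum (fun a b c => f a b c + g a b c) a b c = lower_sum f a b c + lower_sum g a b c.
Proof. by rewrite /lower_sum; case: a; case: b; case: c => * /=; ring. Qed.

Lemma lower_sumZ r (f : nat -> nat -> nat -> rat) a b c :
  lower_sum (fun a b c => r * f a b c) a b c = r * lower_sum f a b c.
Proof. by rewrite /lower_sum; case: a; case: b; case: c => * /=; ring. Qed.

Lemma eq_lower_sum (f g : nat -> nat -> nat -> rat) a b c : (forall a b c, f a b c = g a b c) ->
  lower_sum f a b c = lower_sum g a b c.
Proof. by move=> E; rewrite /lower_sum; case: a; case: b; case: c => * /=; rewrite ?E. Qed.

(** * Kernel and cokernel of the multiplication by X + Y + Z *)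

Section Homology.

Variables m N : nat.
Hypotheses (hm : odd m) (hN : odd N).
(** One argument serves both maps: [s = false] is the map from defect 1 to defect 0 in Hodge degree
    [K], and [s = true] the map from defect 2 to defect 1 in Hodge degree [K + 1]. In both cases [K]
    is the degree of the polynomials in the target. *)
Variables (s : bool) (K : nat).
Hypotheses (hK : ~~ odd K) (hk : (0 < s + K)%N).

Local Notation "x ~~~ y" := (eqv m N x y) (at level 70).
Local Notation low x y z := (rep (s : nat, false : nat, [:: x; y; z])).
Local Notation upp x y z := (rep (true : nat, s : nat, [:: (x : nat); (y : nat); (z : nat)])).

(** The 2 counts the two four-valent ends of a graph of defect 2; the -1 is the sign of a single
    split. *)
Local Notation coef := (if s then 2 else - 1 : rat).

Lemma coef_neq0 : coef != 0. Proof. by case: (s). Qed.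

Lemma split_sum_upper G (l : label (vert G) (edge G)) x y z : labelled l ->
  label_type l = (true : nat, s : nat, [:: x; y; z]) -> (x + y + z).+1 = K ->
  split_sum G ~~~ (coef * label_sign l) *: (low x.+1 y z + low x y.+1 z + low x y z.+1).
Proof.
move=> hl; case: (s) => /= tl sK.
  by rewrite -scalerA; apply: split_sum2 => //; move: hK; rewrite -sK /= negbK.
by rewrite mulN1r scaleNr; apply: split_sum1.
Qed.

Lemma differential_upper x y z : (x + y + z).+1 = K ->
  differential (upp x y z) ~~~ coef *: (low x.+1 y z + low x y.+1 z + low x y z.+1).
Proof.
move=> sK; have [G [l [hl tl ->]]] := repP (realizable_all true s x y z).
rewrite differentialZ differentialG.
apply: eqv_trans (eqvZ (label_sign l) (split_sum_upper hl tl sK)) _.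
by rewrite scalerA mulrCA sgn_sq mulr1; exact: eqv_refl.
Qed.

Lemma hairy_lower x y z : (x + y + z = K)%N -> hairy_chain s (s + K) (low x y z).
Proof.
move=> sK; have := @hairy_chain_rep s false x y z.
by rewrite !addn0 -!addnA (addnA x) sK; apply.
Qed.

Lemma hairy_upper x y z : (x + y + z).+1 = K -> hairy_chain s.+1 (s + K) (upp x y z).
Proof.
move=> sK; have := @hairy_chain_rep true s x y z.
by rewrite -sK add1n !addSn addnS !addnA; apply.
Qed.

Lemma hairy_lower_label G : two_loop_hairy G -> defect G = s -> hodge G = (s + K)%N ->
  exists (l : label (vert G) (edge G)) x y z,
    [/\ labelled l, label_type l = (s : nat, false : nat, [:: x; y; z]) & (x + y + z = K)%N].
Proof.
move=> /two_loop_hairy_label [l [a [b [x [y [z [hl tl ba dE hE]]]]]]] dG hG.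
rewrite dE in dG; rewrite hE in hG; exists l, x, y, z; rewrite tl.
case: (a) (b) (s) ba dG hG => [] [] [] //= _ _ hG; split=> //; lia.
Qed.

Lemma hairy_upper_label G : two_loop_hairy G -> defect G = s.+1 -> hodge G = (s + K)%N ->
  exists (l : label (vert G) (edge G)) x y z,
    [/\ labelled l, label_type l = (true : nat, s : nat, [:: x; y; z]) & (x + y + z).+1 = K].
Proof.
move=> /two_loop_hairy_label [l [a [b [x [y [z [hl tl ba dE hE]]]]]]] dG hG.
rewrite dE in dG; rewrite hE in hG; exists l, x, y, z; rewrite tl.
case: (a) (b) (s) ba dG hG => [] [] [] //= _ _ hG; split=> //; lia.
Qed.

Lemma good_lower x y z : (x + y + z = K)%N -> good_type (s : nat, false : nat, [:: x; y; z]).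
Proof. by rewrite /good_type /= addn0 addnA => -> /=; case: (s) => // _; apply: negbTE. Qed.

Lemma good_upper x y z : (x + y + z).+1 = K -> good_type (true : nat, s : nat, [:: x; y; z]).
Proof.
rewrite /good_type /= addn0 addnA => sK; case: (s) => // _.
by move: hK; rewrite -sK /= negbK.
Qed.

Local Notation lower_t := (s : nat, false : nat).
Local Notation upper_t := (true : nat, s : nat).

Lemma Phi_lower x y z a b c : (x + y + z = K)%N ->
  Phi lower_t a b c (low x y z) = (weight x y z a b c)%:R.
Proof. by move=> sK; apply/Phi_rep/good_lower. Qed.

Lemma Phi_differential y a b c : hairy_chain s.+1 (s + K) y ->
  Phi lower_t a b c (differential y) = coef * lower_sum (fun a b c => Phi upper_t a b c y) a b c.
Proof.
move=> hy; move: y hy a b c; apply: hairy_chain_ind.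
- move=> a b c; rewrite differential0 Phi0 (@eq_lower_sum _ (fun _ _ _ => 0)); last by move=> *; apply: Phi0.
  by rewrite /lower_sum; case: a; case: b; case: c => * /=; rewrite !addr0 mulr0.
- move=> x y Hx Hy a b c; rewrite differentialD PhiD Hx Hy -mulrDr -lower_sumD.
  by congr (_ * _); apply: eq_lower_sum => *; rewrite PhiD.
- move=> r x Hx a b c; rewrite differentialZ PhiZ Hx mulrCA -(lower_sumZ r).
  by congr (_ * _); apply: eq_lower_sum => *; rewrite PhiZ.
move=> G hG dG kG a b c; have [l [x [y [z [hl tl sK]]]]] := hairy_upper_label hG dG kG.
rewrite differentialG (Phi_eqv hm hN _ _ _ _ (split_sum_upper hl tl sK)).
rewrite PhiZ !PhiD !Phi_lower ?addSn ?addnS ?addSn // weight_raise -mulrA -(lower_sumZ (label_sign l)).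
congr (_ * _); apply: eq_lower_sum => a' b' c'; rewrite PhiG.
have gl : good_label upper_t l by split=> //; rewrite tl //; apply: good_upper.
by rewrite (phi_label _ _ _ gl) tl.
Qed.

Lemma Phi_upper_degree y a b c : hairy_chain s.+1 (s + K) y -> (a + b + c).+1 != K ->
  Phi upper_t a b c y = 0.
Proof.
move=> hy ne; move: y hy; apply: hairy_chain_ind.
- exact: Phi0.
- by move=> x y Hx Hy; rewrite PhiD Hx Hy addr0.
- by move=> r x Hx; rewrite PhiZ Hx mulr0.
move=> G hG dG kG; have [l [x [y [z [hl tl sK]]]]] := hairy_upper_label hG dG kG.
have gl : good_label upper_t l by split=> //; rewrite tl //; apply: good_upper.
rewrite PhiG (phi_label _ _ _ gl) tl /weight_seq /=.
have [->|/weight_sum E] := eqVneq (weight x y z a b c) 0%N; first by rewrite mulr0.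
by rewrite -E sK eqxx in ne.
Qed.

Lemma Phi_upper_eq0 y : hairy_chain s.+1 (s + K) y ->
  (forall a b c, (c <= b <= a)%N -> Phi lower_t a.+1 b c (differential y) = 0) ->
  forall a b c, Phi upper_t a b c y = 0.
Proof.
(* The source polynomials have degree one less than [K]. *)
move=> hy H; apply: (lower_sum_inj (K := K.-1)).
- by move=> a b c; exact: Phi_index_swap12.
- by move=> a b c; exact: Phi_index_swap23.
- move=> a b c ne; apply: Phi_upper_degree => //; apply: contraNneq ne => <-; exact: eqxx.
move=> a b c /H; rewrite Phi_differential // => /eqP.
by rewrite mulf_eq0 (negbTE coef_neq0) => /eqP.
Qed.

Lemma big_triple_eq (f : nat -> nat -> nat -> chain) n x y z : (x < n)%N -> (y < n)%N -> (z < n)%N ->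
  \sum_(a < n) \sum_(b < n) \sum_(c < n) (triple_eq x y z a b c)%:R *: f a b c = f x y z.
Proof.
move=> hx hy hz; rewrite (bigD1 (Ordinal hx)) //= [X in _ + X]big1 ?addr0; last first.
  move=> a ax; rewrite big1 // => b _; rewrite big1 // => c _.
  have := negbTE ax; rewrite -val_eqE eq_sym /triple_eq /= => ->; exact: scale0r.
rewrite (bigD1 (Ordinal hy)) //= [X in _ + X]big1 ?addr0; last first.
  move=> a ax; rewrite big1 // => c _.
  have := negbTE ax; rewrite -val_eqE eq_sym /triple_eq /= => ->; rewrite andbF; exact: scale0r.
rewrite (bigD1 (Ordinal hz)) //= [X in _ + X]big1 ?addr0; last first.
  move=> a ax; have := negbTE ax; rewrite -val_eqE eq_sym /triple_eq /= => ->; rewrite !andbF; exact: scale0r.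
by rewrite /triple_eq !eqxx scale1r.
Qed.

(** On a graph of type [(x, y, z)] the right-hand side collects the six permutations of the
    exponents, all representing the class of the graph; hence the factor 6. The exponents add up to
    [K - 1], so the ranges suffice. *)
Lemma upper_expansion x : hairy_chain s.+1 (s + K) x ->
  (6 : rat) *: x ~~~ \sum_(a < K) \sum_(b < K) \sum_(c < K) Phi upper_t a b c x *: upp a b c.
Proof.
move: x; apply: hairy_chain_ind.
- rewrite scaler0 big1 => [|a _]; first exact: eqv_refl.
  by rewrite big1 // => b _; rewrite big1 // => c _; rewrite Phi0 scale0r.
- move=> x y Hx Hy; rewrite scalerDr; apply: eqv_trans (eqvD Hx Hy) _.
  rewrite -big_split /=; under eq_bigr => a _ do (rewrite -big_split /=; under eq_bigr => b _ do
    (rewrite -big_split /=; under eq_bigr => c _ do rewrite -scalerDl -PhiD)).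
  exact: eqv_refl.
- move=> r x Hx; rewrite scalerA mulrC -scalerA; apply: eqv_trans (eqvZ r Hx) _.
  rewrite scaler_sumr; under eq_bigr => a _ do (rewrite scaler_sumr; under eq_bigr => b _ do
    (rewrite scaler_sumr; under eq_bigr => c _ do rewrite scalerA -PhiZ)).
  exact: eqv_refl.
move=> G hG dG kG; have [l [x [y [z [hl tl sK]]]]] := hairy_upper_label hG dG kG.
have gl : good_label upper_t l by split=> //; rewrite tl //; apply: good_upper.
have GE : << G >> ~~~ label_sign l *: upp x y z.
  by rewrite -tl; apply: graph_eqv_rep => //; rewrite tl /type_hodge /=.
apply: eqv_trans (eqvZ 6 GE) _.
under [X in _ ~~~ X]eq_bigr => a _ do under eq_bigr => b _ do under eq_bigr => c _ do
  rewrite PhiG (phi_label _ _ _ gl) tl /weight_seq /= mulrC -scalerA /weight !natrD !scalerDl.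
under [X in _ ~~~ X]eq_bigr => a _ do under eq_bigr => b _ do rewrite !big_split.
under [X in _ ~~~ X]eq_bigr => a _ do rewrite !big_split.
rewrite !big_split /=.
rewrite !(big_triple_eq (fun a b c => label_sign l *: upp a b c)); try by rewrite -sK; clear; lia.
have p12 a b c : upp a b c ~~~ upp b a c by apply: (rep_swap12 hm hN (a := true)).
have p23 a b c : upp a b c ~~~ upp a c b by apply: (rep_swap23 hm hN (a := true)).
rewrite (_ : 6 *: _ = label_sign l *: upp x y z + label_sign l *: upp x y z +
  label_sign l *: upp x y z + label_sign l *: upp x y z + label_sign l *: upp x y z +
  label_sign l *: upp x y z); last by rewrite -!scalerDl scalerA; congr (_ *: _); ring.
do !apply: eqvD; apply: eqvZ.
- exact: eqv_refl.
- exact: p23.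
- exact: p12.
- exact: eqv_trans (p12 _ _ _) (p23 _ _ _).
- exact: eqv_trans (p23 _ _ _) (p12 _ _ _).
- exact: eqv_trans (p12 _ _ _) (eqv_trans (p23 _ _ _) (p12 _ _ _)).
Qed.

Lemma upper_null x : hairy_chain s.+1 (s + K) x ->
  (forall a b c, Phi upper_t a b c x = 0) -> null m N x.
Proof.
move=> hx H; have := upper_expansion hx.
rewrite big1 => [|a _]; last by rewrite big1 // => b _; rewrite big1 // => c _; rewrite H scale0r.
move/null_eqv0/(nullZ (6^-1)); rewrite scalerA mulVf ?scale1r //.
Qed.

Local Notation bd := (boundary m N s (s + K)).
(** The number of [j] with [6 j <= K]. *)
Local Notation d := ((K %/ 6).+1).

Definition basis_chain (j : 'I_d) : chain := low (K./2 - j)%N (K./2 - j)%N (2 * j)%N.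

Lemma basis_size (j : 'I_d) : (K./2 - j + (K./2 - j) + 2 * j = K)%N.
Proof. have := ltn_ord j; lia. Qed.

Definition spanned (x : chain) : Prop :=
  exists c : 'I_d -> rat, bd (x - \sum_j c j *: basis_chain j).

Lemma spanned_bd x : bd x -> spanned x.
Proof.
move=> bx; exists (fun _ => 0).
by rewrite big1 ?subr0 // => j _; rewrite scale0r.
Qed.

Lemma spannedD x y : spanned x -> spanned y -> spanned (x + y).
Proof.
move=> [c hc] [c' hc']; exists (fun j => c j + c' j).
under eq_bigr => j _ do rewrite scalerDl.
by rewrite big_split opprD addrACA; exact: boundaryD.
Qed.

Lemma spannedZ r x : spanned x -> spanned (r *: x).
Proof.
move=> [c hc]; exists (fun j => r * c j); under eq_bigr => j _ do rewrite -scalerA.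
by rewrite -scaler_sumr -scalerBr; exact: boundaryZ.
Qed.

Lemma spanned_eqv x y : x ~~~ y -> spanned y -> spanned x.
Proof.
move=> xy [c hc]; exists c; rewrite -(subrKA y x).
by apply: boundaryD => //; apply: boundary_null.
Qed.

Lemma spanned_basis j : spanned (basis_chain j).
Proof.
exists (fun i => (i == j)%:R); rewrite (bigD1 j) //= eqxx scale1r big1 ?addr0 ?subrr.
  exact/boundary_null/null0.
by move=> i /negbTE ->; exact: scale0r.
Qed.

Lemma spanned_upper x y z : (x + y + z).+1 = K ->
  spanned (low x.+1 y z + low x y.+1 z + low x y z.+1).
Proof.
move=> sK; have := spannedZ coef^-1 (spanned_bd (boundary_differential m N (hairy_upper sK))).
apply: spanned_eqv; have := eqvZ coef^-1 (differential_upper sK).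
by rewrite scalerA mulVf ?coef_neq0 // scale1r; exact: eqv_sym.
Qed.

Lemma low_swap12 x y z : (x + y + z = K)%N -> low x y z ~~~ low y x z.
Proof. by move=> sK; apply: (rep_swap12 hm hN (b := false)); lia. Qed.

Lemma low_swap23 x y z : (x + y + z = K)%N -> low x y z ~~~ low x z y.
Proof. by move=> sK; apply: (rep_swap23 hm hN (b := false)); lia. Qed.

(** For sorted exponents with [x] maximal, either [x = y] and the monomial is in the basis, or the
    boundary of the generator at [(x-1, y, z)] expresses it by monomials with smaller maximum. When
    [y] or [z] equals [x - 1], some of these are permutations of the monomial itself, and it occurs
    with a factor 2 or 3, invertible over the rationals. *)
Lemma spanned_low x y z : (x + y + z = K)%N -> spanned (low x y z).
Proof.
suff H n : forall x y z, [&& x < n, y < n & z < n]%N -> (x + y + z = K)%N -> spanned (low x y z).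
  by move=> sK; apply: (H K.+1) => //; lia.
elim: n => [//|n IH]; apply: triple_sort => [{}x {}y {}z H lt sK|{}x {}y {}z H lt sK|{}x {}y {}z zyx lt sK].
- by apply: spanned_eqv (low_swap12 sK) (H _ _); lia.
- by apply: spanned_eqv (low_swap23 sK) (H _ _); lia.
have [xn|nx] := ltnP x n; first by apply: IH; lia.
have xE : x = n by lia.
have [ny|yn] := leqP n y.
  have yE : y = x by lia.
  (* [z] is even because [K = 2n + z] is, and [3z <= K] because [z <= n]. *)
  have jlt : (z./2 < d)%N by move: hK; lia.
  have := spanned_basis (Ordinal jlt); rewrite /basis_chain /=.
  by have -> : (K./2 - z./2 = n)%N; [move: hK; lia|]; have -> : (2 * z./2 = z)%N; [move: hK; lia|]; rewrite yE xE.
case: n IH xE yn lt {nx} => // n IH xE yn lt; subst x.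
have sK' : (n + y + z).+1 = K by lia.
have Sp := spanned_upper sK'.
have spannedK a b : spanned (a + b) -> spanned b -> spanned a.
  by move=> Sab Sb; rewrite -(addrK b a); apply: spannedD Sab _; rewrite -scaleN1r; exact: spannedZ.
have [yn1|yn1] := ltnP y.+1 n.+1.
  have S1 := IH n y.+1 z ltac:(lia) ltac:(lia).
  have S2 := IH n y z.+1 ltac:(lia) ltac:(lia).
  exact: spannedK (spannedK _ _ Sp S2) S1.
have yE : y = n by lia.
subst y.
(* The second term of the relation is now a permutation of the first, so twice the monomial is
   spanned. *)
have [zn|nz] := ltnP z n.
  have S2 := spannedK _ _ Sp (IH n n z.+1 ltac:(lia) ltac:(lia)).
  suff : spanned ((2 : rat) *: low n.+1 n z).
    by move/(spannedZ 2^-1); rewrite scalerA mulVf // scale1r.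
  apply: spanned_eqv S2; rewrite scaler_nat mulr2n; apply: eqvD; first exact: eqv_refl.
  by apply: low_swap12; lia.
(* Here all three terms of the relation are permutations of one monomial. *)
have zE : z = n by lia.
subst z; suff : spanned ((3 : rat) *: low n.+1 n n).
  by move/(spannedZ 3^-1); rewrite scalerA mulVf // scale1r.
apply: spanned_eqv Sp; rewrite scaler_nat !mulrS mulr0n addr0 addrA.
have e12 : low n.+1 n n ~~~ low n n.+1 n by apply: low_swap12; lia.
apply: eqvD; first by apply: eqvD => //; exact: eqv_refl.
by apply: eqv_trans e12 _; apply: low_swap23; lia.
Qed.

Lemma spanned_hairy x : hairy_chain s (s + K) x -> spanned x.
Proof.
move: x; apply: hairy_chain_ind.
- exact/spanned_bd/boundary_null/null0.
- exact: spannedD.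
- exact: spannedZ.
move=> G hG dG kG; have [l [x [y [z [hl tl sK]]]]] := hairy_lower_label hG dG kG.
have pos : (0 < type_hodge (label_type l))%N by rewrite tl /type_hodge /=; lia.
apply: spanned_eqv (graph_eqv_rep hm hN hl pos) _; rewrite tl.
exact/spannedZ/spanned_low.
Qed.

Lemma Phi_basis (j : 'I_d) a b c :
  Phi lower_t a b c (basis_chain j) = (weight (K./2 - j) (K./2 - j) (2 * j) a b c)%:R.
Proof. exact/Phi_lower/basis_size. Qed.

(** From [6 j <= K] follows [2j <= K/2 - j]: the two largest exponents of a basis monomial agree, so
    no single exponent is strictly largest. *)
Lemma weight_basis_gt (j : 'I_d) a b c : (c <= b <= a)%N ->
  weight (K./2 - j) (K./2 - j) (2 * j) a.+1 b c = 0%N.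
Proof.
move=> cba; have := ltn_ord j; rewrite /weight /triple_eq => lt.
by lia.
Qed.

Lemma weight_basis_neq (i j : 'I_d) : i != j ->
  weight (K./2 - i) (K./2 - i) (2 * i) (K./2 - j) (K./2 - j) (2 * j) = 0%N.
Proof.
rewrite -val_eqE /= => ij; have := ltn_ord i; have := ltn_ord j; rewrite /weight /triple_eq => lt lt'.
by lia.
Qed.

(** Basis monomials do not contribute to the coefficients tested by [lower_sum_inj], so a bounding
    chain [y] has zero polynomial. All coefficients of the combination then vanish, and the one at
    the [j]-th exponents is [c j] times a positive weight. *)
Lemma basis_free (c : 'I_d -> rat) : bd (\sum_j c j *: basis_chain j) -> forall j, c j = 0.
Proof.
move=> [y hy nul]; set zs := \sum_j _ in nul.
have E a b e : Phi lower_t a b e zs = Phi lower_t a b e (differential y).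
  exact: (Phi_eqv hm hN).
have P0 := Phi_upper_eq0 hy.
have zsE a b e : Phi lower_t a b e zs =
    \sum_j c j * (weight (K./2 - j) (K./2 - j) (2 * j) a b e)%:R.
  by rewrite Phi_sum; apply: eq_bigr => j _; rewrite PhiZ Phi_basis.
have {}P0 : forall a b e, Phi upper_t a b e y = 0.
  apply: P0 => a b e le; rewrite -E zsE big1 // => j _.
  by rewrite weight_basis_gt ?mulr0.
move=> j; have := E (K./2 - j)%N (K./2 - j)%N (2 * j)%N.
rewrite Phi_differential // (@eq_lower_sum _ (fun _ _ _ => 0)) //.
have -> : lower_sum (fun _ _ _ => 0 : rat) (K./2 - j) (K./2 - j) (2 * j) = 0.
  by rewrite /lower_sum; case: (_ - _)%N; case: (2 * j)%N => * /=; rewrite !addr0.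
rewrite mulr0 zsE (bigD1 j) //= big1 ?addr0 => [/eqP|i ij]; last by rewrite weight_basis_neq ?mulr0.
rewrite mulf_eq0 pnatr_eq0; have := weight_self (K./2 - j) (K./2 - j) (2 * j).
by case: (weight _ _ _ _ _ _) => // ? _ /orP [/eqP|].
Qed.

Lemma lower_homology :
  (forall x y z, (x + y + z = K)%N -> null m N (differential (low x y z))) ->
  homology_dim m N s (s + K) d.
Proof.
move=> cyc; exists basis_chain; split.
- by move=> j; split; [apply: hairy_lower | apply: cyc]; exact: basis_size.
- exact: basis_free.
- by move=> x [hx _]; exact: spanned_hairy.
Qed.

Lemma upper_homology : homology_dim m N s.+1 (s + K) 0.
Proof.
exists (fun _ => 0); split; [by case|by move=> ? _ []|].
move=> x [hx dx]; exists (fun _ => 0); rewrite big_ord0 subr0; apply/boundary_null/upper_null => //.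
apply: Phi_upper_eq0 => // a b c _; exact: (Phi_null hm hN).
Qed.

End Homology.

Section LowDefect.

Variables m N : nat.
Hypotheses (hm : odd m) (hN : odd N).

Local Notation "x ~~~ y" := (eqv m N x y) (at level 70).

(** Reversal keeps this type and changes the sign, so the class equals its negative and vanishes
    over the rationals. *)
Lemma null_rep_odd x y z : odd (x + y + z) -> null m N (rep (0, 0, [:: x; y; z])%N).
Proof.
move=> o; have := rep_rev (m := m) hm hN (a := false) (b := false) (x := x) (y := y) (z := z).
rewrite /= o scaleN1r => /(_ ltac:(lia)); rewrite /eqv opprK -mulr2n -scaler_nat.
by move/(nullZ 2^-1); rewrite scalerA mulVf // scale1r.
Qed.

Lemma null_hairy0 k x : odd k -> hairy_chain 0 k x -> null m N x.
Proof.
move=> ok; move: x; apply: hairy_chain_ind; [exact: null0|exact: nullD|exact: nullZ|].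
move=> G /two_loop_hairy_label [l [a [b [x [y [z [hl tl ba -> ->]]]]]]] dG hG.
have := graph_eqv_rep (m := m) hm hN hl.
have [a0 b0] : a = false /\ b = false by case: (a) (b) dG => [] [].
rewrite tl a0 b0 in hG *; rewrite /type_hodge /= => /(_ ltac:(lia)).
move/eqv_null; apply; apply/nullZ/null_rep_odd; by rewrite (_ : x + y + z = k)%N //; lia.
Qed.

Lemma differential_rep0 x y z : differential (rep (0, 0, [:: x; y; z])%N) = 0.
Proof.
have [G [l [hl tl ->]]] := repP (realizable_all false false x y z).
by rewrite differentialZ differentialG (split_sum0 hl) ?scaler0 // tl.
Qed.

(** Each term of the differential has no hair at the ends and an odd number of hairs on the strands,
    and is null by [null_rep_odd]. *)
Lemma null_differential_rep1 x y z : ~~ odd (x + y + z) ->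
  null m N (differential (rep (1, 0, [:: x; y; z])%N)).
Proof.
move=> ev; have [G [l [hl tl ->]]] := repP (realizable_all true false x y z).
rewrite differentialZ differentialG; apply: nullZ.
apply: (eqv_null (split_sum1 hm hN hl tl)); apply/nullN/nullZ.
by apply: nullD; [apply: nullD|]; apply: null_rep_odd; rewrite ?addnS ?addSn /= ev.
Qed.

End LowDefect.

Lemma ceil_div6 (k q : nat) : (6 * q < k <= 6 * q.+1)%N ->
  `|Num.ceil (k%:R / 6%:R : rat)|%N = q.+1.
Proof.
move=> /andP [lo hi]; rewrite (_ : Num.ceil _ = (q.+1)%:Z) //.
apply: ceil_def; rewrite (_ : (q.+1)%:Z - 1 = q%:Z); last by lia.
rewrite ltr_pdivlMr ?ler_pdivrMr ?ltr0n // -!pmulrn -!natrM ltr_nat ler_nat.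
by rewrite ![(_ * 6)%N]mulnC lo.
Qed.

Theorem theorem6p1 (m N : nat) (hm : odd m) (hN : odd N) (k : nat) (hk : (1 <= k)%N) :
  homology_dim m N 0 k
    (if odd k then 0%N else `|Num.ceil (k.+1%:R / 6%:R : rat)|%N) /\
  homology_dim m N 1 k
    (if odd k then `|Num.ceil (k%:R / 6%:R : rat)|%N else 0%N).
Proof.
have [ok|ek] := boolP (odd k).
  (* For odd [k] everything in defect 0 is null, so all of defect 1 consists of cycles and its
     homology is the cokernel for [s = true] and [K = k - 1]. *)
  have hk' : (true + k.-1 = k)%N by rewrite add1n prednK.
  have ek : ~~ odd k.-1 by move: ok; rewrite -{1}hk' /= oddD.
  split.
    exists (fun _ => 0); split; [by case|by move=> ? _ []|].
    move=> x [hx _]; exists (fun _ => 0); rewrite big_ord0 subr0.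
    exact/boundary_null/(null_hairy0 hm hN ok).
  (* Both dimension formulas are the ceiling of [(K + 1) / 6], here with [K + 1 = k]. An even [K] is
     [6q], [6q + 2] or [6q + 4], so this ceiling is [q + 1], the size of the basis. *)
  rewrite (ceil_div6 (q := k.-1 %/ 6)); last by clear -ok hk; lia.
  rewrite -[k in homology_dim _ _ _ k]hk'; apply: (lower_homology hm hN (s := true) ek) => // x y z sK.
  by apply: (null_differential_rep1 hm hN); rewrite sK.
split; last exact: (upper_homology hm hN (s := false) ek).
rewrite (ceil_div6 (q := k %/ 6)); last by clear -ek hk; lia.
apply: (lower_homology hm hN (s := false) ek) => // x y z _.
by rewrite differential_rep0; exact: null0.
Qed.
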